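(* (Failure energy of rectifiable cracks in the limit $\epsilon\to0$.) Let $R_t\subset\Omega$ be a fixed $\mathcal{H}^{d-1}$-measurable rectifiable crack set, i.e. there exist countably many compact subsets $K_i$ of $(d-1)$-dimensional $C^1$ graphs with $\mathcal{H}^{d-1}(R_t\setminus\bigcup_{i\ge1}K_i)=0$. For each $\epsilon>0$ let the failure set $\Gamma^\epsilon(t)$ consist of the pairs $(\mathbf{x},\mathbf{y})\in\Omega\times(\Omega\cap H_\epsilon(\mathbf{x}))$ for which the segment joining $\mathbf{x}$ and $\mathbf{y}$ meets $R_t$ (points on one side of $R_t$ are no longer influenced by forces due to points on the other side). Then $$\lim_{\epsilon\to0}\mathcal{F}^\epsilon(t)=\mathcal{G}_c\,\mathcal{H}^{d-1}(R_t),$$ where $\mathcal{H}^{d-1}$ is $(d-1)$-dimensional Hausdorff measure.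
   Context: Let $d\in\{2,3\}$, $\Omega\subset\mathbb{R}^d$ a bounded domain (open), $C^+>0$ a constant (asymptotic value of the bond potential). $H_\epsilon(\mathbf{x})=\{\mathbf{y}:|\mathbf{y}-\mathbf{x}|<\epsilon\}$; $\omega_n$ is the volume of the unit ball in $\mathbb{R}^n$ ($\omega_1=2,\omega_2=\pi,\omega_3=4\pi/3$). The kernel is $\rho^\epsilon(\mathbf{y},\mathbf{x})=\chi_\Omega(\mathbf{y})J(|\mathbf{y}-\mathbf{x}|/\epsilon)/(\epsilon\,\omega_d\epsilon^d)$, where $J:[0,\infty)\to[0,\infty)$ is decreasing, positive on $[0,1)$, $J(0)=M<\infty$, $J=0$ on $[1,\infty)$. With $\chi^+(\mathbf{y},\mathbf{x},t)=1$ if $(\mathbf{x},\mathbf{y})\in\Gamma^\epsilon(t)$ and $0$ otherwise, the failure energy is $\mathcal{F}^\epsilon(t)=\int_\Omega\int_\Omega\rho^\epsilon(\mathbf{y},\mathbf{x})\,C^+\,\chi^+(\mathbf{y},\mathbf{x},t)\,d\mathbf{y}\,d\mathbf{x}$. The critical energy release rate of the model is $\mathcal{G}_c=C^+\frac{2\omega_{d-1}}{\omega_d}\int_0^1 q^dJ(q)\,dq$. *)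

(* Defs.v *)
From HB Require Import structures.
From mathcomp Require Import all_boot all_order all_algebra.
From mathcomp Require Import all_classical all_reals all_analysis.

Set Implicit Arguments.
Unset Strict Implicit.
Unset Printing Implicit Defensive.

Import Order.TTheory GRing.Theory Num.Theory.
Import numFieldNormedType.Exports.

Local Open Scope classical_set_scope.
Local Open Scope ring_scope.

(* R^n is 'rV[R]_n.  Its library norm is the sup norm, used here only through
   the topology and boundedness; metric quantities use the Euclidean norm. *)

Section euclidean.
Context {R : realType} {n : nat}.
Implicit Types x y : 'rV[R]_n.

Definition edot x y : R := \sum_(i < n) x 0 i * y 0 i.

Definition enorm x : R := Num.sqrt (edot x x).

Definition eball x (r : R) : set 'rV[R]_n := [set y | enorm (y - x) < r].

Definition segment x y : set 'rV[R]_n :=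
  [set (1 - s) *: x + s *: y | s in `[0, 1]].

End euclidean.

Definition rV_display : measure_display -> measure_display.
Proof. exact. Qed.

(* Borel sigma-algebra of R^n, as the product sigma-algebra generated by the
   coordinate functions. *)
Section measurable_rV.
Context {R : realType} {n : nat}.

Let coord (i : 'I_n) (x : 'rV[R]_n) : R := x 0 i.

Let rV_set0 : g_sigma_preimage coord set0.
Proof. exact: sigma_algebra0. Qed.

Let rV_setC A : g_sigma_preimage coord A -> g_sigma_preimage coord (~` A).
Proof. exact: sigma_algebraC. Qed.

Let rV_bigcup (F : (set 'rV[R]_n)^nat) :
  (forall i, g_sigma_preimage coord (F i)) ->
  g_sigma_preimage coord (\bigcup_i (F i)).
Proof. exact: sigma_algebra_bigcup. Qed.

HB.instance Definition _ := @isMeasurable.Build (rV_display default_measure_display)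
  'rV[R]_n (g_sigma_preimage coord) rV_set0 rV_setC rV_bigcup.

Lemma measurable_coord (i : 'I_n) :
  measurable_fun [set: 'rV[R]_n] (fun x : 'rV[R]_n => x 0 i).
Proof.
move=> _ Y mY; rewrite setTI; apply: sub_sigma_algebra => /=.
rewrite -bigcup_seq/=; exists i => /=; first by rewrite mem_index_enum.
by exists Y => //; rewrite setTI.
Qed.

Lemma measurable_fun_rV d (T : measurableType d) (f : T -> 'rV[R]_n) :
  (forall i, measurable_fun [set: T] (fun t => f t 0 i)) ->
  measurable_fun [set: T] f.
Proof.
move=> mf.
suff prefS : preimage_set_system [set: T] f measurable `<=` measurable.
  by move=> _ A mA; apply: prefS; exists A.
have -> : preimage_set_system [set: T] f measurable =
    g_sigma_preimage (fun i => coord i \o f).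
  by rewrite -g_sigma_preimage_comp.
apply: smallest_sub; first exact: sigma_algebra_measurable.
move=> A; rewrite -bigcup_seq => -[i _ [B mB <-]].
exact: mf.
Qed.

End measurable_rV.

Section lebesgue_step.
Context {R : realType} {n : nat}.

Definition rV_cons (p : R * 'rV[R]_n) : 'rV[R]_n.+1 :=
  row_mx (const_mx p.1 : 'rV[R]_1) p.2.

Definition rV_uncons (x : 'rV[R]_n.+1) : R * 'rV[R]_n :=
  (x 0 0, \row_j x 0 (lift ord0 j)).

Lemma rV_consK : cancel rV_cons rV_uncons.
Proof.
move=> [a x]; rewrite /rV_cons /rV_uncons /=; congr pair.
  rewrite (_ : 0 = lshift n (0 : 'I_1)); last exact: val_inj.
  by rewrite (@row_mxEl _ 1 1 n) mxE.
apply/rowP => j; rewrite mxE.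
rewrite (_ : lift ord0 j = rshift 1 j); last exact: val_inj.
by rewrite (@row_mxEr _ 1 1 n).
Qed.

Lemma measurable_rV_cons : measurable_fun setT rV_cons.
Proof.
apply: measurable_fun_rV => i.
have [->|[j ->]] : i = 0 \/ exists j, i = lift ord0 j.
  by case: (unliftP ord0 i) => [j|] ->; [right; exists j | left].
- apply: (eq_measurable_fun fst) => [p _|]; last exact: measurable_fst.
  by rewrite -[p in fst p]rV_consK.
- apply: (eq_measurable_fun (fun p : R * 'rV[R]_n => p.2 0 j)) => [p _|].
    by rewrite -[p in snd p]rV_consK mxE.
  exact: (measurableT_comp (measurable_coord j) measurable_snd).
Qed.

Lemma measurable_rV_uncons : measurable_fun setT rV_uncons.
Proof.
apply: measurable_fun_pair; first exact: measurable_coord.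
apply: measurable_fun_rV => j.
apply: (eq_measurable_fun (fun x : 'rV[R]_n.+1 => x 0 (lift ord0 j))) => [x _|].
  by rewrite mxE.
exact: measurable_coord.
Qed.

Variable mu : {sigma_finite_measure set 'rV[R]_n -> \bar R}.

Definition lebesgue_step : set 'rV[R]_n.+1 -> \bar R :=
  pushforward (@lebesgue_measure R \x mu)%E rV_cons.

Let lebesgue_step0 : lebesgue_step set0 = 0%E.
Proof. by rewrite /lebesgue_step /pushforward preimage_set0 measure0. Qed.

Let lebesgue_step_ge0 A : (0 <= lebesgue_step A)%E.
Proof. exact: (measure_ge0 (@lebesgue_measure R \x mu)%E). Qed.

Let lebesgue_step_sigma_additive : semi_sigma_additive lebesgue_step.
Proof.
move=> F mF tF mUF; rewrite /lebesgue_step /pushforward preimage_bigcup.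
apply: measure_semi_sigma_additive.
- by move=> k; rewrite -[X in measurable X]setTI; exact: measurable_rV_cons.
- apply/trivIsetP => /= i j _ _ ij; rewrite -preimage_setI.
  by move/trivIsetP : tF => /(_ _ _ _ _ ij) ->//; rewrite preimage_set0.
- by rewrite -preimage_bigcup -[X in measurable X]setTI; exact: measurable_rV_cons.
Qed.

HB.instance Definition _ := isMeasure.Build _ _ _ lebesgue_step
  lebesgue_step0 lebesgue_step_ge0 lebesgue_step_sigma_additive.

Let lebesgue_step_sigma_finite : sigma_finite setT lebesgue_step.
Proof.
have /sigma_finiteP[F [FT ndF Foo]] := sigma_finiteT (@lebesgue_measure R).
have /sigma_finiteP[G [GT ndG Goo]] := sigma_finiteT mu.
exists (fun k => rV_uncons @^-1` (F k `*` G k)).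
  rewrite -preimage_bigcup -[LHS](preimage_setT rV_uncons); congr (_ @^-1` _).
  rewrite -setXTT FT GT predeqE => -[x y]; split.
    move=> [/= [i _ Fix] [j _ Gjy]]; exists (maxn i j) => //; split.
    - by move: x Fix; exact/subsetPset/ndF/leq_maxl.
    - by move: y Gjy; exact/subsetPset/ndG/leq_maxr.
  by move=> [k _ []/= ? ?]; split; exists k.
move=> k; have [? ?] := Foo k; have [? ?] := Goo k.
have mFG : measurable (F k `*` G k) by exact: measurableX.
split.
  by rewrite -[X in measurable X]setTI; exact: measurable_rV_uncons.
rewrite /lebesgue_step /pushforward -comp_preimage.
rewrite (_ : rV_uncons \o rV_cons = id).
  by rewrite preimage_id product_measure1E// lte_mul_pinfty// ge0_fin_numE.
by apply/funext => p /=; rewrite rV_consK.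
Qed.

HB.instance Definition _ := Measure_isSigmaFinite.Build _ _ _ lebesgue_step
  lebesgue_step_sigma_finite.

End lebesgue_step.

(* Lebesgue measure on the Borel sets of R^n: the n-fold product of
   lebesgue_measure, transported from R * R^n to R^n.+1 at each step. *)
Fixpoint lebesgue_rV (R : realType) (n : nat) :
    {sigma_finite_measure set 'rV[R]_n -> \bar R} :=
  if n is m.+1 then lebesgue_step (lebesgue_rV R m) else dirac (0 : 'rV[R]_0).

Definition ball_volume (R : realType) (n : nat) : R :=
  fine (lebesgue_rV R n (eball 0 1)).

Section hausdorff.
Context {R : realType} {n : nat}.
Local Open Scope ereal_scope.

Definition ediam (A : set 'rV[R]_n) : \bar R :=
  ereal_sup ([set 0] `|` [set (enorm (x - y))%:E | x in A & y in A]).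

(* The factor ball_volume R s / 2 ^ s is the normalization for which the
   s-dimensional Hausdorff measure is the s-dimensional surface measure.  Only
   s > 0 is meant (then empty sets in a cover contribute 0). *)
Definition hausdorff_premeasure (s : nat) (delta : R) (A : set 'rV[R]_n) :
    \bar R :=
  ereal_inf [set \sum_(i <oo)
                   (ball_volume R s)%:E * ((2^-1)%:E * ediam (C i)) ^+ s
            | C in [set C : (set 'rV[R]_n)^nat |
                A `<=` \bigcup_i C i /\ forall i, ediam (C i) <= delta%:E]].

Definition hausdorff_measure (s : nat) (A : set 'rV[R]_n) : \bar R :=
  ereal_sup [set hausdorff_premeasure s delta A | delta in `]0%R, +oo[].

End hausdorff.

Section cracks.
Context {R : realType} {d : nat}.
Implicit Types (U K A Omega crack : set 'rV[R]_d) (f : 'rV[R]_d -> R).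

Definition C1_on U f :=
  forall x, U x ->
    differentiable f x /\ forall v, {for x, continuous (fun z => 'D_v f z)}.

(* Graph, in the direction nu, of a C^1 function over a relatively open subset
   of the hyperplane orthogonal to nu.  Such functions are exactly the
   restrictions to the hyperplane of functions that are C^1 on an open subset
   of R^d (extend them to be constant along nu). *)
Definition C1_graph A :=
  exists (nu : 'rV[R]_d) U f,
    [/\ enorm nu = 1, open U, C1_on U f &
        A = [set z + f z *: nu | z in U `&` [set z | edot z nu = 0]]].

Definition rectifiable A :=
  exists2 K : (set 'rV[R]_d)^nat,
    forall i, compact (K i) /\ exists2 S, C1_graph S & K i `<=` S &
    hausdorff_measure d.-1 (A `\` \bigcup_i K i) = 0%E.

Definition bounded_domain Omega :=
  [/\ Omega !=set0, open Omega, connected Omega & bounded_set Omega].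

(* Only the values of J on [0, +oo[ are relevant. *)
Definition influence_function (J : R -> R) (M : R) :=
  [/\ forall q, 0 <= q -> 0 <= J q,
      forall p q, 0 <= p -> p <= q -> J q <= J p,
      forall q, 0 <= q < 1 -> 0 < J q,
      J 0 = M &
      forall q, 1 <= q -> J q = 0].

Definition kernel_rho Omega (J : R -> R) (eps : R) (y x : 'rV[R]_d) : R :=
  \1_Omega y * J (enorm (y - x) / eps) / (eps * (ball_volume R d * eps ^+ d)).

Definition failure_set Omega crack (eps : R) : set ('rV[R]_d * 'rV[R]_d) :=
  [set p | [/\ Omega p.1, (Omega `&` eball p.1 eps) p.2 &
               segment p.1 p.2 `&` crack !=set0]].

(* Gamma need not be Borel.  The library integral of a nonnegative function is
   the supremum over the simple functions below it, so that when Gamma differs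
   from a Borel set by a Lebesgue-null set, this is still the integral with
   respect to the completed Lebesgue measure. *)
Definition failure_energy Omega (J : R -> R) (Cplus : R)
    (Gamma : set ('rV[R]_d * 'rV[R]_d)) (eps : R) : \bar R :=
  (\int[lebesgue_rV R d]_(x in Omega) \int[lebesgue_rV R d]_(y in Omega)
     (kernel_rho Omega J eps y x * Cplus * \1_Gamma (x, y))%:E)%E.

End cracks.

Definition energy_release_rate (R : realType) (d : nat) (J : R -> R)
    (Cplus : R) : R :=
  Cplus * (2 * ball_volume R d.-1 / ball_volume R d) *
  \int[lebesgue_measure]_(q in `[0, 1]) (q ^+ d * J q).

(* Main.v *)
Require Import Defs.
From HB Require Import structures.
From mathcomp Require Import all_boot all_order all_algebra.
From mathcomp Require Import all_classical all_reals all_analysis.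
From mathcomp Require Import measurable_realfun.
From mathcomp Require Import perm ring lra.

Set Implicit Arguments.
Unset Strict Implicit.
Unset Printing Implicit Defensive.

Import Order.TTheory GRing.Theory Num.Theory.
Import numFieldNormedType.Exports.

Local Open Scope classical_set_scope.
Local Open Scope ring_scope.

(** The number of bonds (x, x + xi) crossing a set E is the Lebesgue measure of the tube
    { x | [x, x + xi] meets E }, so by Tonelli the failure energy is the integral over xi of
    J(|xi| / eps) times this measure.  If E is compact and almost flat, i.e. |(p - q).nu| <=
    eta |p - q| on E, the projection along xi is almost an isometry up to the factor |xi.nu|,
    and a shear shows that the tube has measure |xi.nu| H^{d-1}(E) up to factors (1 +- kappa)^{d-1};
    only the directions nearly orthogonal to nu, of measure O(kappa), escape this, and for them a
    covering argument bounds the measure by O(eps) H^{d-1}(E).  Here H^{d-1} is compared with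
    Lebesgue measure on hyperplanes through H^n = Lebesgue measure, whose proof needs the
    isodiametric inequality (Steiner symmetrization).

    Up to a null set, a rectifiable crack is a disjoint union of compact almost flat sets F_k.
    For the upper bound the pieces add up, and the null set is covered by compact sets of diameter
    at most eps and arbitrarily small total gauge.  For the lower bound finitely many F_k have
    positive distance from each other and from the complement of Omega, so for small eps no
    bond crosses two of them.  Letting kappa tend to 0, the constant is
    int J(|x|) |x_0| dx = 2 omega_{d-1} int_0^1 q^d J(q) dq. *)

(** * Euclidean geometry and Borel sets of R^n *)

(** The kernel carries a factor 1 / eps, so every tube must have measure O(eps), uniformly in the
    direction. For the null part of the crack the covering argument achieves this only with sets of
    diameter at most eps. Such a cover may depend on eps; hence the upper bound holds for every eps
    > 0, while the lower bound, which relies on the gaps between finitely many pieces, holds only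
    for small eps.

    The crack is merely Carathéodory measurable and the failure set need not be Borel. Its energy is
    therefore never computed but squeezed between tube energies of a finite and of a countable union
    of compact sets, where Tonelli applies; monotonicity of the integral holds for arbitrary
    nonnegative integrands.

    A compact flat piece is compared with its projection through Lipschitz bounds in both
    directions, and the measure of the projection through H^n = Lebesgue measure, so that no area
    formula enters. The limit may be +oo, which is why the estimates are kept as one-sided bounds on
    extended reals. *)

Section euclidean_norm.
Context {R : realType} {n : nat}.
Implicit Types (x y z : 'rV[R]_n) (a r : R).

Lemma edotC x y : edot x y = edot y x.
Proof. by apply: eq_bigr => i _; rewrite mulrC. Qed.

Lemma edotDl x y z : edot (x + y) z = edot x z + edot y z.
Proof. by rewrite -big_split; apply: eq_bigr => i _; rewrite mxE mulrDl. Qed.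

Lemma edotZl a x z : edot (a *: x) z = a * edot x z.
Proof. by rewrite /edot big_distrr/=; apply: eq_bigr => i _; rewrite mxE mulrA. Qed.

Lemma edotDr x y z : edot z (x + y) = edot z x + edot z y.
Proof. by rewrite edotC edotDl !(edotC z). Qed.

Lemma edotZr a x z : edot z (a *: x) = a * edot z x.
Proof. by rewrite edotC edotZl edotC. Qed.

Lemma edotNl x z : edot (- x) z = - edot x z.
Proof. by rewrite -scaleN1r edotZl mulN1r. Qed.

Lemma edotNr x z : edot z (- x) = - edot z x.
Proof. by rewrite edotC edotNl edotC. Qed.

Lemma edotBl x y z : edot (x - y) z = edot x z - edot y z.
Proof. by rewrite edotDl edotNl. Qed.

Lemma edotBr x y z : edot z (x - y) = edot z x - edot z y.
Proof. by rewrite edotDr edotNr. Qed.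

Lemma edot0l x : edot 0 x = 0.
Proof. by rewrite -(scale0r x) edotZl mul0r. Qed.

Lemma edot0r x : edot x 0 = 0.
Proof. by rewrite edotC edot0l. Qed.

Lemma edot_ge0 x : 0 <= edot x x.
Proof. by apply: sumr_ge0 => i _; rewrite -expr2 sqr_ge0. Qed.

Lemma enorm_ge0 x : 0 <= enorm x.
Proof. exact: sqrtr_ge0. Qed.

Lemma sqr_enorm x : enorm x ^+ 2 = edot x x.
Proof. by rewrite sqr_sqrtr// edot_ge0. Qed.

Lemma enormZ a x : enorm (a *: x) = `|a| * enorm x.
Proof.
by rewrite /enorm edotZl edotZr mulrA -expr2 sqrtrM ?sqr_ge0// sqrtr_sqr.
Qed.

Lemma enormN x : enorm (- x) = enorm x.
Proof. by rewrite -scaleN1r enormZ normrN1 mul1r. Qed.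

Lemma enorm0 : enorm (0 : 'rV[R]_n) = 0.
Proof. by rewrite /enorm edot0l sqrtr0. Qed.

Lemma enormC x y : enorm (x - y) = enorm (y - x).
Proof. by rewrite -enormN opprB. Qed.

Lemma ler_coord_enorm x i : `|x 0 i| <= enorm x.
Proof.
rewrite -(ler_pXn2r (n := 2)) ?nnegrE ?enorm_ge0// sqr_enorm /edot (bigD1 i)//=.
rewrite real_normK ?num_real// expr2 lerDl.
by apply: sumr_ge0 => j _; rewrite -expr2 sqr_ge0.
Qed.

Lemma enorm_eq0 x : (enorm x == 0) = (x == 0).
Proof.
apply/eqP/eqP => [x0|->]; last exact: enorm0.
apply/rowP => i; rewrite mxE; apply/eqP.
by rewrite -normr_le0 (le_trans (ler_coord_enorm _ _))// x0.
Qed.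

Lemma cauchy_schwarz x y : `|edot x y| <= enorm x * enorm y.
Proof.
rewrite -(ler_pXn2r (n := 2)) ?nnegrE ?mulr_ge0 ?enorm_ge0//.
rewrite exprMn !sqr_enorm real_normK ?num_real//.
have [/eqP|y0] := eqVneq (enorm y) 0.
  by rewrite enorm_eq0 => /eqP ->; rewrite !edot0r expr0n mulr0.
have yy : 0 < edot y y by rewrite -sqr_enorm exprn_gt0// lt0r y0 enorm_ge0.
rewrite -(ler_pM2l yy) -subr_ge0.
set b := edot x y; set c := edot y y.
(* This vector is c times the part of x orthogonal to y; its squared length is c (c |x|^2 - b^2). *)
have := edot_ge0 (c *: x - b *: y).
rewrite !edotBl !edotBr !edotZl !edotZr (edotC y x) -/b -/c => h.
by rewrite (le_trans h)// le_eqVlt; apply/orP; left; apply/eqP; ring.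
Qed.

Lemma ler_enormD x y : enorm (x + y) <= enorm x + enorm y.
Proof.
rewrite -(ler_pXn2r (n := 2)) ?nnegrE ?addr_ge0 ?enorm_ge0//.
rewrite sqrrD !sqr_enorm !edotDl !edotDr (edotC y x).
have := le_trans (ler_norm _) (cauchy_schwarz x y).
by rewrite mulr2n; lra.
Qed.

Lemma ler_enormB x y : enorm (x - y) <= enorm x + enorm y.
Proof. by rewrite -(enormN y) ler_enormD. Qed.

Lemma ler_enorm_dist z x y : enorm (x - y) <= enorm (x - z) + enorm (z - y).
Proof. by rewrite -[x - y](subrKA z) ler_enormD. Qed.

Lemma ler_dist_enorm x y : `|enorm x - enorm y| <= enorm (x - y).
Proof.
rewrite ler_norml lerNl opprB !lerBlDr.
have h1 := ler_enormD (x - y) y; have h2 := ler_enormD (y - x) x.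
by rewrite !subrK in h1 h2; rewrite h1 (enormC x y) h2.
Qed.

Lemma ler_enorm_sum x : enorm x <= \sum_i `|x 0 i|.
Proof.
rewrite -(ler_pXn2r (n := 2)) ?nnegrE ?enorm_ge0 ?sumr_ge0//.
rewrite sqr_enorm /edot expr2 big_distrl/=; apply: ler_sum => i _.
rewrite -expr2 -real_normK ?num_real// expr2 ler_wpM2l// (bigD1 i)//=.
by rewrite lerDl sumr_ge0.
Qed.

Lemma enorm_le_coord x r : (forall i, `|x 0 i| <= r) -> enorm x <= n%:R * r.
Proof.
move=> xr; apply: (le_trans (ler_enorm_sum x)).
by rewrite (le_trans (ler_sum _ (fun i _ => xr i)))// sumr_const card_ord mulr_natl.
Qed.

Lemma ler_coord_normr x i : `|x 0 i| <= `|x|.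
Proof.
have [x0|x0] := ltP 0 `|x|; last first.
  have /eqP : `|x| = 0 by apply/eqP; rewrite eq_le x0 normr_ge0.
  by rewrite normr_eq0 => /eqP ->; rewrite mxE !normr0.
rewrite {2}/Num.norm/= mx_normrE.
exact: (le_bigmax _ (fun ij : 'I_1 * 'I_n => `|x ij.1 ij.2|) (0, i)).
Qed.

Lemma normr_le_coord x r : 0 <= r -> (forall i, `|x 0 i| <= r) -> `|x| <= r.
Proof.
move=> r0 xr; rewrite /Num.norm/= mx_normrE; apply: bigmax_le => // -[i j] _ /=.
by rewrite ord1.
Qed.

Lemma normr_le_enorm x : `|x| <= enorm x.
Proof. by apply: normr_le_coord (enorm_ge0 x) (ler_coord_enorm x). Qed.

Lemma enorm_le_normr x : enorm x <= n%:R * `|x|.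
Proof. by apply: enorm_le_coord => i; exact: ler_coord_normr. Qed.

(** The topology is that of the sup norm, and [|x| <= enorm x <= n |x|] makes the two families of
    balls cofinal. Dividing by [n.+1] keeps the radius positive in dimension 0. *)
Lemma nbhs_eballP x (A : set 'rV[R]_n) :
  nbhs x A <-> exists2 r, 0 < r & eball x r `<=` A.
Proof.
split=> [/nbhs_ballP[r /= r0 rA]|[r r0 rA]].
  exists r => // y /= xy; apply: rA; rewrite mx_norm_ball /ball_ /=.
  by rewrite distrC (le_lt_trans (normr_le_enorm _)).
apply/nbhs_ballP; exists (r / n.+1%:R) => /=; first by rewrite divr_gt0.
move=> y; rewrite mx_norm_ball /ball_ /= => xy; apply: rA; rewrite /eball/=.
rewrite enormC (le_lt_trans (enorm_le_normr _))//.
rewrite (@le_lt_trans _ _ (n.+1%:R * `|x - y|))//; first by rewrite ler_wpM2r// ler_nat.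
by rewrite mulrC -ltr_pdivlMr.
Qed.

Lemma open_eballP (A : set 'rV[R]_n) :
  open A <-> forall x, A x -> exists2 r, 0 < r & eball x r `<=` A.
Proof.
rewrite openE; split=> oA x Ax; first exact/nbhs_eballP/oA.
exact/nbhs_eballP/oA.
Qed.

Lemma open_eball x r : open (eball x r).
Proof.
apply/open_eballP => y; rewrite /eball/= => xy.
exists (r - enorm (y - x)); first by rewrite subr_gt0.
move=> z; rewrite /eball/= => zy; rewrite (le_lt_trans (ler_enorm_dist y _ _))//.
by rewrite -ltrBrDr.
Qed.

Lemma measurable_enorm : measurable_fun setT (@enorm R n).
Proof.
have mdot : measurable_fun setT (fun x : 'rV[R]_n => edot x x).
  by apply: measurable_sum => i; apply: measurable_funM; exact: measurable_coord.
have msqrt : measurable_fun setT (@Num.sqrt R).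
  by apply: continuous_measurable_fun; exact: sqrt_continuous.
exact: (measurableT_comp msqrt mdot).
Qed.

End euclidean_norm.

Section measurable_rV_theory.
Context {R : realType}.

Lemma measurable_funD_rV d (T : measurableType d) n (f g : T -> 'rV[R]_n) :
  measurable_fun setT f -> measurable_fun setT g ->
  measurable_fun setT (fun t => f t + g t).
Proof.
move=> mf mg; apply: measurable_fun_rV => i.
apply: (eq_measurable_fun (fun t => f t 0 i + g t 0 i)) => [t _|].
  by rewrite mxE.
apply: measurable_funD.
  exact: (measurableT_comp (measurable_coord i) mf).
exact: (measurableT_comp (measurable_coord i) mg).
Qed.

Lemma measurable_funZ_rV d (T : measurableType d) n (a : T -> R) (f : T -> 'rV[R]_n) :
  measurable_fun setT a -> measurable_fun setT f ->
  measurable_fun setT (fun t => a t *: f t).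
Proof.
move=> ma mf; apply: measurable_fun_rV => i.
apply: (eq_measurable_fun (fun t => a t * f t 0 i)) => [t _|].
  by rewrite mxE.
apply: measurable_funM => //.
exact: (measurableT_comp (measurable_coord i) mf).
Qed.

Lemma measurable_funN_rV d (T : measurableType d) n (f : T -> 'rV[R]_n) :
  measurable_fun setT f -> measurable_fun setT (fun t => - f t).
Proof.
move=> mf; apply: (eq_measurable_fun (fun t => (-1) *: f t)) => [t _|].
  by rewrite scaleN1r.
exact: measurable_funZ_rV.
Qed.

Lemma measurable_funB_rV d (T : measurableType d) n (f g : T -> 'rV[R]_n) :
  measurable_fun setT f -> measurable_fun setT g ->
  measurable_fun setT (fun t => f t - g t).
Proof. by move=> mf mg; apply: measurable_funD_rV => //; exact: measurable_funN_rV. Qed.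

Lemma measurable_fun_edot d (T : measurableType d) n (f g : T -> 'rV[R]_n) :
  measurable_fun setT f -> measurable_fun setT g ->
  measurable_fun setT (fun t => edot (f t) (g t)).
Proof.
move=> mf mg; apply: measurable_sum => i; apply: measurable_funM.
  exact: (measurableT_comp (measurable_coord i) mf).
exact: (measurableT_comp (measurable_coord i) mg).
Qed.

Lemma measurable_preimage d (T : measurableType d) d' (U : measurableType d')
  (f : T -> U) A : measurable_fun setT f -> measurable A -> measurable (f @^-1` A).
Proof. by move=> mf mA; rewrite -[X in measurable X]setTI; exact: mf. Qed.

Lemma measurable_eball n (x : 'rV[R]_n) r : measurable (eball x r).
Proof.
rewrite (_ : eball x r = (fun y => enorm (y - x)) @^-1` `]-oo, r[%classic).
  apply: measurable_preimage => //.
  apply: measurableT_comp; first exact: measurable_enorm.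
  by apply: measurable_funB_rV => //; exact: measurable_id.
by apply/seteqP; split => y /=; rewrite in_itv.
Qed.

Lemma dense_rat_rV n (x : 'rV[R]_n) (r : R) : 0 < r ->
  exists q : 'rV[rat]_n, enorm (x - map_mx ratr q) < r.
Proof.
move=> r0.
have h i : exists q : rat, `|x 0 i - ratr q| < r / n.+1%:R.
  have e0 : 0 < r / n.+1%:R by rewrite divr_gt0.
  move: (r / _) e0 => e e0.
  have [|q] := @rat_in_itvoo R (x 0 i - e) (x 0 i + e); first by lra.
  by rewrite in_itv/= => /andP[h1 h2]; exists q; rewrite ltr_norml; apply/andP; split; lra.
have [f fP] := choice h.
exists (\row_i f i); rewrite (@le_lt_trans _ _ (n%:R * (r / n.+1%:R)))//.
  by apply: enorm_le_coord => i; rewrite !mxE ltW.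
by rewrite mulrA ltr_pdivrMr// mulrC ltr_pM2l// ltr_nat.
Qed.

(** The Borel structure is generated by the coordinates, not by the open sets. The bridge is a
    countable cover: the balls with rational centre and radius 1 / (k + 1) that lie inside U; codes
    of the other balls give the empty set. *)
Lemma open_measurable_rV n (U : set 'rV[R]_n) : open U -> measurable U.
Proof.
move=> oU.
pose F (p : 'rV[rat]_n * nat) : set 'rV[R]_n :=
  [set y | eball (map_mx ratr p.1) p.2.+1%:R^-1 y /\
           eball (map_mx ratr p.1 : 'rV[R]_n) p.2.+1%:R^-1 `<=` U].
rewrite (_ : U = \bigcup_p F p).
  apply: countable_bigcupT_measurable; first exact: countableP.
  move=> p; have [h|h] := pselect (eball (map_mx ratr p.1 : 'rV[R]_n) p.2.+1%:R^-1 `<=` U).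
    rewrite (_ : F p = eball (map_mx ratr p.1) p.2.+1%:R^-1).
      exact: measurable_eball.
    by apply/seteqP; split=> y // [].
  rewrite (_ : F p = set0) //.
  by apply/seteqP; split=> y // [].
apply/seteqP; split=> [x Ux|x [p _ [h1 h2]]]; last exact: h2.
have [r r0 rU] := (open_eballP U).1 oU x Ux; rewrite /= in r r0 rU.
have r20 : 0 < r / 2 by rewrite divr_gt0.
have [k _ kP] := near_infty_natSinv_lt (PosNum r20).
have {}kP : k.+1%:R^-1 < r / 2 := kP k (leqnn k).
have [q qP] := @dense_rat_rV n x k.+1%:R^-1 (ltac:(by rewrite invr_gt0)).
exists (q, k) => //; split => //=; move=> y; rewrite /eball/= => yq.
apply: rU; rewrite /eball/= (le_lt_trans (ler_enorm_dist (map_mx ratr q) _ _))//.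
rewrite (enormC _ x) (@lt_trans _ _ (k.+1%:R^-1 + k.+1%:R^-1)) ?ltrD//.
by move: (_^-1) kP => e /=; lra.
Qed.

Lemma closed_measurable_rV n (F : set 'rV[R]_n) : closed F -> measurable F.
Proof.
move=> cF; have oF : open (~` F) by exact: closed_openC.
by rewrite -[F]setCK; apply: measurableC; exact: open_measurable_rV.
Qed.

Lemma compact_measurable_rV n (F : set 'rV[R]_n) : compact F -> measurable F.
Proof. by move=> cF; apply: closed_measurable_rV; exact: compact_closed. Qed.

End measurable_rV_theory.

(** * Invariance of Lebesgue measure *)

Section sigma_finite_alias.
Context d (T : measurableType d) (R : realType) (mu : {measure set T -> \bar R}).
Hypothesis smu : sigma_finite setT mu.

(* A name for mu carrying a sigma-finite structure, so that product measures with mu can be formed. *)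
Definition sigma_finite_alias & sigma_finite setT mu : set T -> \bar R := mu.

HB.instance Definition _ := Measure.on (sigma_finite_alias smu).
HB.instance Definition _ := Measure_isSigmaFinite.Build _ _ _ (sigma_finite_alias smu) smu.

End sigma_finite_alias.

Section product_measure_lemmas.
Context d1 d2 (T1 : measurableType d1) (T2 : measurableType d2) (R : realType).
Variables (m1 : {sigma_finite_measure set T1 -> \bar R}).
Variables (m2 : {sigma_finite_measure set T2 -> \bar R}).
Local Open Scope ereal_scope.

(** The image measure takes the values [m1 A * m2 B] on rectangles, and these characterize the
    product measure. *)
Lemma product_measure_map (f1 : T1 -> T1) (f2 : T2 -> T2) X :
  measurable_fun setT f1 -> measurable_fun setT f2 ->
  (forall A, measurable A -> m1 (f1 @^-1` A) = m1 A) ->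
  (forall A, measurable A -> m2 (f2 @^-1` A) = m2 A) ->
  measurable X ->
  (m1 \x m2) ((fun p => (f1 p.1, f2 p.2)) @^-1` X) = (m1 \x m2) X.
Proof.
move=> mf1 mf2 inv1 inv2 mX; set T := fun p => _.
have mT : measurable_fun setT T.
  apply: measurable_fun_pair; first exact: (measurableT_comp mf1 measurable_fst).
  exact: (measurableT_comp mf2 measurable_snd).
pose m' := measure_function_pushforward__canonical__measure_function_Measure
  (product_measure1 m1 m2) mT.
have mm' A B : measurable A -> measurable B -> m' (A `*` B) = m1 A * m2 B.
  move=> mA mB; rewrite /m'/= /pushforward.
  rewrite (_ : T @^-1` _ = (f1 @^-1` A) `*` (f2 @^-1` B))//.
  rewrite product_measure1E.
  - by congr (_ * _); [exact: inv1 | exact: inv2].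
  - exact: (measurable_preimage mf1 mA).
  - exact: (measurable_preimage mf2 mB).
exact/esym/(product_measure_unique mm').
Qed.

Lemma integral_xsection_ysection (S : set (T1 * T2)) : measurable S ->
  \int[m1]_x m2 (xsection S x) = \int[m2]_y m1 (ysection S y).
Proof.
move=> mS.
have mf : measurable_fun setT (fun p => (\1_S p : R)%:E).
  by apply/measurable_EFinP; exact: measurable_indic.
transitivity (\int[m1]_x \int[m2]_y (\1_S (x, y) : R)%:E).
  apply: eq_integral => x _.
  rewrite -[in LHS](setIT (xsection S x)) -integral_indic//; last exact: measurable_xsection.
  apply: eq_integral => y _; congr EFin; rewrite !indicE; congr (nat_of_bool _)%:R.
  by rewrite mem_xsection.
rewrite (fubini_tonelli (fun p => (\1_S p : R)%:E))//.
apply: eq_integral => y _.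
rewrite -[in RHS](setIT (ysection S y)) -integral_indic//; last exact: measurable_ysection.
apply: eq_integral => x _; congr EFin; rewrite !indicE; congr (nat_of_bool _)%:R.
by rewrite mem_ysection.
Qed.

End product_measure_lemmas.

Section translation.
Context {R : realType}.
Local Open Scope ereal_scope.

Definition translation_invariant n (mu : set 'rV[R]_n -> \bar R) :=
  forall (a : 'rV[R]_n) (A : set 'rV[R]_n), measurable A -> mu ((fun x => (x + a)%R) @^-1` A) = mu A.

Lemma ge0_integral_invariant d (T : measurableType d) (mu : {measure set T -> \bar R})
    (phi : T -> T) (f : T -> \bar R) :
  measurable_fun setT phi -> (forall A, measurable A -> mu (phi @^-1` A) = mu A) ->
  measurable_fun setT f -> (forall x, 0 <= f x) ->
  \int[mu]_x f (phi x) = \int[mu]_x f x.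
Proof.
move=> mphi inv mf f0.
transitivity (\int[pushforward mu phi]_x f x).
  by rewrite ge0_integral_pushforward.
by apply: eq_measure_integral => // A mA _; rewrite /= /pushforward inv.
Qed.

Lemma lebesgue_measure_shift (a : R) (A : set R) : measurable A ->
  lebesgue_measure ((fun x => (x + a)%R) @^-1` A) = lebesgue_measure A.
Proof.
move=> mA.
have ms : measurable_fun setT (fun x : measurableTypeR R => (x + a)%R : measurableTypeR R).
  exact: measurable_funD.
pose mu := measure_function_pushforward__canonical__measure_function_Measure lebesgue_measure ms.
have h : forall X : set R, ocitv X -> lebesgue_measure X = mu X.
  move=> X /ocitvP[->|[[b c] /= bc ->]]; first by rewrite !measure0.
  rewrite /mu/= /pushforward.
  rewrite (_ : _ @^-1` _ = `](b - a)%R, (c - a)%R]%classic); last first.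
    by apply/seteqP; split => x /=; rewrite !in_itv/= ltrBlDr lerBrDr.
  rewrite !lebesgue_measure_itv/= !lte_fin bc ifT ?ltrD2r//.
  by congr EFin; ring.
by rewrite [RHS](lebesgue_measure_unique h).
Qed.

Lemma rV_unconsK n : cancel (@rV_uncons R n) rV_cons.
Proof.
move=> x; apply/rowP => i; case: (unliftP ord0 i) => [j|] ->.
  by have := congr1 (fun p : R * 'rV[R]_n => p.2 0%R j) (rV_consK (rV_uncons x)); rewrite !mxE.
by have := congr1 fst (rV_consK (rV_uncons x)).
Qed.

Lemma rV_cons0 n (p : R * 'rV[R]_n) : rV_cons p 0%R ord0 = p.1.
Proof. by have := congr1 fst (rV_consK p). Qed.

Lemma rV_consS n (p : R * 'rV[R]_n) i : rV_cons p 0%R (lift ord0 i) = p.2 0%R i.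
Proof. by have := congr1 (fun p : R * 'rV[R]_n => p.2 0%R i) (rV_consK p); rewrite !mxE. Qed.

Lemma rV_consD n (p q : R * 'rV[R]_n) :
  (rV_cons p + rV_cons q = rV_cons (p.1 + q.1, p.2 + q.2))%R.
Proof.
apply/rowP => i; rewrite mxE; case: (unliftP ord0 i) => [j|] ->.
  by rewrite !rV_consS mxE.
by rewrite !rV_cons0.
Qed.

Lemma lebesgue_rVS n (A : set 'rV[R]_n.+1) :
  lebesgue_rV R n.+1 A = (@lebesgue_measure R \x lebesgue_rV R n) (rV_cons @^-1` A).
Proof. by []. Qed.

Lemma lebesgue_rV_sections n (D : set 'rV[R]_n.+1) : measurable D ->
  lebesgue_rV R n.+1 D = \int[lebesgue_measure]_t lebesgue_rV R n [set x | D (rV_cons (t, x))].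
Proof.
move=> mD; rewrite lebesgue_rVS; apply: eq_integral => t _.
by congr (lebesgue_rV R n _); rewrite /xsection; apply/seteqP; split => x /=; rewrite in_setE.
Qed.

Lemma lebesgue_rV_lines n (D : set 'rV[R]_n.+1) : measurable D ->
  lebesgue_rV R n.+1 D =
  \int[lebesgue_rV R n]_x lebesgue_measure [set t | D (rV_cons (t, x))].
Proof.
move=> mD; have mD' := measurable_preimage (@measurable_rV_cons R n) mD.
rewrite lebesgue_rVS; transitivity (\int[lebesgue_rV R n]_x
  lebesgue_measure (ysection (rV_cons @^-1` D) x)).
  exact: (integral_xsection_ysection lebesgue_measure (lebesgue_rV R n) mD').
apply: eq_integral => x _; congr lebesgue_measure.
by rewrite /ysection; apply/seteqP; split => t /=; rewrite in_setE.
Qed.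

Lemma lebesgue_rV_shift n : translation_invariant (lebesgue_rV R n).
Proof.
elim: n => [|n IH] a A mA.
  rewrite (_ : _ @^-1` A = A)//; apply/seteqP; split => x /=;
  by rewrite (_ : x + a = x)%R//; apply/rowP => -[].
rewrite !lebesgue_rVS.
transitivity ((@lebesgue_measure R \x lebesgue_rV R n)
    ((fun p => ((p.1 + (rV_uncons a).1)%R, (p.2 + (rV_uncons a).2)%R)) @^-1` (rV_cons @^-1` A))).
  have key p : (rV_cons p + a = rV_cons (p.1 + (rV_uncons a).1, p.2 + (rV_uncons a).2))%R.
    by rewrite -[X in (_ + X)%R]rV_unconsK rV_consD.
  rewrite (_ : rV_cons @^-1` (_ @^-1` A) = (fun p =>
    ((p.1 + (rV_uncons a).1)%R, (p.2 + (rV_uncons a).2)%R)) @^-1` (rV_cons @^-1` A))//.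
  by apply/seteqP; split => p /=; rewrite key.
have mf1 : measurable_fun setT (fun x : measurableTypeR R => (x + (rV_uncons a).1)%R).
  exact: measurable_funD.
have mf2 : measurable_fun setT (fun x : 'rV[R]_n => (x + (rV_uncons a).2)%R).
  by apply: measurable_funD_rV => //; exact: measurable_id.
exact: (@product_measure_map _ _ _ _ _ (@lebesgue_measure R) (lebesgue_rV R n) _ _
  (rV_cons @^-1` A) mf1 mf2 (@lebesgue_measure_shift (rV_uncons a).1)
  (IH (rV_uncons a).2) (measurable_preimage (@measurable_rV_cons R n) mA)).
Qed.

(* Uniqueness of Haar measure by Tonelli on { (x, y) | x in A, x + y in B } and its image under
   the substitution x := x - y. *)
Lemma invariant_measure_mul n (mu nu : {measure set 'rV[R]_n -> \bar R}) (A B : set 'rV[R]_n) :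
  sigma_finite setT mu -> sigma_finite setT nu ->
  translation_invariant mu -> translation_invariant nu ->
  measurable A -> measurable B ->
  mu A * nu B = nu (-%R @^-1` A) * mu B.
Proof.
move=> smu snu tmu tnu mA mB.
pose mu' : {sigma_finite_measure set 'rV[R]_n -> \bar R} := sigma_finite_alias smu.
pose nu' : {sigma_finite_measure set 'rV[R]_n -> \bar R} := sigma_finite_alias snu.
have maff (c : 'rV[R]_n) : measurable_fun setT (fun x : 'rV[R]_n => x + c)%R.
  by apply: measurable_funD_rV => //; exact: measurable_id.
have mopp : measurable_fun setT (-%R : 'rV[R]_n -> _).
  by apply: measurable_funN_rV; exact: measurable_id.
pose S : set ('rV[R]_n * 'rV[R]_n) := [set p | A p.1 /\ B (p.1 + p.2)%R].
pose S' : set ('rV[R]_n * 'rV[R]_n) := [set p | A (p.1 - p.2)%R /\ B p.1].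
have mS : measurable S.
  apply: measurableI; first exact: measurable_preimage measurable_fst mA.
  have mD : measurable_fun setT (fun p : 'rV[R]_n * 'rV[R]_n => p.1 + p.2)%R.
    exact: measurable_funD_rV.
  exact: (measurable_preimage mD mB).
have mS' : measurable S'.
  apply: measurableI; last exact: measurable_preimage measurable_fst mB.
  have mD : measurable_fun setT (fun p : 'rV[R]_n * 'rV[R]_n => p.1 - p.2)%R.
    exact: measurable_funB_rV.
  exact: (measurable_preimage mD mA).
have e1 : \int[mu']_x nu' (xsection S x) = mu A * nu B.
  transitivity (\int[mu']_x ((cst (nu B)) \_ A) x).
    apply: eq_integral => x _; rewrite patchE; case: ifPn => [/set_mem Ax|/negP nAx].
      rewrite /= -(tnu x B mB); congr (nu _); apply/seteqP; split => y /=.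
        by move=> /xsectionP[_] /=; rewrite addrC.
      by move=> By; apply/xsectionP; split => //=; rewrite addrC.
    rewrite (_ : xsection _ _ = set0) ?measure0//; apply/seteqP; split => y //.
    by move=> /xsectionP[Ax _]; apply: nAx; exact/mem_set.
  by rewrite -integral_mkcond integral_cst// muleC.
have e2 : \int[mu']_x nu' (xsection S' x) = nu (-%R @^-1` A) * mu B.
  transitivity (\int[mu']_x ((cst (nu (-%R @^-1` A))) \_ B) x).
    apply: eq_integral => x _; rewrite patchE; case: ifPn => [/set_mem Bx|/negP nBx].
      rewrite /= -(tnu (- x)%R); last exact: measurable_preimage.
      congr (nu _); apply/seteqP; split => y /=.
        by move=> /xsectionP[] /=; rewrite opprD opprK addrC.
      by rewrite opprD opprK addrC => Ay; apply/xsectionP.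
    rewrite (_ : xsection _ _ = set0) ?measure0//; apply/seteqP; split => y //.
    by move=> /xsectionP[_ Bx]; apply: nBx; exact/mem_set.
  by rewrite -integral_mkcond integral_cst.
rewrite -e1 -e2 !integral_xsection_ysection//; apply: eq_integral => y _.
rewrite -(tmu (- y)%R (ysection S y)); last exact: measurable_ysection.
congr (mu _); apply/seteqP; split => x /= /ysectionP h; apply/ysectionP; move: h;
  by rewrite /S /S'/= subrK.
Qed.

End translation.

Definition cube (R : realType) (n : nat) (s : R) : set 'rV[R]_n :=
  [set x | forall i, 0 <= x 0 i < s].
Arguments cube {R} n s _.

Lemma mule_pfin_injr (R : realType) (c : R) (x y : \bar R) :
  0 < c -> (x * c%:E = y * c%:E)%E -> x = y.
Proof.
move=> c0 h; apply/eqP; rewrite eq_le.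
have hc : (0 < c%:E)%E by rewrite lte_fin.
by rewrite -(lee_pmul2r _ hc)// -[X in _ && X](lee_pmul2r _ hc)// h lexx.
Qed.

Section lebesgue_rV_theory.
Context {R : realType}.
Local Open Scope ereal_scope.


Lemma measurable_cube n (s : R) : measurable (cube n s).
Proof.
rewrite (_ : cube n s = \bigcap_(i in setT) ((fun x => x 0%R i) @^-1` `[0%R, s[%classic)).
  apply: fin_bigcap_measurable => // i _.
  by apply: measurable_preimage => //; exact: measurable_coord.
apply/seteqP; split => x /=; first by move=> h i _; rewrite /= in_itv/= h.
by move=> h i; have := h i I; rewrite /= in_itv.
Qed.

Lemma lebesgue_rV_cube n (s : R) : (0 <= s)%R -> lebesgue_rV R n (cube n s) = (s ^+ n)%:E.
Proof.
move=> s0; elim: n => [|n IH].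
  rewrite /= diracE (_ : _ \in _ = true)//; apply/mem_set => -[]//.
rewrite lebesgue_rVS (_ : _ @^-1` _ = `[0%R, s[%classic `*` cube n s); last first.
  apply/seteqP; split => p /=.
    move=> h; split; first by have := h ord0; rewrite rV_cons0 in_itv.
    by move=> i; have := h (lift ord0 i); rewrite rV_consS.
  rewrite in_itv/= => -[h1 h2] i; case: (unliftP ord0 i) => [j|] ->.
    by rewrite rV_consS.
  by rewrite rV_cons0.
rewrite product_measure1E//; last exact: measurable_cube.
rewrite [X in X * _](lebesgue_measure_itv `[0%R, s[) [X in _ * X]IH /= lte_fin.
move: s0; rewrite le_eqVlt => /orP[/eqP<-|s0].
  by rewrite ltxx mul0e exprS mul0r.
by rewrite s0 -EFinD subr0 exprS.
Qed.

(** This is [invariant_measure_mul] with both measures equal to Lebesgue measure and the unit cube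
    as second set, whose measure 1 drops out. *)
Lemma lebesgue_rVN n (A : set 'rV[R]_n) : measurable A ->
  lebesgue_rV R n (-%R @^-1` A) = lebesgue_rV R n A.
Proof.
move=> mA; have := @invariant_measure_mul R n (lebesgue_rV R n) (lebesgue_rV R n) A
  (cube n 1%R) (sigma_finiteT _) (sigma_finiteT _) (@lebesgue_rV_shift R n)
  (@lebesgue_rV_shift R n) mA (@measurable_cube n 1%R).
have := lebesgue_rV_cube n (@ler01 R); rewrite expr1n => e1.
by rewrite [X in _ * X = _]e1 [X in _ = _ * X]e1 !mule1.
Qed.

Lemma invariant_measure_eqZ n (mu : {measure set 'rV[R]_n -> \bar R}) (A B : set 'rV[R]_n) :
  sigma_finite setT mu -> translation_invariant mu -> measurable A -> measurable B ->
  mu A * lebesgue_rV R n B = lebesgue_rV R n A * mu B.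
Proof.
move=> smu tmu mA mB; rewrite -(lebesgue_rVN mA).
by apply: invariant_measure_mul => //; [exact: sigma_finiteT | exact: lebesgue_rV_shift].
Qed.

Lemma lebesgue_rV_preimage n (f g : 'rV[R]_n -> 'rV[R]_n) (A B : set 'rV[R]_n) :
  measurable_fun setT f -> measurable_fun setT g -> cancel f g -> cancel g f ->
  {morph f : x y / (x + y)%R} -> measurable A -> measurable B ->
  lebesgue_rV R n (f @^-1` A) * lebesgue_rV R n B =
  lebesgue_rV R n A * lebesgue_rV R n (f @^-1` B).
Proof.
move=> mf mg fK gK fD mA mB.
pose mu := measure_function_pushforward__canonical__measure_function_Measure (lebesgue_rV R n) mf.
apply: (@invariant_measure_eqZ n mu) => //.
  have /sigma_finiteP[F [FT ndF Foo]] := sigma_finiteT (lebesgue_rV R n).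
  exists (fun k => g @^-1` F k).
    by rewrite -preimage_bigcup -FT preimage_setT.
  move=> k; have [mF Fk] := Foo k; split; first exact: measurable_preimage.
  rewrite /= /pushforward (_ : f @^-1` _ = F k)//.
  by apply/seteqP; split => x /=; rewrite fK.
move=> a X mX; rewrite /= /pushforward.
rewrite -(@lebesgue_rV_shift R n (g a) (f @^-1` X)); last exact: measurable_preimage.
by congr (lebesgue_rV R n _); apply/seteqP; split => x /=; rewrite fD gK.
Qed.

(** The factor is read off on the cube of side [s], whose preimage is the unit cube. *)
Lemma lebesgue_rV_scale n (s : R) (A : set 'rV[R]_n) : (0 < s)%R -> measurable A ->
  lebesgue_rV R n A = (s ^+ n)%:E * lebesgue_rV R n ((fun x => s *: x)%R @^-1` A).
Proof.
move=> s0 mA.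
have mZ (r : R) : measurable_fun setT (fun x : 'rV[R]_n => r *: x)%R.
  by apply: measurable_funZ_rV => //; exact: measurable_id.
have := @lebesgue_rV_preimage n ( *:%R s) ( *:%R s^-1) A (cube n s)
  (mZ s) (mZ s^-1%R).
rewrite (_ : _ @^-1` cube n s = cube n 1); last first.
  apply/seteqP; split => x /= h i; have := h i; rewrite mxE.
    by rewrite pmulr_rge0// -[X in (_ < X)%R]mulr1 ltr_pM2l.
  by rewrite pmulr_rge0// -[X in (_ -> _ && (_ < X)%R)]mulr1 ltr_pM2l.
rewrite !lebesgue_rV_cube ?ltW// expr1n mule1 => <-.
- by rewrite muleC.
- by move=> x; rewrite scalerA mulVf ?scale1r// gt_eqF.
- by move=> x; rewrite scalerA mulfV ?scale1r// gt_eqF.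
- by move=> x y; rewrite scalerDr.
- by [].
- exact: measurable_cube.
Qed.

Lemma lebesgue_rV_eball_shift n (x : 'rV[R]_n) r :
  lebesgue_rV R n (eball x r) = lebesgue_rV R n (eball 0 r).
Proof.
rewrite -(@lebesgue_rV_shift R n x); last exact: measurable_eball.
by congr (lebesgue_rV R n _); apply/seteqP; split => y; rewrite /eball/= addrK subr0.
Qed.

Lemma eball_scale n (s r : R) : (0 < s)%R ->
  (fun x : 'rV[R]_n => s *: x)%R @^-1` eball 0 (s * r) = eball 0%R r.
Proof.
by move=> s0; apply/seteqP; split => x; rewrite /eball/= !subr0 enormZ gtr0_norm// ltr_pM2l.
Qed.

Lemma cube_sub_eball n (s : R) : (0 < s)%R -> cube n s `<=` eball 0%R (n.+1%:R * s).
Proof.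
move=> s0 x xs; rewrite /eball/= subr0.
apply: (@le_lt_trans _ _ (n%:R * s)%R); last by rewrite ltr_pM2r// ltr_nat.
by apply: enorm_le_coord => i; have /andP[h1 h2] := xs i; rewrite ger0_norm// ltW.
Qed.

Lemma eball_sub_cube n (r : R) :
  eball (0:'rV[R]_n) r `<=` (fun x => x + const_mx r)%R @^-1` cube n (2 * r)%R.
Proof.
move=> x; rewrite /eball/= subr0 => xr i.
have := le_lt_trans (ler_coord_enorm x i) xr; rewrite ltr_norml !mxE => /andP[h1 h2].
by apply/andP; split; lra.
Qed.

Lemma lebesgue_rV_eball1_gt0 n : 0 < lebesgue_rV R n (eball 0%R 1%R).
Proof.
have s0 : (0 < (n.+1%:R^-1 : R))%R by rewrite invr_gt0.
apply: (@lt_le_trans _ _ (lebesgue_rV R n (cube n n.+1%:R^-1))).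
  by rewrite lebesgue_rV_cube ?ltW// lte_fin exprn_gt0.
apply: le_measure; rewrite ?inE; [exact: measurable_cube|exact: measurable_eball|].
by have := @cube_sub_eball n _ s0; rewrite mulfV// pnatr_eq0.
Qed.

Lemma lebesgue_rV_eball_lty n (x : 'rV[R]_n) r : lebesgue_rV R n (eball x r) < +oo.
Proof.
rewrite lebesgue_rV_eball_shift.
have [r0|r0] := ltP 0%R r; last first.
  rewrite (_ : eball _ _ = set0) ?measure0//; apply/seteqP; split => y //.
  by rewrite /eball/= => /(le_lt_trans (enorm_ge0 _)); rewrite ltNge r0.
apply: (@le_lt_trans _ _ (lebesgue_rV R n (cube n (2 * r)))).
  rewrite -(@lebesgue_rV_shift R n (const_mx r) (cube n (2 * r))); last exact: measurable_cube.
  apply: le_measure; rewrite ?inE; [exact: measurable_eball| |exact: eball_sub_cube].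
  apply: measurable_preimage; last exact: measurable_cube.
  by apply: measurable_funD_rV => //; exact: measurable_id.
by rewrite lebesgue_rV_cube ?ltry// mulr_ge0// ltW.
Qed.

Lemma ball_volumeE n : (ball_volume R n)%:E = lebesgue_rV R n (eball 0%R 1%R).
Proof. by rewrite fineK// ge0_fin_numE//; exact: lebesgue_rV_eball_lty. Qed.

Lemma ball_volume_gt0 n : (0 < ball_volume R n)%R.
Proof. by rewrite -lte_fin ball_volumeE lebesgue_rV_eball1_gt0. Qed.

Lemma lebesgue_rV_eball n (x : 'rV[R]_n) r : (0 < r)%R ->
  lebesgue_rV R n (eball x r) = (r ^+ n * ball_volume R n)%:E.
Proof.
move=> r0; rewrite lebesgue_rV_eball_shift (lebesgue_rV_scale r0); last exact: measurable_eball.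
by rewrite -[X in eball 0%R X]mulr1 eball_scale// EFinM ball_volumeE.
Qed.

(** The unit ball is its own preimage and has positive finite measure, so the factor of
    proportionality is 1. *)
Lemma lebesgue_rV_isometry n (f g : 'rV[R]_n -> 'rV[R]_n) (A : set 'rV[R]_n) :
  measurable_fun setT f -> measurable_fun setT g -> cancel f g -> cancel g f ->
  {morph f : x y / (x + y)%R} -> (forall x, enorm (f x) = enorm x) -> measurable A ->
  lebesgue_rV R n (f @^-1` A) = lebesgue_rV R n A.
Proof.
move=> mf mg fK gK fD fN mA.
have := lebesgue_rV_preimage mf mg fK gK fD mA (measurable_eball 0%R 1%R).
rewrite (_ : f @^-1` eball 0%R 1%R = eball 0%R 1); last first.
  by apply/seteqP; split => x; rewrite /eball/= !subr0 fN.
have h0 := ball_volume_gt0 n; rewrite -ball_volumeE.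
by apply: mule_pfin_injr h0.
Qed.

End lebesgue_rV_theory.

(** * Hausdorff measure *)

Section ereal_expr.
Context {R : realType}.
Local Open Scope ereal_scope.
Implicit Types x y : \bar R.

Lemma lee_expe n x y : 0 <= x -> x <= y -> x ^+ n <= y ^+ n.
Proof.
move=> x0 xy; elim: n => [|n IH]; first by rewrite !expe0.
by rewrite !expeS; apply: lee_pmul => //; exact: expe_ge0.
Qed.

Lemma exprM_ge0 n x y : (x * y) ^+ n = x ^+ n * y ^+ n.
Proof.
elim: n => [|n IH]; first by rewrite !expe0 mule1.
by rewrite !expeS IH muleACA.
Qed.

End ereal_expr.

Section ediam.
Context {R : realType} {n : nat}.
Local Open Scope ereal_scope.
Implicit Types A B : set 'rV[R]_n.

Lemma ediam_ge0 A : 0 <= ediam A.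
Proof. by apply: ereal_sup_ubound; left. Qed.

Lemma ediam0 : ediam (@set0 'rV[R]_n) = 0.
Proof.
apply/eqP; rewrite eq_le ediam_ge0 andbT.
by apply: ge_ereal_sup => x [->|[a []]].
Qed.

Lemma lee_ediam A x y : A x -> A y -> (enorm (x - y))%:E <= ediam A.
Proof. by move=> Ax Ay; apply: ereal_sup_ubound; right; exists x => //; exists y. Qed.

Lemma ediam_le A (r : \bar R) : 0 <= r ->
  (forall x y, A x -> A y -> (enorm (x - y))%:E <= r) -> ediam A <= r.
Proof.
by move=> r0 h; apply: ge_ereal_sup => x [->//|[a Aa [b Ab <-]]]; exact: h.
Qed.

Lemma subset_ediam A B : A `<=` B -> ediam A <= ediam B.
Proof.
move=> AB; apply: ediam_le; first exact: ediam_ge0.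
by move=> x y /AB Ax /AB Ay; exact: lee_ediam.
Qed.

Lemma ediam_eball (x : 'rV[R]_n) (r : R) : (0 <= r)%R -> ediam (eball x r) <= (2 * r)%:E.
Proof.
move=> r0; apply: ediam_le; first by rewrite lee_fin mulr_ge0.
move=> y z; rewrite /eball/= lee_fin => yx zx.
rewrite (le_trans (ler_enorm_dist x _ _))// (enormC x).
by rewrite mulr_natl mulr2n lerD// ltW.
Qed.

End ediam.

Definition hausdorff_gauge (R : realType) n s (C : set 'rV[R]_n) : \bar R :=
  ((ball_volume R s)%:E * ((2^-1)%:E * ediam C) ^+ s)%E.

Section hausdorff_gauge.
Context {R : realType}.
Local Open Scope ereal_scope.

Lemma hausdorff_gauge_ge0 n s (C : set 'rV[R]_n) : 0 <= hausdorff_gauge s C.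
Proof.
apply: mule_ge0; first by rewrite lee_fin ltW// ball_volume_gt0.
by apply: expe_ge0; apply: mule_ge0; [rewrite lee_fin|exact: ediam_ge0].
Qed.

Lemma hausdorff_gauge0 n s : (0 < s)%N -> hausdorff_gauge s (@set0 'rV[R]_n) = 0.
Proof.
case: s => // s _; rewrite /hausdorff_gauge ediam0 mule0.
by rewrite -EFin_expe expr0n/= mule0.
Qed.

Lemma hausdorff_gauge_le m n s (L : R) (C : set 'rV[R]_m) (D : set 'rV[R]_n) :
  (0 <= L)%R -> ediam C <= L%:E * ediam D ->
  hausdorff_gauge s C <= (L ^+ s)%:E * hausdorff_gauge s D.
Proof.
move=> L0 CD; rewrite /hausdorff_gauge muleCA EFin_expe -exprM_ge0.
apply: lee_wpmul2l; first by rewrite lee_fin ltW// ball_volume_gt0.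
apply: lee_expe; first by apply: mule_ge0; [rewrite lee_fin|exact: ediam_ge0].
by rewrite muleCA; apply: lee_wpmul2l.
Qed.

Lemma subset_hausdorff_gauge n s (C D : set 'rV[R]_n) : C `<=` D ->
  hausdorff_gauge s C <= hausdorff_gauge s D.
Proof.
move=> CD; have := @hausdorff_gauge_le _ _ s 1%R C D ler01.
by rewrite expr1n !mul1e; apply; exact: subset_ediam.
Qed.

Lemma hausdorff_gauge_le_fin n s (C : set 'rV[R]_n) (r : R) : (0 <= r)%R ->
  ediam C <= r%:E -> hausdorff_gauge s C <= (ball_volume R s * (r / 2) ^+ s)%:E.
Proof.
move=> r0 Cr; rewrite /hausdorff_gauge EFinM.
apply: lee_wpmul2l; first by rewrite lee_fin ltW// ball_volume_gt0.
rewrite EFin_expe; apply: lee_expe.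
  by apply: mule_ge0; [rewrite lee_fin|exact: ediam_ge0].
by rewrite mulrC EFinM; apply: lee_wpmul2l => //; rewrite lee_fin.
Qed.

End hausdorff_gauge.

Section cover_infimum.
Context {T : Type} {R : realType}.
Local Open Scope ereal_scope.

(** Covers of the sets [F n] that are optimal up to e / 2 ^ (n + 1) are merged into one through a
    bijection of nat with nat * nat. An infinite term makes the bound trivial and is set aside,
    because a near-optimal cover is available only for a finite infimum. *)
Lemma cover_inf_sigma_subadditive (tau : set T -> \bar R) (P : set T -> Prop) :
  (forall C, 0 <= tau C) ->
  sigma_subadditive (fun A => ereal_inf [set \sum_(i <oo) tau (C i)
    | C in [set C : (set T)^nat | A `<=` \bigcup_i C i /\ forall i, P (C i)]]).
Proof.
move=> tau0; set mu := (X in sigma_subadditive X); move=> F.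
have mu0 A : 0 <= mu A.
  by apply: le_ereal_inf_tmp => _ [C _ <-]; exact: nneseries_ge0.
have [[i ioo]|] := pselect (exists i, mu (F i) = +oo).
  rewrite (eseries_pinfty _ _ ioo) ?leey// => k _.
  by rewrite -ltNye (lt_le_trans _ (mu0 _)).
rewrite -forallNE => Foo.
suff add2e (e : {posnum R}) :
    mu (\bigcup_n F n) <= \sum_(i <oo) mu (F i) + e%:num%:E.
  by apply/lee_addgt0Pr => _/posnumP[].
rewrite (le_trans _ (epsilon_trick _ _ _))//.
have [G PG] : {G : ((set T)^nat)^nat & forall n, (F n `<=` \bigcup_i G n i /\
    forall i, P (G n i)) /\
    \sum_(i <oo) tau (G n i) <= mu (F n) + (e%:num / (2 ^ n.+1)%:R)%:E}.
  apply: (@choice _ _ (fun n (C : (set T)^nat) => (F n `<=` \bigcup_i C i /\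
    forall i, P (C i)) /\
    \sum_(i <oo) tau (C i) <= mu (F n) + (e%:num / (2 ^ n.+1)%:R)%:E)) => n.
  have fin : mu (F n) \is a fin_num.
    by rewrite ge0_fin_numE// ltey; apply/eqP; exact: Foo.
  have en0 : (0 < e%:num / (2 ^ n.+1)%:R)%R by [].
  have [_ [C CP <-] Clt] := lb_ereal_inf_adherent en0 fin.
  by exists C; split => //; exact: ltW.
pose a (p : nat * nat) := tau (G p.1 p.2).
apply: (@le_trans _ _ (\esum_(p in setT) a p)).
  have /card_esym/ppcard_eqP[f] := card_nat2.
  apply: ereal_inf_lbound => /=; exists (fun i => G (f i).1 (f i).2).
    split => [t [n _ Ft]|i]; last exact: (PG (f i).1).1.2.
    have [k _ Gk] := (PG n).1.1 t Ft.
    by exists (f^-1%FUN (n, k)) => //=; rewrite invK ?inE.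
  rewrite nneseries_esumT; last by move=> k; exact: tau0.
  by apply/esym/(reindex_esum setT setT f a); split.
rewrite (_ : setT = setT `*`` (fun=> setT)); last by apply/seteqP; split.
rewrite -(esum_esum (a := fun i j => tau (G i j)))//.
rewrite -nneseries_esumT; last by move=> k; exact: esum_ge0.
apply: lee_nneseries => [k _ _|k _]; first exact: esum_ge0.
by rewrite -nneseries_esumT//; exact: (PG k).2.
Qed.

End cover_infimum.

Section hausdorff_outer.
Context {R : realType} {n : nat} (s : nat).
Hypothesis s_gt0 : (0 < s)%N.
Local Open Scope ereal_scope.
Implicit Types A B X : set 'rV[R]_n.

Lemma hausdorff_premeasure_ge0 delta A : 0 <= hausdorff_premeasure s delta A.
Proof.
apply: le_ereal_inf_tmp => _ [C _ <-]; apply: nneseries_ge0 => k _ _.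
exact: hausdorff_gauge_ge0.
Qed.

Lemma hausdorff_premeasure_le delta A (C : (set 'rV[R]_n)^nat) :
  A `<=` \bigcup_i C i -> (forall i, ediam (C i) <= delta%:E) ->
  hausdorff_premeasure s delta A <= \sum_(i <oo) hausdorff_gauge s (C i).
Proof. by move=> AC Cd; apply: ereal_inf_lbound; exists C. Qed.

Lemma subset_hausdorff_premeasure delta A B : A `<=` B ->
  hausdorff_premeasure s delta A <= hausdorff_premeasure s delta B.
Proof.
move=> AB; apply: le_ereal_inf_tmp => _ [C [BC Cd] <-].
by apply: hausdorff_premeasure_le => //; exact: subset_trans BC.
Qed.

Lemma hausdorff_premeasure_antitone (delta1 delta2 : R) A : (delta1 <= delta2)%R ->
  hausdorff_premeasure s delta2 A <= hausdorff_premeasure s delta1 A.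
Proof.
move=> d12; apply: le_ereal_inf_tmp => _ [C [AC Cd] <-].
by apply: hausdorff_premeasure_le => // i; rewrite (le_trans (Cd i))// lee_fin.
Qed.

Lemma hausdorff_premeasure_set0 (delta : R) : (0 <= delta)%R ->
  hausdorff_premeasure s delta (@set0 'rV[R]_n) = 0.
Proof.
move=> d0; apply/eqP; rewrite eq_le hausdorff_premeasure_ge0 andbT.
apply: (le_trans (@hausdorff_premeasure_le delta set0 (fun=> set0) _ _)) => //.
  by move=> i; rewrite ediam0 lee_fin.
by rewrite eseries0// => i _ _; exact: hausdorff_gauge0.
Qed.

Lemma hausdorff_premeasure_sigma_subadditive (delta : R) :
  sigma_subadditive (hausdorff_premeasure s delta : set 'rV[R]_n -> \bar R).
Proof.
move=> F; exact: (@cover_inf_sigma_subadditive _ R (hausdorff_gauge s)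
  (fun C => ediam C <= delta%:E) (@hausdorff_gauge_ge0 R n s) F).
Qed.

Lemma le_hausdorff_measure (delta : R) A : (0 < delta)%R ->
  hausdorff_premeasure s delta A <= hausdorff_measure s A.
Proof.
by move=> d0; apply: ereal_sup_ubound; exists delta => //=; rewrite in_itv/= d0.
Qed.

Lemma hausdorff_measure_le A (c : \bar R) :
  (forall delta : R, (0 < delta)%R -> hausdorff_premeasure s delta A <= c) ->
  hausdorff_measure s A <= c.
Proof.
by move=> h; apply: ge_ereal_sup => _ [d/= + <-]; rewrite in_itv/= andbT; exact: h.
Qed.

Lemma hausdorff_measure_ge0 A : 0 <= hausdorff_measure s A.
Proof. exact: le_trans (hausdorff_premeasure_ge0 1 A) (le_hausdorff_measure A ltr01). Qed.

Lemma subset_hausdorff_measure A B : A `<=` B ->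
  hausdorff_measure s A <= hausdorff_measure s B.
Proof.
move=> AB; apply: hausdorff_measure_le => d d0.
exact: le_trans (subset_hausdorff_premeasure _ AB) (le_hausdorff_measure B d0).
Qed.

Lemma hausdorff_measure_set0 : hausdorff_measure s (@set0 'rV[R]_n) = 0.
Proof.
apply/eqP; rewrite eq_le hausdorff_measure_ge0 andbT.
by apply: hausdorff_measure_le => d d0; rewrite hausdorff_premeasure_set0// ltW.
Qed.

Lemma hausdorff_measure_sigma_subadditive :
  sigma_subadditive (hausdorff_measure s : set 'rV[R]_n -> \bar R).
Proof.
move=> F; apply: hausdorff_measure_le => d d0.
apply: (le_trans (hausdorff_premeasure_sigma_subadditive d F)).
apply: lee_nneseries => [k _ _|k _]; first exact: hausdorff_premeasure_ge0.
exact: le_hausdorff_measure.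
Qed.

(** For s = 0 every member of a cover, even an empty one, would count 1. The argument [0 < s]
    therefore accompanies the set function, so that an outer measure structure can be attached to
    it. *)
Definition hausdorff_outer & (0 < s)%N : set 'rV[R]_n -> \bar R := hausdorff_measure s.

HB.instance Definition _ := isOuterMeasure.Build R _ (hausdorff_outer s_gt0)
  hausdorff_measure_set0 hausdorff_measure_ge0 subset_hausdorff_measure
  hausdorff_measure_sigma_subadditive.

Lemma hausdorff_measureU_le A B :
  hausdorff_measure s (A `|` B) <= hausdorff_measure s A + hausdorff_measure s B.
Proof. exact: (outer_measureU2 (hausdorff_outer s_gt0)). Qed.

(** A set of diameter less than [r] cannot meet both [A] and [B], so each member of a fine cover
    serves only one of them and the cover splits without loss. *)
Lemma hausdorff_measureU_separated A B (r : R) : (0 < r)%R ->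
  (forall x y, A x -> B y -> (r <= enorm (x - y))%R) ->
  hausdorff_measure s (A `|` B) = hausdorff_measure s A + hausdorff_measure s B.
Proof.
move=> r0 AB; apply/eqP; rewrite eq_le hausdorff_measureU_le/=.
have pre (d : R) : (0 < d)%R -> (d < r)%R ->
    hausdorff_premeasure s d A + hausdorff_premeasure s d B <=
    hausdorff_measure s (A `|` B).
  move=> d0 dr; apply: le_trans (le_hausdorff_measure _ d0).
  apply: le_ereal_inf_tmp => _ [C [ABC Cd] <-].
  have hA : hausdorff_premeasure s d A <= \sum_(i <oo) hausdorff_gauge s (C i `&` A).
    apply: hausdorff_premeasure_le => [x Ax|i].
      by have [i _ Ci] := ABC x (or_introl Ax); exists i.
    exact: le_trans (subset_ediam (@subIsetl _ _ _)) (Cd i).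
  have hB : hausdorff_premeasure s d B <= \sum_(i <oo) hausdorff_gauge s (C i `&` B).
    apply: hausdorff_premeasure_le => [x Bx|i].
      by have [i _ Ci] := ABC x (or_intror Bx); exists i.
    exact: le_trans (subset_ediam (@subIsetl _ _ _)) (Cd i).
  apply: (le_trans (leeD hA hB)).
  rewrite -nneseriesD; [|by move=> *; exact: hausdorff_gauge_ge0..].
  apply: lee_nneseries => [i _ _|i _].
    by apply: adde_ge0; exact: hausdorff_gauge_ge0.
  have [CA|/set0P[x [Cx Ax]]] := eqVneq (C i `&` A) set0.
    by rewrite CA hausdorff_gauge0// add0e; exact: (subset_hausdorff_gauge s (@subIsetl _ _ _)).
  rewrite (_ : C i `&` B = set0).
    by rewrite hausdorff_gauge0// adde0; exact: (subset_hausdorff_gauge s (@subIsetl _ _ _)).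
  apply/seteqP; split => y // -[Cy By].
  have := le_trans (lee_ediam Cx Cy) (Cd i); rewrite lee_fin => h.
  by have := le_lt_trans (le_trans (AB x y Ax By) h) dr; rewrite ltxx.
(* The two measures are suprema over independent scales; antitonicity in the scale reduces both to a
   common one below [r]. *)
have mix (d1 d2 : R) : (0 < d1)%R -> (0 < d2)%R ->
    hausdorff_premeasure s d1 A + hausdorff_premeasure s d2 B <=
    hausdorff_measure s (A `|` B).
  move=> d10 d20; pose d : R := Num.min (Num.min d1 d2) (r / 2)%R.
  have d0 : (0 < d)%R by rewrite !lt_min d10 d20 divr_gt0.
  have dr : (d < r)%R.
    by rewrite gt_min ltr_pdivrMr// ltr_pMr// (_ : (1 < 2)%R) ?orbT// ltr1n.
  apply: le_trans (pre d d0 dr).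
  by apply: leeD; apply: hausdorff_premeasure_antitone; rewrite !ge_min lexx ?orbT.
have [->|Hfin] := eqVneq (hausdorff_measure s (A `|` B)) +oo; first by rewrite leey.
have fin : hausdorff_measure s (A `|` B) \is a fin_num.
  by rewrite ge0_fin_numE ?hausdorff_measure_ge0// ltey.
have finA : hausdorff_measure s A \is a fin_num.
  rewrite ge0_fin_numE ?hausdorff_measure_ge0//.
  rewrite (le_lt_trans (subset_hausdorff_measure (@subsetUl _ A B)))//.
  by rewrite ltey.
(* The suprema are taken one at a time, the other term being moved across the inequality, which
   requires it to be finite. *)
rewrite addeC -leeBrDr//; apply: hausdorff_measure_le => d2 d20.
have finB : hausdorff_premeasure s d2 B \is a fin_num.
  rewrite ge0_fin_numE ?hausdorff_premeasure_ge0//.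
  rewrite (le_lt_trans (le_hausdorff_measure B d20))//.
  rewrite (le_lt_trans (subset_hausdorff_measure (@subsetUr _ A B)))//.
  by rewrite ltey.
rewrite leeBrDr// addeC -leeBrDr//; apply: hausdorff_measure_le => d1 d10.
by rewrite leeBrDr//; exact: mix.
Qed.

End hausdorff_outer.

Section hausdorff_lipschitz.
Context {R : realType}.
Local Open Scope ereal_scope.

(** Two parametrizations [u], [v] over one index set replace a map: exchanging them treats the
    inverse map, so one statement bounds the measure of an image from both sides without naming an
    inverse. *)
Lemma hausdorff_measure_lipschitz (T : Type) m n s (u : T -> 'rV[R]_m) (v : T -> 'rV[R]_n)
    (A : set T) (L : R) : (0 < L)%R ->
  (forall i j, A i -> A j -> (enorm (v i - v j) <= L * enorm (u i - u j))%R) ->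
  hausdorff_measure s (v @` A) <= (L ^+ s)%:E * hausdorff_measure s (u @` A).
Proof.
move=> L0 uv; apply: hausdorff_measure_le => d d0.
have dL : (0 < d / L)%R by rewrite divr_gt0.
have LS : (0 < L ^+ s)%R by rewrite exprn_gt0.
apply: (@le_trans _ _ ((L ^+ s)%:E * hausdorff_premeasure s (d / L) (u @` A))); last first.
  by apply: lee_wpmul2l; [rewrite lee_fin ltW|exact: le_hausdorff_measure].
rewrite -lee_pdivrMl//; apply: le_ereal_inf_tmp => _ [C [AC Cd] <-].
rewrite lee_pdivrMl// -nneseriesZl; last by move=> *; exact: hausdorff_gauge_ge0.
pose D i := v @` (A `&` u @^-1` C i).
have CD i : ediam (D i) <= L%:E * ediam (C i).
  apply: ediam_le => [|_ _ [a [Aa Ca] <-] [b [Ab Cb] <-]].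
    by apply: mule_ge0; [rewrite lee_fin ltW|exact: ediam_ge0].
  apply: (@le_trans _ _ (L%:E * (enorm (u a - u b))%:E)).
    by rewrite -EFinM lee_fin uv.
  by apply: lee_wpmul2l; [rewrite lee_fin ltW|exact: lee_ediam].
apply: (@le_trans _ _ (\sum_(i <oo) hausdorff_gauge s (D i))).
  apply: hausdorff_premeasure_le => [_ [a Aa <-]|i].
    have [i _ Ci] : (\bigcup_i C i) (u a) by apply: AC; exists a.
    by exists i => //; exists a.
  apply: (le_trans (CD i)); apply: (@le_trans _ _ (L%:E * (d / L)%:E)).
    by apply: lee_wpmul2l; [rewrite lee_fin ltW|exact: Cd].
  by rewrite -EFinM mulrC divfK// gt_eqF.
apply: lee_nneseries => [i _ _|i _]; first exact: hausdorff_gauge_ge0.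
by apply: hausdorff_gauge_le => //; exact: ltW.
Qed.

End hausdorff_lipschitz.

Lemma ediam_closure (R : realType) n (B : set 'rV[R]_n) : (ediam (closure B) <= ediam B)%E.
Proof.
apply: ediam_le; first exact: ediam_ge0.
move=> x y cx cy; apply/lee_addgt0Pr => r r0; rewrite /= in r r0 *.
have r20 : (0 < r / 2)%R by rewrite divr_gt0.
have [x' [Bx xx']] : B `&` eball x (r / 2) !=set0.
  by apply: cx; apply/nbhs_eballP; exists (r / 2)%R.
have [y' [By yy']] : B `&` eball y (r / 2) !=set0.
  by apply: cy; apply/nbhs_eballP; exists (r / 2)%R.
apply: (@le_trans _ _ ((enorm (x' - y'))%:E + r%:E)); last first.
  by apply: leeD => //; exact: lee_ediam.
rewrite -EFinD lee_fin.
have h1 := ler_enorm_dist x' x y; have h2 := ler_enorm_dist y' x' y.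
move: xx' yy'; rewrite /eball/= (enormC x' x) => h3 h4; lra.
Qed.

(** * Borel sets are Carathéodory measurable; Borel regularity *)

Section hausdorff_borel.
Context {R : realType} {n : nat} (s : nat).
Hypothesis s_gt0 : (0 < s)%N.
Local Open Scope ereal_scope.
Implicit Types A B X : set 'rV[R]_n.

Let H : set 'rV[R]_n -> \bar R := hausdorff_measure s.

(* The classical argument for metric outer measures: the layers Z k of X next to the hyperplane
   have summable measure since every other layer is at positive distance from the others. *)
Lemma hausdorff_halfspace_caratheodory (i : 'I_n) (a : R) :
  H.-caratheodory [set x : 'rV[R]_n | (a < x 0%R i)%R].
Proof.
pose S : set 'rV[R]_n := [set x | (a < x 0%R i)%R].
apply: (@le_caratheodory_measurable R _ (hausdorff_outer s_gt0)) => X.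
change (H (X `&` S) + H (X `&` ~` S) <= H X).
have [->|Hfin] := eqVneq (H X) +oo; first by rewrite leey.
have HX : H X \is a fin_num by rewrite ge0_fin_numE ?hausdorff_measure_ge0// ltey.
have Hsub A : A `<=` X -> H A \is a fin_num.
  move=> AX; rewrite ge0_fin_numE ?hausdorff_measure_ge0//.
  by rewrite (le_lt_trans (subset_hausdorff_measure _ AX))// ltey.
pose e (k : nat) : R := (k.+1%:R^-1)%R.
have e_gt0 k : (0 < e k)%R by rewrite invr_gt0.
have e_le j k : (j <= k)%N -> (e k <= e j)%R.
  by move=> jk; rewrite lef_pV2 ?posrE// ler_nat.
have e_lt k : (e k.+1 < e k)%R by rewrite ltf_pV2 ?posrE// ltr_nat.
pose Y k := X `&` [set x | (a + e k <= x 0%R i)%R].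
pose Z k := X `&` [set x | (a + e k.+1 <= x 0%R i < a + e k)%R].
have sep (A B : set 'rV[R]_n) (b c : R) : (b < c)%R ->
    (forall x, A x -> (x 0%R i <= b)%R) -> (forall x, B x -> (c <= x 0%R i)%R) ->
    H (A `|` B) = H A + H B.
  move=> bc Ab Bc; apply: (hausdorff_measureU_separated s_gt0 (r := (c - b)%R)).
    by rewrite subr_gt0.
  move=> x y /Ab xb /Bc cy; apply: (le_trans _ (ler_coord_enorm _ i)).
  rewrite !mxE distrC; apply: (le_trans _ (ler_norm _)).
  by rewrite lerB.
(* In the step to N + 2, the layer [Z N.+1] is separated from [Y N] and both lie in [Y N.+2], so
   that H (Z N.+1) + H (Y N) is at most H (Y N.+2). The even and the odd layers are thus summed
   alternately. *)
have sumZ N : \sum_(0 <= k < N) H (Z k) <= H (Y N) + H (Y N.-1).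
  elim: N => [|[|N] IH].
  - by rewrite big_nil; apply: adde_ge0; exact: hausdorff_measure_ge0.
  - rewrite big_nat_recr//= big_nil add0e -[X in X <= _]adde0.
    apply: leeD; last exact: hausdorff_measure_ge0.
    by apply: subset_hausdorff_measure => x [Xx /= /andP[]].
  rewrite big_nat_recr//=; apply: (le_trans (leeD IH (lexx _))).
  rewrite -addeA [leRHS]addeC; apply: leeD => //.
  rewrite addeC -(sep _ _ (a + e N.+1)%R (a + e N)%R) ?ltrD2l//.
  - apply: subset_hausdorff_measure => x [[Xx /= /andP[]]//|[Xx /= h]]; split => //=.
    by apply: le_trans h; rewrite lerD2l e_le// leqW.
  - by move=> x [_ /= /andP[_ /ltW]].
  - by move=> x [].
have sumZX : \sum_(k <oo) H (Z k) < +oo.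
  apply: (@le_lt_trans _ _ (H X + H X)); last by rewrite ltey_eq fin_numD HX.
  apply: lime_le; first by apply: is_cvg_nneseries => *; exact: hausdorff_measure_ge0.
  apply: nearW => N; apply: (le_trans (sumZ N)).
  by apply: leeD; apply: subset_hausdorff_measure; exact: subIsetl.
have YS k : H (X `&` S) <= H (Y k) + \sum_(k <= j <oo) H (Z j).
  have -> : \sum_(k <= j <oo) H (Z j) = \sum_(j <oo) H (Z (j + k)%N).
    by rewrite (nneseries_addn (f := fun j => H (Z j)))// => j; exact: hausdorff_measure_ge0.
  apply: (le_trans _ (leeD (lexx _) (hausdorff_measure_sigma_subadditive s _))).
  apply: (le_trans _ (hausdorff_measureU_le s_gt0 _ _)).
  apply: subset_hausdorff_measure => x [Xx Sx].
  have [h|h] := leP (a + e k)%R (x 0%R i); first by left.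
  right.
  have d0 : (0 < x 0%R i - a)%R by rewrite subr_gt0.
  have [N _ hN] := near_infty_natSinv_lt (PosNum d0).
  have {hN} exN : exists m, (a + e m <= x 0%R i)%R.
    by have hN' : (e N < x 0%R i - a)%R := hN N (leqnn N); exists N; rewrite -lerBrDl ltW.
  (* The least such [m] exceeds [k], and minimality puts [x] into the layer [Z m.-1]. *)
  case: (ex_minnP exN) => m mP mmin.
  have km : (k < m)%N.
    rewrite ltnNge; apply/negP => mk; have := le_lt_trans mP h.
    by rewrite ltrD2l ltNge e_le.
  exists (m.-1 - k)%N => //; rewrite subnK; last by rewrite -ltnS prednK// (leq_ltn_trans _ km).
  split => //=; rewrite prednK ?(leq_ltn_trans _ km)// mP/= ltNge.
  apply/negP => /mmin; rewrite leqNgt prednK ?leqnn//.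
  exact: leq_ltn_trans km.
have main k : H (X `&` S) + H (X `&` ~` S) <= H X + \sum_(k <= j <oo) H (Z j).
  apply: (le_trans (leeD (YS k) (lexx _))).
  rewrite addeAC; apply: leeD => //; rewrite addeC -(sep _ _ a (a + e k)%R) ?ltrDl//.
  - by apply: subset_hausdorff_measure => x [[]|[]].
  - by move=> x [_ /= /negP]; rewrite -leNgt.
  - by move=> x [].
have := nneseries_tail_cvg sumZX (fun k _ => @hausdorff_measure_ge0 R n s (Z k)).
move=> tail; have : (fun k => H X + \sum_(k <= j <oo) H (Z j)) @ \oo --> H X + 0.
  by apply: cvgeD => //; [rewrite fin_num_adde_defl|exact: cvg_cst].
rewrite adde0 => /cvg_lim <-//.
apply: lime_ge; last exact: nearW.
apply/cvg_ex; exists (H X + 0).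
by apply: cvgeD => //; [rewrite fin_num_adde_defl|exact: cvg_cst].
Qed.

(** The Carathéodory sets form a sigma-algebra, and it contains the half-spaces, which generate the
    sigma-algebra of the coordinates. *)
Lemma hausdorff_borel_caratheodory A : measurable A -> H.-caratheodory A.
Proof.
have C0 : H.-caratheodory set0.
  exact: (caratheodory_measurable_set0 (hausdorff_outer s_gt0)).
have CC B : H.-caratheodory B -> H.-caratheodory (~` B).
  exact: (@caratheodory_measurable_setC _ _ (hausdorff_outer s_gt0)).
have CU (F : (set 'rV[R]_n)^nat) : (forall k, H.-caratheodory (F k)) ->
    H.-caratheodory (\bigcup_k F k).
  exact: (@caratheodory_measurable_bigcup _ _ (hausdorff_outer s_gt0)).
apply: smallest_sub.
  by split => // B; rewrite setTD; exact: CC.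
move=> B; rewrite -bigcup_seq => -[i _ [Y mY <-]]; rewrite setTI.
have {}mY : (@RGenOInfty.G R).-sigma.-measurable Y by rewrite -RGenOInfty.measurableE.
move: Y mY.
pose P := [set B : set R | H.-caratheodory ((fun x : 'rV[R]_n => x 0%R i) @^-1` B)].
apply: (@smallest_sub _ _ _ P).
  split; first by rewrite /P/= preimage_set0.
    by move=> B' PB; rewrite /P/= setTD preimage_setC; exact: CC.
  by move=> F PF; rewrite /P/= preimage_bigcup; exact: CU.
move=> _ [a ->]; rewrite /P/= (_ : _ @^-1` _ = [set x : 'rV[R]_n | (a < x 0%R i)%R]).
  exact: hausdorff_halfspace_caratheodory.
by apply/seteqP; split => x /=; rewrite in_itv/= andbT.
Qed.

(** For each k take a cover of [A] of mesh at most 1 / (k + 1) and excess at most 1 / (k + 1).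
    Closing its members makes their union Borel without increasing diameters, and [G] is the
    intersection of these unions. If H A is infinite the whole space will do. *)
Lemma hausdorff_borel_regular A : exists2 G, measurable G & A `<=` G /\ H G = H A.
Proof.
have [HA|HA] := eqVneq (H A) +oo.
  exists setT => //; split => //; rewrite HA; apply/eqP.
  by rewrite -leye_eq -HA; exact: subset_hausdorff_measure.
have HAfin : H A \is a fin_num by rewrite ge0_fin_numE ?hausdorff_measure_ge0// ltey.
pose e (k : nat) : R := (k.+1%:R^-1)%R.
have e_gt0 k : (0 < e k)%R by rewrite invr_gt0.
have ex k : exists C : (set 'rV[R]_n)^nat, [/\ A `<=` \bigcup_i C i,
    forall i, ediam (C i) <= (e k)%:E &
    \sum_(i <oo) hausdorff_gauge s (C i) <= H A + (e k)%:E].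
  have fin : hausdorff_premeasure s (e k) A \is a fin_num.
    rewrite ge0_fin_numE ?hausdorff_premeasure_ge0//.
    by rewrite (le_lt_trans (le_hausdorff_measure s A (e_gt0 k)))// ltey.
  have [_ [C [AC Cd] <-] Clt] := lb_ereal_inf_adherent (e_gt0 k) fin.
  exists C; split => //; apply: (le_trans (ltW Clt)).
  by apply: leeD => //; exact: le_hausdorff_measure.
have [C CP] := choice ex.
pose G := \bigcap_k \bigcup_i closure (C k i).
have mG : measurable G.
  apply: bigcapT_measurable => k; apply: bigcupT_measurable => i.
  apply: closed_measurable_rV; exact: closed_closure.
exists G => //.
have AG : A `<=` G.
  move=> x Ax k _; have [AC _ _] := CP k; have [i _ Ci] := AC x Ax.
  by exists i => //; exact: subset_closure.
split => //; apply/eqP; rewrite eq_le; apply/andP; split; last exact: subset_hausdorff_measure.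
apply: hausdorff_measure_le => d d0; apply/lee_addgt0Pr => r r0.
pose m : R := Num.min d r.
have m0 : (0 < m)%R by rewrite lt_min d0 r0.
have [k _ kP] := near_infty_natSinv_lt (PosNum m0).
have ekm : (e k < m)%R := kP k (leqnn k).
have [AC Cd Csum] := CP k.
apply: (@le_trans _ _ (H A + (e k)%:E)); last first.
  by apply: leeD => //; rewrite lee_fin ltW// (lt_le_trans ekm)// ge_min lexx orbT.
apply: le_trans Csum; apply: (@le_trans _ _ (\sum_(i <oo) hausdorff_gauge s (closure (C k i)))).
  apply: hausdorff_premeasure_le => [x Gx|i]; first exact: Gx.
  apply: (le_trans (ediam_closure _)); apply: (le_trans (Cd i)).
  by rewrite lee_fin ltW// (lt_le_trans ekm)// ge_min lexx.
apply: lee_nneseries => [i _ _|i _]; first exact: hausdorff_gauge_ge0.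
have := @hausdorff_gauge_le R _ _ s 1%R (closure (C k i)) (C k i) ler01.
by rewrite expr1n !mul1e; apply; exact: ediam_closure.
Qed.

End hausdorff_borel.

Section hausdorff_on.
Context {R : realType} {n : nat} (s : nat).
Hypothesis s_gt0 : (0 < s)%N.
Local Open Scope ereal_scope.

Lemma hausdorff_on0 (K : set 'rV[R]_n) : hausdorff_measure s (set0 `&` K) = 0.
Proof. by rewrite set0I hausdorff_measure_set0. Qed.

Lemma hausdorff_measureIU (A B K : set 'rV[R]_n) : (hausdorff_measure s).-caratheodory A ->
  A `&` B = set0 ->
  hausdorff_measure s ((A `|` B) `&` K) =
  hausdorff_measure s (A `&` K) + hausdorff_measure s (B `&` K).
Proof.
move=> cA AB; rewrite (cA ((A `|` B) `&` K)); congr (_ + _); congr (hausdorff_measure s _).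
  by apply/seteqP; split => x /=; tauto.
apply/seteqP; split => x /=; first by tauto.
move=> [Bx Kx]; split; first by tauto.
by move=> Ax; have : (A `&` B) x by []; rewrite AB.
Qed.

(** [K] is arbitrary: additivity comes from cutting test sets with the Carathéodory sets [F k],
    first finitely many of them and then in the limit. *)
Lemma hausdorff_on_sigma_additive (K : set 'rV[R]_n) (F : (set 'rV[R]_n)^nat) :
  (forall k, (hausdorff_measure s).-caratheodory (F k)) -> trivIset setT F ->
  hausdorff_measure s ((\bigcup_k F k) `&` K) = \sum_(k <oo) hausdorff_measure s (F k `&` K).
Proof.
move=> cF tF; apply/eqP; rewrite eq_le; apply/andP; split.
  have -> : (\bigcup_k F k) `&` K = \bigcup_k (F k `&` K) by rewrite setI_bigcupl.
  exact: (hausdorff_measure_sigma_subadditive s (fun k => F k `&` K)).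
apply: lime_le; first by apply: is_cvg_nneseries => *; exact: hausdorff_measure_ge0.
apply: nearW => N.
have add m : \sum_(0 <= k < m) hausdorff_measure s (F k `&` K) =
    hausdorff_measure s (\big[setU/set0]_(k < m) F k `&` K).
  elim: m => [|m IH]; first by rewrite big_nil big_ord0 hausdorff_on0.
  rewrite big_nat_recr//= IH big_ord_recr/= setUC hausdorff_measureIU//; first by rewrite addeC.
  apply/seteqP; split => x // -[Fm]; rewrite -bigcup_mkord => -[k /= km Fk].
  move/trivIsetP : tF => /(_ m k I I); rewrite gtn_eqF// => /(_ isT) FF.
  by have : (F m `&` F k) x by []; rewrite FF.
rewrite add; apply: subset_hausdorff_measure => x [+ Kx]; rewrite -bigcup_mkord => -[k _ Fk].
by split => //; exists k.
Qed.

Definition hausdorff_restr (K : set 'rV[R]_n) & (0 < s)%N : set 'rV[R]_n -> \bar R :=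
  fun A => hausdorff_measure s (A `&` K).

Variable K : set 'rV[R]_n.

Let restr_ge0 A : 0 <= hausdorff_restr K s_gt0 A.
Proof. exact: hausdorff_measure_ge0. Qed.

Let restr_sigma_additive : semi_sigma_additive (hausdorff_restr K s_gt0).
Proof.
move=> F mF tF mUF; rewrite /hausdorff_restr.
rewrite (@hausdorff_on_sigma_additive K F) //.
  by apply: is_cvg_nneseries => *; exact: hausdorff_measure_ge0.
by move=> k; exact: hausdorff_borel_caratheodory.
Qed.

HB.instance Definition _ := isMeasure.Build _ _ _ (hausdorff_restr K s_gt0)
  (hausdorff_on0 K) restr_ge0 restr_sigma_additive.

End hausdorff_on.

(** * The isodiametric inequality *)

Section coordinate_update.
Context {R : realType} {n : nat}.
Implicit Types (i j : 'I_n) (x y : 'rV[R]_n) (C : set 'rV[R]_n).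

Definition set_coord i (t : R) x : 'rV[R]_n := \row_j (if j == i then t else x 0 j).

Definition flip_coord i x := set_coord i (- x 0 i) x.

Lemma set_coord_set i s t x : set_coord i s (set_coord i t x) = set_coord i s x.
Proof. by apply/rowP => j; rewrite !mxE; case: eqP. Qed.

Lemma set_coord_id i x : set_coord i (x 0 i) x = x.
Proof. by apply/rowP => j; rewrite !mxE; case: eqP => [->|]. Qed.

Lemma set_coordE i t x : set_coord i t x 0 i = t.
Proof. by rewrite mxE eqxx. Qed.

Lemma flip_coordK i : involutive (flip_coord i).
Proof. by move=> x; rewrite /flip_coord set_coord_set set_coordE opprK set_coord_id. Qed.

Lemma set_coord_flip i j t x : i != j ->
  set_coord i t (flip_coord j x) = flip_coord j (set_coord i t x).
Proof.
move=> ij; apply/rowP => k; rewrite !mxE (eq_sym j i) (negbTE ij).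
by case: (eqVneq k i) => // ->; rewrite (negbTE ij).
Qed.

Lemma measurable_set_coord i x : measurable_fun setT (fun t : R => set_coord i t x).
Proof.
apply: measurable_fun_rV => j.
case: (eqVneq j i) => [->|ji].
  by apply: (eq_measurable_fun id) => [t _|]; [rewrite mxE eqxx|exact: measurable_id].
by apply: (eq_measurable_fun (cst (x 0 j))) => [t _|]; [rewrite mxE (negbTE ji)|exact: measurable_cst].
Qed.

Definition chord i C x : \bar R := lebesgue_measure [set t | C (set_coord i t x)].

(** Steiner symmetrization: each chord parallel to axis i is replaced by the centred open segment of
    the same length. The inequality is strict so that an empty chord contributes no point, not even
    the midpoint. *)
Definition steiner i C : set 'rV[R]_n :=
  [set x : 'rV[R]_n | ((2 * `|x 0 i|)%:E < chord i C x)%E].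

Lemma chord_set_coord i C t x : chord i C (set_coord i t x) = chord i C x.
Proof.
by congr lebesgue_measure; apply/seteqP; split => s /=; rewrite set_coord_set.
Qed.

Lemma steiner_flip i C x : steiner i C x -> steiner i C (flip_coord i x).
Proof.
by rewrite /steiner/= /flip_coord chord_set_coord set_coordE normrN.
Qed.

(** This lets the symmetries accumulate when a set is symmetrized along all axes in turn. *)
Lemma steiner_flip_other i j C : i != j -> (forall x, C x -> C (flip_coord j x)) ->
  forall x, steiner i C x -> steiner i C (flip_coord j x).
Proof.
move=> ij Cj x; have e : flip_coord j x 0 i = x 0 i by rewrite mxE (negbTE ij).
rewrite /steiner/= e.
rewrite (_ : chord i C (flip_coord j x) = chord i C x)//.
congr lebesgue_measure; apply/seteqP; split => t /=; rewrite set_coord_flip//.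
  by move=> /Cj; rewrite flip_coordK.
exact: Cj.
Qed.

(** The intervals spanned by [A] and [B] have total length (sup A - inf B) + (sup B - inf A), and
    each bracket is at most [m]. *)
Lemma lebesgue_measure_spread (A B : set R) (m : R) : measurable A -> measurable B ->
  A !=set0 -> B !=set0 -> (forall u v, A u -> B v -> `|u - v| < m) ->
  (lebesgue_measure A + lebesgue_measure B <= (2 * m)%:E)%E.
Proof.
move=> mA mB [a Aa] [b Bb] AB.
have ubA v : B v -> ubound A (v + m).
  by move=> Bv u Au; have := AB u v Au Bv; rewrite ltr_norml => /andP[h1 h2]; lra.
have lbA v : B v -> lbound A (v - m).
  by move=> Bv u Au; have := AB u v Au Bv; rewrite ltr_norml => /andP[h1 h2]; lra.
have ubB u : A u -> ubound B (u + m).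
  by move=> Au v Bv; have := AB u v Au Bv; rewrite ltr_norml => /andP[h1 h2]; lra.
have lbB u : A u -> lbound B (u - m).
  by move=> Au v Bv; have := AB u v Au Bv; rewrite ltr_norml => /andP[h1 h2]; lra.
have hsA : has_sup A by split; [exists a|exists (b + m); exact: ubA].
have hiA : has_inf A by split; [exists a|exists (b - m); exact: lbA].
have hsB : has_sup B by split; [exists b|exists (a + m); exact: ubB].
have hiB : has_inf B by split; [exists b|exists (a - m); exact: lbB].
have le1 (X : set R) : measurable X -> has_sup X -> has_inf X -> X !=set0 ->
    (lebesgue_measure X <= (sup X - inf X)%:E)%E.
  move=> mX sX iX [x Xx].
  have XI : X `<=` `[inf X, sup X]%classic.
    move=> y Xy /=; rewrite in_itv/=; apply/andP; split.
      exact: (ge_inf iX.2 Xy).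
    exact: (ub_le_sup sX.2 Xy).
  apply: (@le_trans _ _ (lebesgue_measure `[inf X, sup X]%classic)).
    by apply: le_measure; rewrite ?inE.
  rewrite lebesgue_measure_itv/= lte_fin; case: ifP => _ //.
  rewrite lee_fin subr_ge0; have := XI x Xx; rewrite /= in_itv/= => /andP[].
  exact: le_trans.
apply: (le_trans (leeD (le1 A _ _ _ _) (le1 B _ _ _ _))) => //; [by exists a|by exists b|].
rewrite -EFinD lee_fin.
have h1 : sup A - m <= inf B.
  apply: lb_le_inf => [|v Bv]; first by exists b.
  rewrite lerBlDr; apply: ge_sup; [by exists a|exact: ubA].
have h2 : sup B - m <= inf A.
  apply: lb_le_inf => [|v Bv]; first by exists a.
  rewrite lerBlDr; apply: ge_sup; [by exists b|exact: ubB].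
lra.
Qed.

Lemma enorm_set_coord_le i (u v : R) x y : `|x 0 i - y 0 i| <= `|u - v| ->
  enorm (x - y) <= enorm (set_coord i u x - set_coord i v y).
Proof.
move=> h; rewrite /enorm ler_sqrt ?edot_ge0// /edot (bigD1 i)//= [leRHS](bigD1 i)//=.
apply: lerD.
  by rewrite !mxE eqxx -!expr2 -(real_normK (num_real (x 0 i - y 0 i)))
    -(real_normK (num_real (u - v))) ler_pXn2r ?nnegrE.
apply: ler_sum => j ji; rewrite !mxE (negbTE ji).
exact: lexx.
Qed.

(** The chords of [C] through x and y are longer than 2 |x_i| and 2 |y_i|. By
    [lebesgue_measure_spread] they contain parameters u and v at distance at least |x_i - y_i|, and
    the corresponding points of [C] are at least as far apart as x and y. *)
Lemma ediam_steiner i C : measurable C -> (ediam (steiner i C) <= ediam C)%E.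
Proof.
move=> mC; apply: ediam_le; first exact: ediam_ge0.
move=> x y Sx Sy.
pose A := [set t | C (set_coord i t x)]; pose B := [set t | C (set_coord i t y)].
have mA : measurable A by exact: (measurable_preimage (measurable_set_coord i x) mC).
have mB : measurable B by exact: (measurable_preimage (measurable_set_coord i y) mC).
have ne (X : set R) (z : R) : ((2 * `|z|)%:E < lebesgue_measure X)%E -> X !=set0.
  move=> h; apply/set0P/eqP => X0; move: h; rewrite X0 measure0 lte_fin.
  by rewrite ltNge mulr_ge0.
have [u [v [Au Bv uv]]] : exists u v, [/\ A u, B v & `|x 0 i - y 0 i| <= `|u - v|].
  apply: contrapT => hn.
  have AB u v : A u -> B v -> `|u - v| < `|x 0 i - y 0 i|.
    by move=> Au Bv; rewrite ltNge; apply/negP => h; apply: hn; exists u, v.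
  have := lebesgue_measure_spread mA mB (ne _ _ Sx) (ne _ _ Sy) AB.
  rewrite leNgt => /negP; apply.
  apply: (@le_lt_trans _ _ ((2 * `|x 0 i|)%:E + (2 * `|y 0 i|)%:E)%E).
    by rewrite -EFinD lee_fin -mulrDr ler_pM2l// ler_normB.
  exact: lteD.
apply: le_trans (lee_ediam Au Bv); rewrite lee_fin.
exact: enorm_set_coord_le.
Qed.

End coordinate_update.

Section swap_coord.
Context {R : realType} {n : nat}.

Definition swap_coord (i : 'I_n.+1) (x : 'rV[R]_n.+1) : 'rV[R]_n.+1 :=
  \row_j x 0 (tperm ord0 i j).

Lemma swap_coordK i : involutive (swap_coord i).
Proof. by move=> x; apply/rowP => j; rewrite !mxE tpermK. Qed.

Lemma swap_coordD i : {morph swap_coord i : x y / x + y}.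
Proof. by move=> x y; apply/rowP => j; rewrite !mxE. Qed.

Lemma enorm_swap_coord i x : enorm (swap_coord i x) = enorm x.
Proof.
rewrite /enorm /edot [in RHS](reindex_inj (@perm_inj _ (tperm ord0 i))).
by congr Num.sqrt; apply: eq_bigr => j _; rewrite !mxE.
Qed.

Lemma measurable_swap_coord i : measurable_fun setT (swap_coord i).
Proof.
apply: measurable_fun_rV => j.
apply: (eq_measurable_fun (fun x : 'rV[R]_n.+1 => x 0 (tperm ord0 i j))) => [x _|].
  by rewrite mxE.
exact: measurable_coord.
Qed.

Lemma lebesgue_rV_swap_coord i (A : set 'rV[R]_n.+1) : measurable A ->
  lebesgue_rV R n.+1 (swap_coord i @^-1` A) = lebesgue_rV R n.+1 A.
Proof.
apply: (lebesgue_rV_isometry (g := swap_coord i)).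
- exact: measurable_swap_coord.
- exact: measurable_swap_coord.
- exact: swap_coordK.
- exact: swap_coordK.
- exact: swap_coordD.
- exact: enorm_swap_coord.
Qed.

Lemma set_coord_swap i t x : set_coord i t x = swap_coord i (set_coord ord0 t (swap_coord i x)).
Proof.
apply/rowP => j; rewrite !mxE.
case: (eqVneq j i) => [->|ji]; first by rewrite tpermR eqxx.
rewrite tpermK; case: (eqVneq j ord0) ji => [-> ji|j0 ji].
  by rewrite tpermL eq_sym (negbTE ji).
have -> : tperm ord0 i j = j by rewrite tpermD// eq_sym.
by rewrite (negbTE j0).
Qed.

(** Lebesgue measure is built by splitting off the first coordinate. Conjugation with the exchange
    of axes 0 and i carries what is proved for the first axis over to axis i. *)
Lemma steiner_swap i (C : set 'rV[R]_n.+1) :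
  steiner i C = swap_coord i @^-1` steiner ord0 (swap_coord i @^-1` C).
Proof.
have e x : chord i C x = chord ord0 (swap_coord i @^-1` C) (swap_coord i x).
  by congr lebesgue_measure; apply/seteqP; split => t /=; rewrite (set_coord_swap i t x).
by apply/seteqP; split => x; rewrite /steiner/= e mxE tpermL.
Qed.

Lemma set_coord_cons t s (x : 'rV[R]_n) : set_coord ord0 t (rV_cons (s, x)) = rV_cons (t, x).
Proof.
apply/rowP => j; rewrite mxE; case: (unliftP ord0 j) => [k|] ->.
  by rewrite !rV_consS.
by rewrite eqxx rV_cons0.
Qed.

Lemma lebesgue_measure_chord (r : \bar R) : (0 <= r)%E ->
  lebesgue_measure [set t : R | ((2 * `|t|)%:E < r)%E] = r.
Proof.
case: r => [r r0|_|//].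
  rewrite (_ : [set _ | _] = `](- (r / 2)), (r / 2)[%classic); last first.
    apply/seteqP; split => t /=; rewrite in_itv/= lte_fin.
      by rewrite -ltr_norml ltr_pdivlMr// mulrC.
    by rewrite -ltr_norml ltr_pdivlMr// mulrC.
  rewrite lebesgue_measure_itv/= lte_fin; rewrite lee_fin in r0.
  case: ifPn => [_|]; first by rewrite -EFinD; congr EFin; lra.
  by rewrite -leNgt => h; congr EFin; lra.
rewrite (_ : [set _ | _] = `]-oo, +oo[%classic); last first.
  by apply/seteqP; split => t _ //=; rewrite ltry.
by rewrite lebesgue_measure_itv.
Qed.

Lemma measurable_chord0 (C : set 'rV[R]_n.+1) : measurable C ->
  measurable_fun setT (fun x : 'rV[R]_n => lebesgue_measure [set t | C (rV_cons (t, x))]).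
Proof.
move=> mC; have mC' := measurable_preimage (@measurable_rV_cons R n) mC.
apply: (eq_measurable_fun (lebesgue_measure \o ysection (rV_cons @^-1` C))) => [x _|].
  by rewrite /= /ysection; congr lebesgue_measure; apply/seteqP; split => t /=; rewrite in_setE.
exact: measurable_fun_ysection.
Qed.

Lemma measurable_steiner0 (C : set 'rV[R]_n.+1) : measurable C -> measurable (steiner ord0 C).
Proof.
move=> mC.
have ch x : chord ord0 C x = lebesgue_measure [set t | C (rV_cons (t, (rV_uncons x).2))].
  rewrite -[in LHS](rV_unconsK x); congr lebesgue_measure.
  by apply/seteqP; split => t /=; rewrite [rV_uncons x]surjective_pairing set_coord_cons.
have mch : measurable_fun setT (chord ord0 C).
  apply: (eq_measurable_fun (fun x => lebesgue_measure [set t | C (rV_cons (t, (rV_uncons x).2))])).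
    by move=> x _; rewrite ch.
  apply: (measurableT_comp (measurable_chord0 mC)).
  exact: (measurableT_comp measurable_snd (@measurable_rV_uncons R n)).
rewrite -[X in measurable X]setTI; apply: measurable_lte => //.
apply/measurable_EFinP; apply: measurable_funM => //.
by apply: measurableT_comp => //; exact: measurable_coord.
Qed.

Lemma lebesgue_rV_steiner0 (C : set 'rV[R]_n.+1) : measurable C ->
  lebesgue_rV R n.+1 (steiner ord0 C) = lebesgue_rV R n.+1 C.
Proof.
move=> mC.
rewrite !lebesgue_rV_lines//; last exact: measurable_steiner0.
apply: eq_integral => x _.
rewrite -[RHS]lebesgue_measure_chord; last exact: measure_ge0.
have ch t : chord ord0 C (rV_cons (t, x)) = lebesgue_measure [set s | C (rV_cons (s, x))].
  by congr lebesgue_measure; apply/seteqP; split => s /=; rewrite set_coord_cons.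
by congr lebesgue_measure; apply/seteqP; split => t /=; rewrite /steiner/= rV_cons0 ch.
Qed.

Lemma measurable_steiner i (C : set 'rV[R]_n.+1) : measurable C -> measurable (steiner i C).
Proof.
move=> mC; rewrite steiner_swap.
apply: (measurable_preimage (measurable_swap_coord i)); apply: measurable_steiner0.
exact: (measurable_preimage (measurable_swap_coord i)).
Qed.

Lemma lebesgue_rV_steiner i (C : set 'rV[R]_n.+1) : measurable C ->
  lebesgue_rV R n.+1 (steiner i C) = lebesgue_rV R n.+1 C.
Proof.
move=> mC; have mC' := measurable_preimage (measurable_swap_coord i) mC.
rewrite steiner_swap lebesgue_rV_swap_coord; last exact: measurable_steiner0.
by rewrite lebesgue_rV_steiner0// lebesgue_rV_swap_coord.
Qed.

End swap_coord.

Section isodiametric.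
Context {R : realType}.
Local Open Scope ereal_scope.

(** This passes from open balls, whose volume is known, to a set known only to lie in the closed
    ball of radius half its diameter. For a factor c > 1 the radius is stretched by the root of c of
    the relevant order. *)
Lemma lee_mul_exp_gt1 n (x y : \bar R) : 0 <= y ->
  (forall t : R, (1 < t)%R -> x <= (t ^+ n)%:E * y) -> x <= y.
Proof.
move=> y0 h.
have {}h (c : R) : (1 < c)%R -> x <= c%:E * y.
  case: n h => [|n] h c1.
    apply: (le_trans (h c c1)); rewrite expr0.
    by apply: lee_wpmul2r => //; rewrite lee_fin ltW.
  have e : (expR (ln c / n.+1%:R) ^+ n.+1 = c)%R.
    rewrite -expRM_natl mulrC divfK ?pnatr_eq0// lnK// posrE.
    exact: lt_trans ltr01 c1.
  by rewrite -{}e; apply: h; rewrite expR_gt1 divr_gt0// ln_gt0.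
move: y0; rewrite le_eqVlt => /orP[/eqP y0|y0].
  by have := h 2%R; rewrite -y0 mule0 ltr1n; apply.
case: y y0 h => [y|_ _|//]; last by rewrite leey.
rewrite lte_fin => y0 h; apply/lee_addgt0Pr => e e0; rewrite /= in e e0 *.
have := h (1 + e / y)%R; rewrite ltrDl divr_gt0// => /(_ isT).
by rewrite -EFinM mulrDl mul1r divfK ?gt_eqF// EFinD.
Qed.

(* Symmetrizing along every axis makes the set stable under x |-> - x without increasing its
   diameter; it is then contained in a ball of radius half the diameter. *)
Lemma isodiametric n (C : set 'rV[R]_n.+1) : measurable C ->
  lebesgue_rV R n.+1 C <= hausdorff_gauge n.+1 C.
Proof.
move=> mC.
have [D [mD DC dDC symD]] : exists D : set 'rV[R]_n.+1, [/\ measurable D,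
    lebesgue_rV R n.+1 D = lebesgue_rV R n.+1 C, ediam D <= ediam C &
    forall i, i \in enum 'I_n.+1 -> forall x, D x -> D (flip_coord i x)].
  elim: (enum 'I_n.+1) => [|i s [D [mD DC dDC symD]]]; first by exists C.
  exists (steiner i D); split.
  - exact: measurable_steiner.
  - by rewrite lebesgue_rV_steiner.
  - exact: le_trans (ediam_steiner i mD) dDC.
  - move=> j; rewrite inE; case: (eqVneq j i) => [-> _|ji /= js]; first exact: steiner_flip.
    by apply: steiner_flip_other; [rewrite eq_sym|exact: symD].
(* Flipping every coordinate once yields x |-> - x, the symmetry that is wanted. *)
have flipE s x j : uniq s ->
    foldr (@flip_coord R n.+1) x s 0%R j = (if j \in s then - x 0%R j else x 0%R j)%R.
  elim: s j => // i s IH j /= /andP[si us].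
  rewrite mxE inE; case: (eqVneq j i) => [->|ji] /=; last exact: IH.
  by rewrite IH// (negbTE si).
have opp x : D x -> D (- x)%R.
  move=> Dx; rewrite (_ : (- x)%R = foldr (@flip_coord R n.+1) x (enum 'I_n.+1)).
    elim: (enum 'I_n.+1) symD => //= i s IH symD.
    apply: (symD); first by rewrite mem_head.
    by apply: IH => j js; apply: symD; rewrite inE js orbT.
  by apply/rowP => j; rewrite flipE ?enum_uniq// mem_enum mxE.
rewrite -DC; apply: (@le_trans _ _ (hausdorff_gauge n.+1 D)); last first.
  by have := @hausdorff_gauge_le R _ _ n.+1 1%R D C ler01; rewrite expr1n !mul1e; apply.
have diamx x : D x -> (2 * enorm x)%:E <= ediam D.
  move=> Dx; apply: le_trans (lee_ediam Dx (opp x Dx)); rewrite opprK lee_fin.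
  have -> : (x + x = 2 *: x)%R by rewrite scaler_nat mulr2n.
  by rewrite enormZ normr_nat.
have [d0|] := ltP 0 (ediam D); last first.
  move=> d0; have D0 : D `<=` [set 0%R].
    move=> x Dx /=; apply/eqP; rewrite -enorm_eq0.
    have := le_trans (diamx x Dx) d0; rewrite lee_fin.
    by have := enorm_ge0 x => h1 h2; apply/eqP; lra.
  apply: (@le_trans _ _ 0); last exact: hausdorff_gauge_ge0.
  apply/lee_addgt0Pr => e e0; rewrite /= in e e0 *; rewrite add0e.
  (* With [r <= 1] the power r ^ (n + 1) is at most r, so the ball has volume at most e. *)
  pose r : R := Num.min 1%R (e / ball_volume R n.+1)%R.
  have r0 : (0 < r)%R by rewrite lt_min ltr01 divr_gt0// ball_volume_gt0.
  apply: (@le_trans _ _ (lebesgue_rV R n.+1 (eball 0%R r))).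
    apply: le_measure; rewrite ?inE//; first exact: measurable_eball.
    by move=> x /D0 ->; rewrite /eball/= subrr enorm0.
  rewrite lebesgue_rV_eball// lee_fin -ler_pdivlMr ?ball_volume_gt0//.
  rewrite exprS (@le_trans _ _ (r * 1)%R)//; last by rewrite mulr1 ge_min lexx orbT.
  rewrite ler_pM2l//; apply: exprn_ile1; first exact: ltW.
  by rewrite ge_min lexx.
have [dfin|doo] := ltP (ediam D) +oo; last first.
  move: doo; rewrite leye_eq => /eqP doo.
  rewrite /hausdorff_gauge doo mulry gtr0_sg ?invr_gt0// mul1e.
  have -> : +oo ^+ n.+1 = +oo :> \bar R.
    by elim: n {C mC D mD DC dDC symD flipE opp diamx d0 doo} => // n IH; rewrite expeS IH mulyy.
  by rewrite mulry gtr0_sg ?ball_volume_gt0// mul1e leey.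
have [r rE] : exists r, ediam D = r%:E.
  by exists (fine (ediam D)); rewrite fineK// ge0_fin_numE// ltW.
rewrite rE lte_fin in d0.
apply: (@lee_mul_exp_gt1 n.+1); first exact: hausdorff_gauge_ge0.
move=> t t1.
apply: (@le_trans _ _ (lebesgue_rV R n.+1 (eball 0%R (t * (r / 2))%R))).
  apply: le_measure; rewrite ?inE//; first exact: measurable_eball.
  move=> x Dx; rewrite /eball/= subr0; have := diamx x Dx; rewrite rE lee_fin => h.
  apply: (@le_lt_trans _ _ (r / 2)%R); first by lra.
  by rewrite ltr_pMl// divr_gt0.
rewrite lebesgue_rV_eball; last by rewrite mulr_gt0 ?divr_gt0// (lt_trans ltr01).
rewrite /hausdorff_gauge rE -EFinM -EFin_expe -!EFinM lee_fin.
by rewrite exprMn (mulrC _ (ball_volume _ _)) mulrCA (mulrC 2^-1%R).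
Qed.

End isodiametric.

(** * Hausdorff measure in top dimension *)

Lemma big_setU_subadditive (T : Type) (R : realFieldType) (I : Type) (r : seq I)
    (mu : set T -> \bar R) (F : I -> set T) :
  mu set0 = 0%E -> (forall A B, mu (A `|` B) <= mu A + mu B)%E ->
  (mu (\big[setU/set0]_(i <- r) F i) <= \sum_(i <- r) mu (F i))%E.
Proof.
move=> mu0 muU; elim: r => [|i r IH]; first by rewrite !big_nil mu0.
rewrite !big_cons; apply: (le_trans (muU _ _)).
exact: leeD.
Qed.

Section hausdorff_lebesgue.
Context {R : realType}.
Local Open Scope ereal_scope.

Lemma hausdorff_premeasureU n s (d : R) (A B : set 'rV[R]_n) : (0 < s)%N -> (0 <= d)%R ->
  hausdorff_premeasure s d (A `|` B) <=
  hausdorff_premeasure s d A + hausdorff_premeasure s d B.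
Proof.
move=> s0 d0; pose F : (set 'rV[R]_n)^nat := fun k => if k is 0%N then A else if k is 1%N then B else set0.
apply: (@le_trans _ _ (hausdorff_premeasure s d (\bigcup_k F k))).
  apply: subset_hausdorff_premeasure => x [Ax|Bx]; [by exists 0%N|by exists 1%N].
apply: (le_trans (hausdorff_premeasure_sigma_subadditive s d F)).
rewrite nneseries_recl//; last by move=> *; exact: hausdorff_premeasure_ge0.
rewrite (nneseries_split 1 1); last by move=> *; exact: hausdorff_premeasure_ge0.
rewrite big_nat1 eseries0 ?adde0// => -[//|[//|k]] _ _.
exact: hausdorff_premeasure_set0.
Qed.

Lemma hausdorff_premeasure_le_gauge n s (d : R) (A : set 'rV[R]_n) : (0 < s)%N -> (0 <= d)%R ->
  ediam A <= d%:E -> hausdorff_premeasure s d A <= hausdorff_gauge s A.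
Proof.
move=> s0 d0 Ad; pose F : (set 'rV[R]_n)^nat := fun k => if k is 0%N then A else set0.
apply: (le_trans (@hausdorff_premeasure_le R n s d A F _ _)).
- by move=> x Ax; exists 0%N.
- by case=> [|k] //=; rewrite ediam0 lee_fin.
rewrite nneseries_recl//; last by move=> *; exact: hausdorff_gauge_ge0.
by rewrite eseries0 ?adde0// => -[//|k] _ _; exact: hausdorff_gauge0.
Qed.

Lemma hausdorff_measure_isometry m n s (f : 'rV[R]_m -> 'rV[R]_n) (A : set 'rV[R]_m) :
  (forall x y, enorm (f x - f y) = enorm (x - y)) ->
  hausdorff_measure s (f @` A) = hausdorff_measure s A.
Proof.
move=> fE; apply/eqP; rewrite eq_le; apply/andP; split.
  rewrite -[leRHS]mul1e -[X in X%:E * _](expr1n R s) -[in leRHS](image_id A).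
  by apply: hausdorff_measure_lipschitz => // x y _ _; rewrite fE mul1r.
rewrite -[leRHS]mul1e -[X in X%:E * _](expr1n R s) -[in leLHS](image_id A).
by apply: hausdorff_measure_lipschitz => // x y _ _; rewrite fE mul1r.
Qed.

(** Here the sharp constant matters: the isodiametric inequality bounds the volume of each member of
    a cover by its gauge without loss. Members are closed first, to make them measurable. *)
Lemma lebesgue_le_hausdorff n (A : set 'rV[R]_n.+1) : measurable A ->
  lebesgue_rV R n.+1 A <= hausdorff_measure n.+1 A.
Proof.
move=> mA; apply: (le_trans _ (le_hausdorff_measure n.+1 A ltr01)).
apply: le_ereal_inf_tmp => _ [C [AC _] <-].
have mC i : measurable (closure (C i)) by apply: closed_measurable_rV; exact: closed_closure.
apply: (@le_trans _ _ (\sum_(i <oo) lebesgue_rV R n.+1 (closure (C i)))).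
  apply: measure_sigma_subadditive => //.
  by move=> x /AC[i _ Ci]; exists i => //; exact: subset_closure.
apply: lee_nneseries => [i _ _|i _]; first exact: measure_ge0.
apply: (le_trans (isodiametric (mC i))).
have := @hausdorff_gauge_le R _ _ n.+1 1%R (closure (C i)) (C i) ler01.
by rewrite expr1n !mul1e; apply; exact: ediam_closure.
Qed.

Lemma ediam_cube_shift m (s : R) (a : 'rV[R]_m) : (0 <= s)%R ->
  ediam ((fun x => x - a)%R @^-1` cube m s) <= (m%:R * s)%:E.
Proof.
move=> s0; apply: ediam_le; first by rewrite lee_fin mulr_ge0.
move=> x y xs ys; rewrite lee_fin; apply: enorm_le_coord => i.
have := xs i; have := ys i; rewrite !mxE => /andP[h1 h2] /andP[h3 h4].
by rewrite ler_norml; apply/andP; split; lra.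
Qed.

Lemma cube_grid m (N : nat) : (0 < N)%N -> cube m (1 : R) `<=`
  \big[setU/set0]_(k : {ffun 'I_m -> 'I_N})
    (fun x => x - \row_i ((k i)%:R / N%:R))%R @^-1` cube m (N%:R^-1)%R.
Proof.
move=> N0 x xQ.
have NR : (0 < N%:R :> R)%R by rewrite ltr0n.
have tN i : (Num.truncn (x 0%R i * N%:R) < N)%N.
  have /andP[h1 h2] := xQ i; rewrite truncn_lt_nat ?mulr_ge0// -[ltRHS]mul1r ltr_pM2r//.
pose k := [ffun i => Ordinal (tN i)].
rewrite -bigcup_seq; exists k; first by rewrite /= mem_index_enum.
move=> i /=; rewrite !mxE ffunE /=.
have /andP[h1 h2] := xQ i.
have /truncn_itv/andP[h3 h4] : (0 <= x 0%R i * N%:R)%R by rewrite mulr_ge0.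
rewrite subr_ge0 ler_pdivrMr// h3/= ltrBlDr -[X in (X + _)%R]mul1r -mulrDl.
by rewrite ltr_pdivlMr// -natr1 addrC in h4 *.
Qed.

Lemma hausdorff_premeasure_cube m s (N : nat) (d b : R) : (0 < s)%N -> (0 < N)%N -> (0 <= d)%R ->
  (forall a : 'rV[R]_m, hausdorff_premeasure s d
    ((fun x => x - a)%R @^-1` cube m (N%:R^-1)%R) <= b%:E) ->
  hausdorff_premeasure s d (cube m (1 : R)) <= (N%:R ^+ m * b)%:E.
Proof.
move=> s0 N0 d0 h; apply: (le_trans (subset_hausdorff_premeasure _ _ (cube_grid N0))).
apply: (le_trans (big_setU_subadditive _ _ _ _)).
- exact: hausdorff_premeasure_set0.
- by move=> A B; exact: hausdorff_premeasureU.
apply: (@le_trans _ _ (\sum_(k : {ffun 'I_m -> 'I_N}) b%:E)).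
  by apply: lee_sum => k _; exact: h.
by rewrite sumEFin sumr_const card_ffun !card_ord lee_fin -natrX mulr_natl.
Qed.

Lemma exists_invn_le (e : R) : (0 < e)%R -> exists2 N, (0 < N)%N & (N%:R^-1 <= e)%R.
Proof.
move=> e0; have [k _ kP] := near_infty_natSinv_lt (PosNum e0).
by exists k.+1 => //; exact/ltW/(kP k (leqnn k)).
Qed.

(** With N cells per axis the gauge of a cell is of order N ^ (- m), so the total over N ^ m cells
    is independent of N. The bound is crude, but it is needed before the exact value can be
    found. *)
Lemma hausdorff_cube_lty m : (0 < m)%N -> hausdorff_measure m (cube m (1 : R)) < +oo.
Proof.
move=> m0; apply: (@le_lt_trans _ _ (ball_volume R m * (m%:R / 2) ^+ m)%:E); last exact: ltry.
apply: hausdorff_measure_le => d d0.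
have mR : (0 < m%:R :> R)%R by rewrite ltr0n.
have [N N0 Nd] := exists_invn_le (divr_gt0 d0 mR).
have NR : (0 < N%:R :> R)%R by rewrite ltr0n.
have -> : (ball_volume R m * (m%:R / 2) ^+ m =
    N%:R ^+ m * (ball_volume R m * (m%:R * N%:R^-1 / 2) ^+ m))%R.
  rewrite mulrCA -exprMn; congr (_ * _ ^+ _)%R; field.
  by rewrite gt_eqF.
apply: hausdorff_premeasure_cube => // [|a]; first exact: ltW.
have s0 : (0 <= N%:R^-1 :> R)%R by rewrite invr_ge0.
have dc := ediam_cube_shift a s0.
apply: (le_trans (hausdorff_premeasure_le_gauge m0 (ltW d0) _)).
  by apply: (le_trans dc); rewrite lee_fin mulrC -ler_pdivlMr.
by apply: hausdorff_gauge_le_fin => //; rewrite mulr_ge0.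
Qed.

Lemma hausdorff_shift m s (a : 'rV[R]_m) (A : set 'rV[R]_m) :
  hausdorff_measure s ((fun x => x + a)%R @^-1` A) = hausdorff_measure s A.
Proof.
rewrite -[RHS](@hausdorff_measure_isometry m m s (fun x => x - a)%R).
  congr hausdorff_measure; apply/seteqP; split => x /=.
    by move=> Ax; exists (x + a)%R => //; rewrite addrK.
  by move=> [y Ay <-]; rewrite subrK.
by move=> x y; rewrite opprB addrA subrK.
Qed.

(** Hausdorff measure in top dimension is a translation invariant Borel measure, hence a multiple of
    Lebesgue measure; the multiple is its value on the unit cube. *)
Lemma hausdorff_lebesgueZ n (A : set 'rV[R]_n.+1) : measurable A ->
  hausdorff_measure n.+1 A = lebesgue_rV R n.+1 A * hausdorff_measure n.+1 (cube n.+1 (1 : R)).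
Proof.
move=> mA; pose mu : {measure set 'rV[R]_n.+1 -> \bar R} :=
  hausdorff_restr setT (ltn0Sn n).
have muE B : mu B = hausdorff_measure n.+1 B by rewrite /mu/= /hausdorff_restr setIT.
have mQ := @measurable_cube R n.+1 1%R.
have := @invariant_measure_eqZ R n.+1 mu A (cube n.+1 1%R).
rewrite !muE lebesgue_rV_cube// expr1n mule1; apply => //; last first.
  by move=> a B mB; rewrite !muE hausdorff_shift.
(* Sigma-finiteness: the translates of the unit cube by rational vectors cover the space, because a
   rational vector close to x - (1/2, ..., 1/2) moves x into the interior of the cube. *)
pose G (k : 'rV[rat]_n.+1) : set 'rV[R]_n.+1 := (fun x => x - map_mx ratr k)%R @^-1` cube n.+1 (1 : R).
have mG k : measurable (G k).
  apply: measurable_preimage => //; apply: measurable_funB_rV => //; exact: measurable_id.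
exists (fun k => if unpickle k is Some q then G q else set0).
  apply/seteqP; split => // x _.
  have [q qP] := @dense_rat_rV R n.+1 (x - const_mx 2^-1)%R 2^-1 (ltac:(by rewrite invr_gt0)).
  exists (pickle q) => //; rewrite pickleK /G /= => i.
  have := le_lt_trans (ler_coord_enorm _ i) qP; rewrite !mxE ltr_norml => /andP[h1 h2].
  by apply/andP; split; lra.
move=> k; case: unpickle => [q|]; last by split => //; rewrite measure0.
split => //; rewrite muE /G.
rewrite (hausdorff_shift n.+1 (- map_mx ratr q)%R).
exact: hausdorff_cube_lty.
Qed.

(* With c = H^m (unit cube) and th the volume fraction of the ball inscribed in a cube, covering
   each cell of a fine grid by its inscribed ball and the rest gives c <= th + c (1 - th). *)
Lemma hausdorff_cube n : hausdorff_measure n.+1 (cube n.+1 (1 : R)) = 1.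
Proof.
set m := n.+1; apply/eqP; rewrite eq_le; apply/andP; split; last first.
  have := @lebesgue_le_hausdorff n (cube n.+1 1%R) (@measurable_cube R n.+1 1%R).
  by rewrite lebesgue_rV_cube// expr1n.
pose c := fine (hausdorff_measure m (cube m (1 : R))).
have cE : hausdorff_measure m (cube m (1 : R)) = c%:E.
  by rewrite fineK// ge0_fin_numE ?hausdorff_measure_ge0// hausdorff_cube_lty.
have c0 : (0 <= c)%R by rewrite -lee_fin -cE hausdorff_measure_ge0.
pose th : R := (ball_volume R m / 2 ^+ m)%R.
have th0 : (0 < th)%R by rewrite divr_gt0 ?ball_volume_gt0// exprn_gt0.
suff : hausdorff_measure m (cube m (1 : R)) <= (th + c * (1 - th))%:E.
  rewrite cE !lee_fin mulrBr mulr1 addrCA lerDl subr_ge0.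
  by rewrite -[leRHS]mul1r ler_pM2r.
apply: hausdorff_measure_le => d d0.
have [N N0 Nd] := exists_invn_le d0.
set s : R := (N%:R^-1)%R in Nd.
have NR : (0 < N%:R :> R)%R by rewrite ltr0n.
have s0 : (0 < s)%R by rewrite invr_gt0.
have s20 : (0 < s / 2)%R by rewrite divr_gt0.
pose v : R := ((s / 2) ^+ m * ball_volume R m)%R.
have -> : (th + c * (1 - th) = N%:R ^+ m * (v + c * (s ^+ m - v)))%R.
  have Ns : (N%:R ^+ m * s ^+ m = 1)%R by rewrite -exprMn mulfV ?expr1n// gt_eqF.
  have Nv : (N%:R ^+ m * v = th)%R.
    by rewrite /v expr_div_n !mulrA Ns mul1r mulrC.
  by rewrite [RHS]mulrDr Nv [X in _ = (_ + X)%R]mulrCA [X in _ = (_ + _ * X)%R]mulrBr Ns Nv.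
apply: hausdorff_premeasure_cube => // [|a]; first exact: ltW.
rewrite -/s; set Q := _ @^-1` _.
pose B : set 'rV[R]_m := eball (a + const_mx (s / 2))%R (s / 2)%R.
have mQ : measurable Q.
  apply: measurable_preimage; last exact: measurable_cube.
  by apply: measurable_funB_rV => //; exact: measurable_id.
have mB : measurable B by exact: measurable_eball.
have BQ : B `<=` Q.
  move=> x Bx i; have := le_lt_trans (ler_coord_enorm _ i) Bx.
  by rewrite !mxE ltr_norml => /andP[h1 h2]; apply/andP; split; lra.
have lB : lebesgue_rV R m B = v%:E by rewrite lebesgue_rV_eball.
have lQ : lebesgue_rV R m Q = (s ^+ m)%:E.
  rewrite -(lebesgue_rV_cube m (ltW s0)).
  exact: (lebesgue_rV_shift (- a)%R (@measurable_cube R m s)).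
rewrite -(setDUK BQ).
apply: (le_trans (hausdorff_premeasureU _ _ _ (ltW d0))) => //.
rewrite EFinD; apply: leeD.
  have dB : ediam B <= s%:E.
    apply: (le_trans (ediam_eball _ (ltW s20))).
    by rewrite mulrC divfK.
  apply: (le_trans (hausdorff_premeasure_le_gauge _ (ltW d0) _)) => //.
    by apply: (le_trans dB); rewrite lee_fin.
  rewrite /v mulrC; exact: (hausdorff_gauge_le_fin _ (ltW s0) dB).
(* What remains of the cell is measured by H itself, that is, by c times its volume; c thus
   reappears on the right-hand side. *)
apply: (le_trans (le_hausdorff_measure _ _ d0)).
have mD : measurable (Q `\` B) by exact: measurableD.
rewrite (hausdorff_lebesgueZ mD) cE measureD// ?(setIidr BQ); last first.
  by rewrite [X in X < _]lQ ltry.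
by rewrite [X in (X - _) * _]lQ [X in (_ - X) * _]lB -EFinB -EFinM mulrC.
Qed.

Lemma hausdorff_lebesgue n (A : set 'rV[R]_n.+1) : measurable A ->
  hausdorff_measure n.+1 A = lebesgue_rV R n.+1 A.
Proof. by move=> mA; rewrite hausdorff_lebesgueZ// hausdorff_cube mule1. Qed.

End hausdorff_lebesgue.

(** * Tubes *)

Section separation.
Context {R : realType} {n : nat}.

(** Each point of [K] has a neighbourhood whose distance to [F] is bounded below; compactness, in
    the form of near-coverings, makes one bound serve all of [K]. *)
Lemma compact_closed_separated (K F : set 'rV[R]_n) : compact K -> closed F ->
  K `&` F = set0 -> exists2 r : R, 0 < r & forall x y, K x -> F y -> r <= enorm (x - y).
Proof.
move=> cK cF KF.
have /compact_near_coveringP/(_ R (0 : R)^'+ (fun r x => forall y, F y -> r <= enorm (x - y)) _) := cK.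
case=> [|e /= e0 he].
  move=> x Kx.
  have nFx : (~` F) x by move=> Fx; have : (K `&` F) x by []; rewrite KF.
  have oF : open (~` F) by exact: closed_openC.
  have [r r0 rF] := (open_eballP (~` F)).1 oF x nFx.
  have r20 : 0 < r / 2 by rewrite divr_gt0.
  exists (eball x (r / 2), `]0, (r / 2)[%classic).
    split; first by apply/nbhs_eballP; exists (r / 2).
    by rewrite /=; near=> z; rewrite /= in_itv/=; apply/andP; split.
  move=> [z t] [/= zx]; rewrite in_itv/= => /andP[t0 tr] y Fy.
  rewrite leNgt; apply/negP => h; apply: (rF y) => //.
  rewrite /eball/= (le_lt_trans (ler_enorm_dist z _ _))// (enormC y).
  by move: zx; rewrite /eball/=; lra.
exists (e / 2); first by rewrite divr_gt0.
move=> x y Kx Fy; apply: (he (e / 2)) => //=.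
  by rewrite /ball_/= sub0r normrN gtr0_norm ?divr_gt0// ltr_pdivrMr// ltr_pMr// ltr1n.
by rewrite divr_gt0.
Unshelve. all: by end_near. Qed.

End separation.

Section tube.
Context {R : realType}.

Definition tube n (A : set 'rV[R]_n) (xi : 'rV[R]_n) : set 'rV[R]_n :=
  [set x | exists2 s : R, 0 <= s <= 1 & A (x + s *: xi)].

Lemma subset_tube n (A B : set 'rV[R]_n) xi : A `<=` B -> tube A xi `<=` tube B xi.
Proof. by move=> AB x [s s01 As]; exists s => //; exact: AB. Qed.

Lemma tube_bigcup n (F : (set 'rV[R]_n)^nat) xi :
  tube (\bigcup_k F k) xi = \bigcup_k tube (F k) xi.
Proof.
apply/seteqP; split => x; first by move=> [s s01 [k _ Fk]]; exists k => //; exists s.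
by move=> [k _ [s s01 Fk]]; exists s => //; exists k.
Qed.

Definition enbhd n (A : set 'rV[R]_n) (r : R) : set 'rV[R]_n :=
  \bigcup_(p in A) eball p r.

Lemma open_enbhd n (A : set 'rV[R]_n) r : open (enbhd A r).
Proof. by apply: bigcup_open => p _; exact: open_eball. Qed.

Lemma compact_path n (x xi : 'rV[R]_n) :
  compact ((fun s : R => x + s *: xi) @` `[0, 1]%classic).
Proof.
apply: continuous_compact; last exact: segment_compact.
apply: continuous_subspaceT => s.
apply: (@continuousD _ _ _ (cst x) (fun s : R => s *: xi)).
  exact: cst_continuous.
exact: scalel_continuous.
Qed.

(** The real parameter s is traded for rational ones. If for every k the bond comes within 1 / (k +
    1) of [A] at a rational parameter, its distance to [A] is 0, and the bond, being compact, meets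
    the closed set [A]. Measurability jointly in x and xi is what Tonelli requires. *)
Lemma measurable_tube_pair n (A : set 'rV[R]_n) : compact A ->
  measurable [set p : 'rV[R]_n * 'rV[R]_n | tube A p.2 p.1].
Proof.
move=> cA; have clA : closed A by exact: compact_closed.
pose S k (q : rat) := [set p : 'rV[R]_n * 'rV[R]_n |
  (0 <= (ratr q : R) <= 1) /\ enbhd A k.+1%:R^-1 (p.1 + ratr q *: p.2)].
rewrite (_ : [set _ | _] = \bigcap_k \bigcup_q S k q).
  apply: bigcapT_measurable => k; apply: bigcupT_measurable_rat => q.
  have [h|h] := boolP (0 <= (ratr q : R) <= 1); last first.
    by rewrite (_ : S k q = set0)//; apply/seteqP; split => p // []; rewrite (negbTE h).
  have mf : measurable_fun setT (fun p : 'rV[R]_n * 'rV[R]_n => p.1 + (ratr q : R) *: p.2).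
    apply: measurable_funD_rV; first exact: measurable_fst.
    by apply: measurable_funZ_rV; [exact: measurable_cst|exact: measurable_snd].
  have := measurable_preimage mf (open_measurable_rV (@open_enbhd n A k.+1%:R^-1)).
  by congr measurable; apply/seteqP; split => p //= [].
apply/seteqP; split => -[x xi] /=.
  move=> [s /andP[s0 s1] As] k _.
  (* A parameter within [e] of s moves the point by less than 1 / (k + 1); the 1 in the denominator
     covers xi = 0. *)
  pose e : R := k.+1%:R^-1 / (1 + enorm xi).
  have n0 : 0 < 1 + enorm xi by rewrite ltr_pwDl// enorm_ge0.
  have k0 : 0 < (k.+1%:R^-1 : R) by rewrite invr_gt0.
  have e0 : 0 < e by rewrite divr_gt0.
  have [|q] := @rat_in_itvoo R (Num.max 0 (s - e)) (Num.min 1 (s + e)).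
    by rewrite gt_max !lt_min ltr01/=; apply/and3P; split; lra.
  rewrite in_itv/= gt_max lt_min => /andP[/andP[q0 qs] /andP[q1 qe]].
  exists q => //; split => /=; first by rewrite !ltW.
  exists (x + s *: xi) => //; rewrite /eball/= opprD addrACA subrr add0r -scalerBl enormZ.
  apply: (@le_lt_trans _ _ (e * enorm xi)).
    by rewrite ler_wpM2r ?enorm_ge0// ltW// ltr_norml; apply/andP; split; lra.
  rewrite /e mulrAC ltr_pdivrMr// ltr_pM2l// ltrDr ltr01//.
move=> h; apply: contrapT => nt.
have [r r0 hr] := compact_closed_separated (@compact_path n x xi) clA (ltac:(
  apply/seteqP; split => y // -[[s /= + <-] As]; rewrite in_itv/= => s01;
  by apply: nt; exists s)).
have [k _ kP] := near_infty_natSinv_lt (PosNum r0).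
have {}kP : k.+1%:R^-1 < r := kP k (leqnn k).
have [q _ [q01 [p Ap /= pq]]] := h k I.
have := hr (x + ratr q *: xi) p _ Ap.
rewrite leNgt (lt_trans pq kP) => /(_ _)/negP; case => //.
by exists (ratr q) => //=; rewrite in_itv.
Qed.

Lemma measurable_tube n (A : set 'rV[R]_n) xi : compact A -> measurable (tube A xi).
Proof.
move=> cA; have := measurable_ysection xi (measurable_tube_pair cA).
congr measurable; apply/seteqP; split => x /=; first by move/ysectionP.
by move=> h; apply/ysectionP.
Qed.

End tube.

Lemma measure_big_setU_le d (T : measurableType d) (R : realType)
    (mu : {measure set T -> \bar R}) (I : Type) (r : seq I) (F : I -> set T) :
  (forall i, measurable (F i)) ->
  (mu (\big[setU/set0]_(i <- r) F i) <= \sum_(i <- r) mu (F i))%E.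
Proof.
move=> mF; elim: r => [|i r IH]; first by rewrite !big_nil measure0.
rewrite !big_cons; apply: (le_trans (measureU2 _ _ _)) => //.
  exact: bigsetU_measurable.
exact: leeD.
Qed.

Section tube_measure_bound.
Context {R : realType} {n : nat}.
Hypothesis n_gt0 : (0 < n)%N.
Local Open Scope ereal_scope.

(* The tube is covered by at most 1 + L / r + 1 balls of radius 3 r. *)
Lemma lebesgue_tube_diam (C : set 'rV[R]_n.+1) (xi : 'rV[R]_n.+1) (L r : R) :
  compact C -> (0 < r)%R -> (r <= L)%R -> (enorm xi <= L)%R -> ediam C <= r%:E ->
  lebesgue_rV R n.+1 (tube C xi) <= (3 ^+ n.+2 * ball_volume R n.+1 * L * r ^+ n)%:E.
Proof.
move=> cC r0 rL xiL Cr; have L0 : (0 < L)%R := lt_le_trans r0 rL.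
have rhs0 : (0 <= 3 ^+ n.+2 * ball_volume R n.+1 * L * r ^+ n)%R.
  have w0 := ball_volume_gt0 (R := R) n.+1.
  have h3 : (0 < (3 : R) ^+ n.+2)%R by exact: exprn_gt0.
  exact: mulr_ge0 (ltW (mulr_gt0 (mulr_gt0 h3 w0) L0)) (exprn_ge0 _ (ltW r0)).
have [C0|/set0P[p Cp]] := eqVneq C set0.
  rewrite (_ : tube C xi = set0) ?measure0 ?lee_fin//.
  by apply/seteqP; split => x //; rewrite C0 => -[].
pose K := (Num.truncn (L / r)).+1.
have KR : (0 < K%:R :> R)%R by rewrite ltr0n.
have Lr0 : (0 <= L / r)%R by rewrite divr_ge0// ltW.
have /truncn_itv/andP[tK1 tK2] := Lr0.
have LK : (L / K%:R <= r)%R.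
  by rewrite ler_pdivrMr// mulrC -ler_pdivrMr// ltW.
(* A point of the tube misses a centre by at most r, the diameter of [C], plus at most r, the length
   of a step along xi; the radius 3 r makes the inequality strict. *)
pose B j : set 'rV[R]_n.+1 := eball (p - (j%:R / K%:R) *: xi)%R (3 * r)%R.
have tB : tube C xi `<=` \big[setU/set0]_(j < K.+1) B j.
  move=> x [s /andP[s0 s1] Cx]; rewrite -bigcup_mkord.
  have sK0 : (0 <= s * K%:R)%R by rewrite mulr_ge0// ltW.
  have /truncn_itv/andP[j1 j2] := sK0; set j := Num.truncn _ in j1 j2.
  exists j => /=.
    rewrite ltnS -(ler_nat R); apply: (le_trans j1).
    by rewrite -[leRHS]mul1r ler_wpM2r// ltW.
  rewrite /B /eball/=.
  have -> : (x - (p - (j%:R / K%:R) *: xi) =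
      (x + s *: xi - p) - (s - j%:R / K%:R) *: xi)%R.
    by apply/rowP => i; rewrite !mxE; ring.
  apply: (le_lt_trans (ler_enormB _ _)).
  have h1 : (enorm (x + s *: xi - p) <= r)%R.
    by have := le_trans (lee_ediam Cx Cp) Cr; rewrite lee_fin.
  have h2 : (enorm ((s - j%:R / K%:R) *: xi) <= r)%R.
    rewrite enormZ; apply: le_trans LK; rewrite mulrC.
    apply: ler_pM => //; first exact: enorm_ge0.
    rewrite ger0_norm ?subr_ge0 ?ler_pdivrMr// lerBlDr -[X in (_ <= X + _)%R]mul1r -mulrDl.
    by rewrite ler_pdivlMr// addrC natr1 ltW.
  lra.
apply: (@le_trans _ _ (lebesgue_rV R n.+1 (\big[setU/set0]_(j < K.+1) B j))).
  apply: le_measure; rewrite ?inE//; first exact: measurable_tube.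
  by apply: bigsetU_measurable => j _; exact: measurable_eball.
have mB j : measurable (B j) by exact: measurable_eball.
apply: (le_trans (measure_big_setU_le _ _ _)) => //.
rewrite (eq_bigr (fun=> ((3 * r) ^+ n.+1 * ball_volume R n.+1)%:E)); last first.
  by move=> j _; apply: lebesgue_rV_eball; rewrite mulr_gt0.
rewrite sumEFin sumr_const card_ord lee_fin -[X in (X <= _)%R]mulr_natl.
have K3 : (K.+1%:R <= 3 * (L / r))%R.
  have Lr1 : (1 <= L / r)%R by rewrite ler_pdivlMr// mul1r.
  rewrite -natr1 /K -natr1; lra.
apply: (@le_trans _ _ (3 * (L / r) * ((3 * r) ^+ n.+1 * ball_volume R n.+1))%R).
  by rewrite ler_wpM2r// mulr_ge0 ?exprn_ge0 ?mulr_ge0 ?(ltW r0)// ltW// ball_volume_gt0.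
rewrite le_eqVlt; apply/orP; left; apply/eqP.
rewrite exprMn !exprS; move: (3 ^+ n)%R (r ^+ n)%R => u v; field; exact: lt0r_neq0.
Qed.

(** The constant of [lebesgue_tube_diam] divided by that of the gauge, [ball_volume R n / 2 ^ n]. *)
Definition tube_constant : R := (3 ^+ n.+2 * ball_volume R n.+1 * 2 ^+ n / ball_volume R n)%R.

Lemma tube_constant_gt0 : (0 < tube_constant)%R.
Proof.
have w0 := ball_volume_gt0 (R := R) n.+1; have w1 := ball_volume_gt0 (R := R) n.
have h3 : (0 < (3 : R) ^+ n.+2)%R by exact: exprn_gt0.
have h2 : (0 < (2 : R) ^+ n)%R by exact: exprn_gt0.
exact: divr_gt0 (mulr_gt0 (mulr_gt0 h3 w0) h2) w1.
Qed.

Lemma lebesgue_tube_gauge (C : set 'rV[R]_n.+1) (xi : 'rV[R]_n.+1) (L : R) :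
  compact C -> (0 < L)%R -> (enorm xi <= L)%R -> ediam C <= L%:E ->
  lebesgue_rV R n.+1 (tube C xi) <= (tube_constant * L)%:E * hausdorff_gauge n C.
Proof.
move=> cC L0 xiL CL.
have [r rE] : exists r, ediam C = r%:E.
  exists (fine (ediam C)); rewrite fineK// ge0_fin_numE ?ediam_ge0//.
  exact: le_lt_trans CL (ltry _).
have : (0 <= r)%R by rewrite -lee_fin -rE ediam_ge0.
rewrite le_eqVlt => /orP[/eqP r0|r0]; last first.
  apply: (le_trans (lebesgue_tube_diam cC r0 _ xiL _)); rewrite ?rE//.
    by rewrite -lee_fin -rE.
  rewrite /hausdorff_gauge rE -EFinM -EFin_expe -!EFinM lee_fin.
  rewrite /tube_constant exprMn exprVn le_eqVlt; apply/orP; left; apply/eqP; field.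
  by rewrite expf_neq0//= lt0r_neq0// ball_volume_gt0.
apply: (@le_trans _ _ 0); last first.
  apply: mule_ge0; last exact: hausdorff_gauge_ge0.
  by rewrite lee_fin mulr_ge0// ltW// tube_constant_gt0.
apply/lee_addgt0Pr => e e0; rewrite /= in e e0 *; rewrite add0e.
pose k : R := (3 ^+ n.+2 * ball_volume R n.+1 * L)%R.
have k0 : (0 < k)%R.
  have h3 : (0 < (3 : R) ^+ n.+2)%R by exact: exprn_gt0.
  exact: mulr_gt0 (mulr_gt0 h3 (ball_volume_gt0 n.+1)) L0.
(* A set of diameter 0 has arbitrarily small positive bounds [t] for its diameter. As n > 0,
   [t <= 1] gives t ^ n <= t, and [t <= e / k] then brings the estimate below e. *)
pose t : R := Num.min (Num.min 1%R L) (e / k)%R.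
have t0 : (0 < t)%R by rewrite !lt_min ltr01 L0 divr_gt0.
have tL : (t <= L)%R by rewrite !ge_min lexx orbT.
apply: (le_trans (lebesgue_tube_diam cC t0 tL xiL _)).
  by rewrite rE -r0 lee_fin ltW.
rewrite lee_fin -/k mulrC -ler_pdivlMr//.
case: n n_gt0 => // m _; rewrite exprS (@le_trans _ _ (t * 1)%R)//.
  rewrite ler_pM2l//; apply: exprn_ile1; first exact: ltW.
  by rewrite !ge_min lexx.
by rewrite mulr1 ge_min lexx orbT.
Qed.

(** The premeasure at the single scale [L] suffices: the members of a cover, closed and cut with
    [A], are compact of diameter at most L, within the range of [lebesgue_tube_gauge]. The constant
    is crude, but the bound holds in every direction. *)
Lemma lebesgue_tube_hausdorff (A : set 'rV[R]_n.+1) (xi : 'rV[R]_n.+1) (L : R) :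
  compact A -> (0 < L)%R -> (enorm xi <= L)%R ->
  lebesgue_rV R n.+1 (tube A xi) <= (tube_constant * L)%:E * hausdorff_measure n A.
Proof.
move=> cA L0 xiL.
have cL0 : (0 < tube_constant * L)%R by rewrite mulr_gt0// tube_constant_gt0.
apply: (@le_trans _ _ ((tube_constant * L)%:E * hausdorff_premeasure n L A)); last first.
  by apply: lee_wpmul2l; [rewrite lee_fin ltW|exact: le_hausdorff_measure].
rewrite -lee_pdivrMl//; apply: le_ereal_inf_tmp => _ [C [AC Cd] <-].
rewrite lee_pdivrMl// -nneseriesZl; last by move=> *; exact: hausdorff_gauge_ge0.
pose D i := A `&` closure (C i).
have cD i : compact (D i) by apply: compact_closedI => //; exact: closed_closure.
have dD i : ediam (D i) <= ediam (C i).
  exact: le_trans (subset_ediam (@subIsetr _ _ _)) (ediam_closure _).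
apply: (@le_trans _ _ (\sum_(i <oo) lebesgue_rV R n.+1 (tube (D i) xi))).
  apply: measure_sigma_subadditive => //.
  - by move=> i; exact: measurable_tube.
  - exact: measurable_tube.
  rewrite -tube_bigcup; apply: subset_tube => x Ax.
  by have [i _ Ci] := AC x Ax; exists i => //; split => //; exact: subset_closure.
apply: lee_nneseries => [i _ _|i _]; first exact: measure_ge0.
apply: (le_trans (lebesgue_tube_gauge (cD i) L0 xiL (le_trans (dD i) (Cd i)))).
apply: lee_wpmul2l; first by rewrite lee_fin ltW.
by have := @hausdorff_gauge_le R _ _ n 1%R (D i) (C i) ler01; rewrite expr1n !mul1e; apply.
Qed.

End tube_measure_bound.

(** * Tubes over almost flat sets *)

Section shear.
Context {R : realType} {n : nat}.
Local Open Scope ereal_scope.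

Lemma edot_rV_uncons (x y : 'rV[R]_n.+1) :
  edot x y = (x 0%R ord0 * y 0%R ord0 + edot (rV_uncons x).2 (rV_uncons y).2)%R.
Proof.
rewrite /edot big_ord_recl; congr (_ + _)%R.
by apply: eq_bigr => i _; rewrite !mxE.
Qed.

Lemma ler_enorm_uncons (x : 'rV[R]_n.+1) : (enorm (rV_uncons x).2 <= enorm x)%R.
Proof.
rewrite /enorm ler_sqrt ?edot_ge0// (edot_rV_uncons x x) lerDr -expr2.
exact: sqr_ge0.
Qed.

Lemma enorm_uncons_le (x : 'rV[R]_n.+1) :
  (enorm x <= `|x 0%R ord0| + enorm (rV_uncons x).2)%R.
Proof.
rewrite -(ler_pXn2r (n := 2)) ?nnegrE ?enorm_ge0 ?addr_ge0 ?enorm_ge0//.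
rewrite sqr_enorm edot_rV_uncons sqrrD -sqr_enorm real_normK ?num_real// expr2.
by rewrite lerD2r lerDl mulrn_wge0// mulr_ge0// enorm_ge0.
Qed.

Definition shear (c : R -> 'rV[R]_n) (p : 'rV[R]_n.+1) : 'rV[R]_n.+1 :=
  rV_cons (p 0%R ord0, (rV_uncons p).2 + c (p 0%R ord0))%R.

Lemma shear_cons c t x : shear c (rV_cons (t, x)) = rV_cons (t, x + c t)%R.
Proof. by rewrite /shear rV_cons0 rV_consK. Qed.

Lemma measurable_shear c : measurable_fun setT c -> measurable_fun setT (shear c).
Proof.
move=> mc; apply: (measurableT_comp (@measurable_rV_cons R n)).
apply: measurable_fun_pair; first exact: measurable_coord.
apply: measurable_funD_rV.
  exact: (measurableT_comp measurable_snd (@measurable_rV_uncons R n)).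
exact: (measurableT_comp mc (measurable_coord _)).
Qed.

(** The shear translates each section of first coordinate t by [c t], and Lebesgue measure is the
    integral over t of the measures of the sections. *)
Lemma lebesgue_rV_shear c (D : set 'rV[R]_n.+1) : measurable_fun setT c -> measurable D ->
  lebesgue_rV R n.+1 (shear c @^-1` D) = lebesgue_rV R n.+1 D.
Proof.
move=> mc mD; rewrite !lebesgue_rV_sections//; last exact: (measurable_preimage (measurable_shear mc)).
apply: eq_integral => t _.
have mDt : measurable [set x | D (rV_cons (t, x))].
  apply: (measurable_preimage (f := fun x => rV_cons (t, x))) mD.
  by apply: (measurableT_comp (@measurable_rV_cons R n)); exact: measurable_fun_pair.
rewrite -[RHS](lebesgue_rV_shift (c t) mDt).
by congr (lebesgue_rV R n _); apply/seteqP; split => x /=; rewrite shear_cons.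
Qed.

(** Projection along the direction (a, b) onto the hyperplane of first coordinate 0; it is meant for
    a != 0, that is, for directions transversal to the hyperplane. *)
Definition oblique_proj (a : R) (b : 'rV[R]_n) (p : 'rV[R]_n.+1) : 'rV[R]_n :=
  ((rV_uncons p).2 - (p 0 ord0 / a) *: b)%R.

Lemma rV_consZ (s : R) (p : R * 'rV[R]_n) : (s *: rV_cons p = rV_cons (s * p.1, s *: p.2))%R.
Proof.
apply/rowP => i; rewrite mxE; case: (unliftP ord0 i) => [j|] ->.
  by rewrite !rV_consS mxE.
by rewrite !rV_cons0.
Qed.

Lemma rV_cons_eta (p : 'rV[R]_n.+1) : rV_cons (p 0%R ord0, (rV_uncons p).2) = p.
Proof. exact: (rV_unconsK p). Qed.

(* A shear makes the direction of the tube vertical; the vertical lines then meet it in segments of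
   length `|a|. *)
Lemma lebesgue_tube_proj (C : set 'rV[R]_n.+1) (a : R) (b : 'rV[R]_n) :
  compact C -> a != 0%R -> measurable (oblique_proj a b @` C) ->
  (forall p q, C p -> C q -> oblique_proj a b p = oblique_proj a b q -> p = q) ->
  lebesgue_rV R n.+1 (tube C (rV_cons (a, b))) =
  `|a|%:E * lebesgue_rV R n (oblique_proj a b @` C).
Proof.
move=> cC a0 mP inj.
have mc : measurable_fun setT (fun t : R => (t / a) *: b)%R.
  by apply: measurable_funZ_rV => //; exact: measurable_funM.
rewrite -(lebesgue_rV_shear mc (measurable_tube _ cC)).
rewrite lebesgue_rV_lines; last exact: (measurable_preimage (measurable_shear mc) (measurable_tube _ cC)).
transitivity (\int[lebesgue_rV R n]_(x in oblique_proj a b @` C) (cst `|a|%:E) x); last first.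
  by rewrite integral_cst.
rewrite [RHS]integral_mkcond; apply: eq_integral => y _; rewrite patchE.
have onC t s : (rV_cons (t, y + (t / a) *: b) + s *: rV_cons (a, b) =
    rV_cons (t + s * a, y + ((t + s * a) / a) *: b))%R.
  rewrite rV_consZ rV_consD /=; congr (rV_cons (_, _)).
  by rewrite -addrA -scalerDl mulrDl mulfK.
have proj t : (oblique_proj a b (rV_cons (t, y + (t / a) *: b)) = y)%R.
  by rewrite /oblique_proj rV_cons0 rV_consK/= addrK.
case: ifPn => [/set_mem[p Cp py]|/negP ny]; last first.
  rewrite (_ : [set _ | _] = set0) ?measure0//; apply/seteqP; split => t //=.
  rewrite shear_cons => -[s _]; rewrite onC => Cs; apply: ny; apply/mem_set.
  by eexists; [exact: Cs|exact: proj].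
pose p0 := p 0%R ord0.
have pE : (p = rV_cons (p0, y + (p0 / a) *: b))%R.
  by rewrite -{1}(rV_cons_eta p) -py /oblique_proj subrK.
rewrite (_ : [set t | _] = [set t | exists2 s : R, (0 <= s <= 1)%R & (t + s * a = p0)%R]); last first.
  apply/seteqP; split => t /=; rewrite shear_cons => -[s s01].
    rewrite onC => Cs; exists s => //.
    have := inj _ _ Cs Cp; rewrite proj py => /(_ erefl) /(congr1 (fun z : 'rV[R]_n.+1 => z 0%R ord0)).
    by rewrite rV_cons0.
  by move=> tp; exists s => //; rewrite onC tp -pE.
have [apos|aneg] := ltP 0%R a.
  rewrite (_ : [set _ | _] = `[(p0 - a)%R, p0]%classic).
    rewrite lebesgue_measure_itv/= lte_fin ltrBlDr ltrDl apos gtr0_norm//.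
    by rewrite -EFinB opprB addrC subrK.
  apply/seteqP; split => t /=; rewrite in_itv/=.
    move=> [s /andP[s0 s1] <-]; apply/andP; split.
      by rewrite -addrA gerDl -[X in (_ - X)%R]mul1r -mulrBl mulr_le0_ge0 ?subr_le0// ltW.
    by rewrite lerDl mulr_ge0// ltW.
  move=> /andP[t1 t2]; exists ((p0 - t) / a)%R; last by rewrite divfK// subrKC.
  by rewrite divr_ge0 ?subr_ge0// ?(ltW apos)//= ler_pdivrMr// mul1r lerBlDr -lerBlDl.
have {}aneg : (a < 0)%R by rewrite lt_neqAle a0.
rewrite (_ : [set _ | _] = `[p0, (p0 - a)%R]%classic).
  rewrite lebesgue_measure_itv/= lte_fin ltrBrDr gtrDl aneg ltr0_norm//.
  by rewrite -EFinB addrAC subrr sub0r.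
apply/seteqP; split => t /=; rewrite in_itv/=.
  move=> [s /andP[s0 s1] <-]; apply/andP; split.
    by rewrite gerDl mulr_ge0_le0// ltW.
  by rewrite -addrA lerDl -[X in (_ - X)%R]mul1r -mulrBl mulr_le0 ?subr_le0// ltW.
move=> /andP[t1 t2]; exists ((p0 - t) / a)%R; last by rewrite divfK// subrKC.
rewrite -mulrNN -invrN opprB divr_ge0 ?subr_ge0 ?oppr_ge0 ?(ltW aneg)//=.
by rewrite ler_pdivrMr ?oppr_gt0// mul1r lerBlDr addrC.
Qed.

End shear.

Definition flat (R : realType) n (nu : 'rV[R]_n) (eta : R) (A : set 'rV[R]_n) :=
  forall p q, A p -> A q -> `|edot (p - q) nu| <= eta * enorm (p - q).

Section flat_tube.
Context {R : realType}.

Lemma lipschitz_continuous_rV m n (f : 'rV[R]_m -> 'rV[R]_n) (L : R) :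
  (forall x y, enorm (f x - f y) <= L * enorm (x - y)) -> continuous f.
Proof.
move=> fL x A /nbhs_eballP[r r0 rA]; apply/nbhs_eballP.
have L0 : 0 < 1 + `|L| by rewrite ltr_pwDl.
exists (r / (1 + `|L|)); first by rewrite divr_gt0.
move=> y; rewrite /eball/= => yx; apply: rA; rewrite /eball/=.
apply: (le_lt_trans (fL _ _)).
apply: (@le_lt_trans _ _ ((1 + `|L|) * enorm (y - x))).
  by rewrite ler_wpM2r ?enorm_ge0// (le_trans (ler_norm _))// lerDr.
by rewrite mulrC -ltr_pdivlMr.
Qed.

Lemma oblique_projB n (a : R) (b : 'rV[R]_n) p q :
  oblique_proj a b p - oblique_proj a b q = oblique_proj a b (p - q).
Proof. by apply/rowP => i; rewrite !mxE; ring. Qed.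

Lemma enorm_oblique_proj n (a : R) (b : 'rV[R]_n) p :
  enorm (oblique_proj a b p) <= enorm p + `|p 0 ord0| * (enorm b / `|a|).
Proof.
apply: (le_trans (ler_enormB _ _)); apply: lerD; first exact: ler_enorm_uncons.
by rewrite enormZ normrM normfV mulrAC mulrA.
Qed.

Lemma compact_oblique_proj n (a : R) (b : 'rV[R]_n) (C : set 'rV[R]_n.+1) :
  compact C -> compact (oblique_proj a b @` C).
Proof.
move=> cC; apply: continuous_compact => //; apply: continuous_subspaceT.
apply: (@lipschitz_continuous_rV _ _ _ (1 + enorm b / `|a|)) => x y.
rewrite oblique_projB; apply: (le_trans (enorm_oblique_proj _ _ _)).
rewrite mulrDl mul1r lerD2l mulrC ler_wpM2l ?divr_ge0 ?enorm_ge0//.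
exact: ler_coord_enorm.
Qed.

(** Differences x = p - q within [C] are almost horizontal. The norm of x exceeds that of its last
    coordinates by at most |x_0|, and these are shifted by at most |x_0| |b| / |a| under the
    projection; flatness bounds |x_0| by eta |x|. *)
Lemma oblique_proj_lipschitz n (a eta : R) (b : 'rV[R]_n) (C : set 'rV[R]_n.+1) p q :
  0 <= eta -> (forall p q, C p -> C q -> `|(p - q) 0 ord0| <= eta * enorm (p - q)) ->
  C p -> C q ->
  enorm (oblique_proj a b p - oblique_proj a b q) <=
    (1 + eta * (1 + enorm b / `|a|)) * enorm (p - q) /\
  (1 - eta * (1 + enorm b / `|a|)) * enorm (p - q) <=
    enorm (oblique_proj a b p - oblique_proj a b q).
Proof.
move=> eta0 fC Cp Cq; have := fC p q Cp Cq.
rewrite oblique_projB; set x := p - q => hx.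
have ba : 0 <= enorm b / `|a| by rewrite divr_ge0 ?enorm_ge0.
have hm : `|x 0 ord0| * (enorm b / `|a|) <= eta * enorm x * (enorm b / `|a|).
  by rewrite ler_wpM2r.
have x0 := enorm_ge0 x.
have ex : 0 <= eta * enorm x by rewrite mulr_ge0.
split.
  have := enorm_oblique_proj a b x; nra.
have h1 := enorm_uncons_le x.
have h2 : enorm (rV_uncons x).2 <= enorm (oblique_proj a b x) + `|x 0 ord0| * (enorm b / `|a|).
  have -> : (rV_uncons x).2 = oblique_proj a b x + (x 0 ord0 / a) *: b.
    by rewrite /oblique_proj subrK.
  apply: (le_trans (ler_enormD _ _)); rewrite lerD2l.
  by rewrite enormZ normrM normfV mulrAC mulrA.
nra.
Qed.

(** The two Lipschitz bounds compare [C] with its projection, whose Hausdorff measure is its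
    Lebesgue measure. The lower one also gives the injectivity that [lebesgue_tube_proj] asks
    for. *)
Lemma lebesgue_tube_flat0 m (a eta : R) (b : 'rV[R]_m.+1) (C : set 'rV[R]_m.+2) :
  compact C -> a != 0 -> 0 <= eta -> eta * (1 + enorm b / `|a|) < 1 ->
  (forall p q, C p -> C q -> `|(p - q) 0 ord0| <= eta * enorm (p - q)) ->
  ((`|a| * (1 - eta * (1 + enorm b / `|a|)) ^+ m.+1)%:E * hausdorff_measure m.+1 C <=
   lebesgue_rV R m.+2 (tube C (rV_cons (a, b))) <=
   (`|a| * (1 + eta * (1 + enorm b / `|a|)) ^+ m.+1)%:E * hausdorff_measure m.+1 C)%E.
Proof.
move=> cC a0 eta0; set k := eta * _ => k1 fC.
have lip p q := @oblique_proj_lipschitz _ a eta b C p q eta0 fC.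
have k0 : 0 <= k by rewrite mulr_ge0// addr_ge0// divr_ge0// enorm_ge0.
have mP : measurable (oblique_proj a b @` C).
  by apply: compact_measurable_rV; exact: compact_oblique_proj.
rewrite lebesgue_tube_proj//; last first.
  move=> p q Cp Cq pq; have [_] := lip p q Cp Cq.
  rewrite pq subrr enorm0 pmulr_rle0 ?subr_gt0// => h; apply/eqP.
  by rewrite -subr_eq0 -enorm_eq0 eq_le h enorm_ge0.
rewrite -hausdorff_lebesgue// !EFinM -!muleA; apply/andP; split; apply: lee_wpmul2l => //.
  have k10 : 0 < 1 - k by rewrite subr_gt0.
  rewrite -lee_pdivlMl ?exprn_gt0// -exprVn -[X in (hausdorff_measure _ X <= _)%E]image_id.
  apply: hausdorff_measure_lipschitz; first by rewrite invr_gt0.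
  move=> p q Cp Cq; rewrite mulrC ler_pdivlMr// mulrC.
  by have [_] := lip p q Cp Cq.
rewrite -[X in (_ <= _ * hausdorff_measure _ X)%E]image_id.
apply: hausdorff_measure_lipschitz; first by rewrite ltr_pwDl.
by move=> p q Cp Cq; have [] := lip p q Cp Cq.
Qed.

Section reflection.
Context {n : nat}.
Implicit Types w x y : 'rV[R]_n.

(* For w = 0 the quotient is 0, so that this is the identity. *)
Definition reflection w x := x - (2 * edot x w / edot w w) *: w.

Lemma edot_eq0 w : edot w w = 0 -> w = 0.
Proof. by move=> /eqP; rewrite -sqr_enorm expf_eq0/= enorm_eq0 => /eqP. Qed.

Lemma edot_reflection w x y : edot (reflection w x) (reflection w y) = edot x y.
Proof.
rewrite /reflection !edotBl !edotBr !edotZl !edotZr (edotC w y).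
have [w0|w0] := eqVneq (edot w w) 0; last by field.
by rewrite (edot_eq0 w0) !edot0r; ring.
Qed.

Lemma reflectionB w : {morph reflection w : x y / x - y}.
Proof. by move=> x y; rewrite /reflection edotBl; apply/rowP => i; rewrite !mxE; ring. Qed.

Lemma reflectionD w : {morph reflection w : x y / x + y}.
Proof. by move=> x y; rewrite /reflection edotDl; apply/rowP => i; rewrite !mxE; ring. Qed.

Lemma reflectionZ w a x : reflection w (a *: x) = a *: reflection w x.
Proof. by rewrite /reflection edotZl; apply/rowP => i; rewrite !mxE; ring. Qed.

Lemma reflectionK w : involutive (reflection w).
Proof.
move=> x; rewrite {1}/reflection {1}/reflection edotBl edotZl.
have [w0|w0] := eqVneq (edot w w) 0.
  by rewrite /reflection (edot_eq0 w0) !edot0r !scaler0 !subr0.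
by apply/rowP => i; rewrite !mxE; field.
Qed.

Lemma enorm_reflection w x : enorm (reflection w x) = enorm x.
Proof. by rewrite /enorm edot_reflection. Qed.

Lemma measurable_reflection w : measurable_fun setT (reflection w).
Proof.
apply: measurable_funB_rV; first exact: measurable_id.
apply: measurable_funZ_rV; last exact: measurable_cst.
apply: measurable_funM => //; apply: measurable_funM => //.
by apply: measurable_fun_edot; [exact: measurable_id|exact: measurable_cst].
Qed.

Lemma continuous_reflection w : continuous (reflection w).
Proof.
by apply: (@lipschitz_continuous_rV _ _ _ 1) => x y; rewrite -reflectionB enorm_reflection mul1r.
Qed.

Lemma lebesgue_rV_reflection w (A : set 'rV[R]_n) : measurable A ->
  lebesgue_rV R n (reflection w @^-1` A) = lebesgue_rV R n A.
Proof.
apply: (lebesgue_rV_isometry (g := reflection w)).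
- exact: measurable_reflection.
- exact: measurable_reflection.
- exact: reflectionK.
- exact: reflectionK.
- exact: reflectionD.
- exact: enorm_reflection.
Qed.

(** The reflection along nu - e sends nu to e; it reduces a flat set with arbitrary unit normal to
    the case where the normal is the first axis. *)
Lemma reflection_unit nu e : enorm nu = 1 -> enorm e = 1 -> reflection (nu - e) nu = e.
Proof.
move=> nu1 e1; rewrite /reflection.
have nn : edot nu nu = 1 by rewrite -sqr_enorm nu1 expr1n.
have ee : edot e e = 1 by rewrite -sqr_enorm e1 expr1n.
have [w0|w0] := eqVneq (edot (nu - e) (nu - e)) 0.
  have /eqP := edot_eq0 w0; rewrite subr_eq0 => /eqP ->.
  by rewrite subrr scaler0 subr0.
have -> : 2 * edot nu (nu - e) / edot (nu - e) (nu - e) = 1.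
  rewrite -[RHS](mulfV w0); congr (_ / _).
  rewrite !edotBl !edotBr nn ee (edotC e nu); ring.
by rewrite scale1r subKr.
Qed.

End reflection.

Definition e0 n : 'rV[R]_n.+1 := \row_j (j == ord0)%:R.

Lemma edot_e0 n (x : 'rV[R]_n.+1) : edot x (e0 n) = x 0 ord0.
Proof.
rewrite /edot big_ord_recl mxE eqxx mulr1 big1 ?addr0// => i _.
by rewrite mxE mulr0.
Qed.

Lemma enorm_e0 n : enorm (e0 n) = 1.
Proof. by rewrite /enorm edot_e0 mxE eqxx sqrtr1. Qed.

(** For an admissible direction |b| / |a| <= 1 / kappa, so the distortion is at most kappa ^ 2 / 2 *
    (1 + 1 / kappa) = (kappa ^ 2 + kappa) / 2 <= kappa. This is the origin of the flatness constant
    kappa ^ 2 / 2. *)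
Lemma lebesgue_tube_flat m (nu xi : 'rV[R]_m.+2) (kappa : R) (C : set 'rV[R]_m.+2) :
  compact C -> enorm nu = 1 -> 0 < kappa < 1 -> flat nu (kappa ^+ 2 / 2) C ->
  xi != 0 -> kappa * enorm xi <= `|edot xi nu| ->
  ((`|edot xi nu| * (1 - kappa) ^+ m.+1)%:E * hausdorff_measure m.+1 C <=
   lebesgue_rV R m.+2 (tube C xi) <=
   (`|edot xi nu| * (1 + kappa) ^+ m.+1)%:E * hausdorff_measure m.+1 C)%E.
Proof.
move=> cC nu1 /andP[k0 k1] fC xi0 good.
pose T := reflection (nu - e0 m.+1).
have Te x : (T x) 0 ord0 = edot x nu.
  by rewrite -edot_e0 -(reflection_unit nu1 (enorm_e0 _)) edot_reflection.
pose D := T @` C.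
have cD : compact D.
  by apply: continuous_compact => //; apply: continuous_subspaceT; exact: continuous_reflection.
have HD : hausdorff_measure m.+1 D = hausdorff_measure m.+1 C.
  by apply: hausdorff_measure_isometry => x y; rewrite -reflectionB enorm_reflection.
pose a := (T xi) 0 ord0; pose b := (rV_uncons (T xi)).2.
have xin : 0 < enorm xi by rewrite lt0r enorm_eq0 xi0 enorm_ge0.
have aE : a = edot xi nu by rewrite /a Te.
have apos : 0 < `|a| by rewrite aE (lt_le_trans _ good)// mulr_gt0.
have a0 : a != 0 by rewrite -normr_gt0.
have bx : enorm b <= enorm xi.
  by rewrite -(enorm_reflection (nu - e0 m.+1) xi); exact: ler_enorm_uncons.
have tD : tube D (rV_cons (a, b)) = T @^-1` tube C xi.
  rewrite rV_cons_eta; apply/seteqP; split => x [s s01].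
    move=> [c Cc ce]; exists s => //; rewrite (_ : T x + s *: xi = c)//.
    apply: (can_inj (reflectionK (nu - e0 m.+1))).
    by rewrite reflectionD reflectionK reflectionZ.
  move=> Cs; exists s => //; exists (T x + s *: xi) => //.
  by rewrite /T reflectionD reflectionK reflectionZ.
rewrite -(lebesgue_rV_reflection (nu - e0 m.+1) (measurable_tube xi cC)) -/T -tD -HD.
have eta0 : 0 <= kappa ^+ 2 / 2 by rewrite divr_ge0// sqr_ge0.
set l := kappa ^+ 2 / 2 * (1 + enorm b / `|a|).
have lk : l <= kappa.
  have ba : enorm b / `|a| <= kappa^-1.
    rewrite ler_pdivrMr// mulrC ler_pdivlMr// mulrC aE; apply: le_trans good.
    by rewrite ler_pM2l.
  have : l <= kappa ^+ 2 / 2 * (1 + kappa^-1) by rewrite ler_wpM2l// lerD2l.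
  rewrite mulrDr mulr1 expr2 [X in _ + X](_ : _ = kappa / 2); last by field; rewrite gt_eqF.
  nra.
have l0 : 0 <= l by rewrite mulr_ge0// addr_ge0// divr_ge0// enorm_ge0.
have fD p q : D p -> D q -> `|(p - q) 0 ord0| <= kappa ^+ 2 / 2 * enorm (p - q).
  move=> [p' Cp' <-] [q' Cq' <-].
  by rewrite -reflectionB enorm_reflection Te; exact: fC.
have /andP[h1 h2] := lebesgue_tube_flat0 cD a0 eta0 (le_lt_trans lk k1) fD.
rewrite -/l -aE in h1 h2 *; apply/andP; split.
  apply: le_trans h1; apply: lee_wpmul2r; first exact: hausdorff_measure_ge0.
  by rewrite lee_fin ler_pM2l//; apply: lerXn2r; rewrite ?nnegrE; lra.
apply: (le_trans h2); apply: lee_wpmul2r; first exact: hausdorff_measure_ge0.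
by rewrite lee_fin ler_pM2l//; apply: lerXn2r; rewrite ?nnegrE; lra.
Qed.

End flat_tube.

(** * Rectifiable sets *)

Section regularity.
Context {R : realType} {n : nat} (mu : {measure set 'rV[R]_n -> \bar R}).
Hypothesis mu_fin : (mu setT < +oo)%E.
Local Open Scope ereal_scope.

Definition closed_open_regular (A : set 'rV[R]_n) := forall e : R, (0 < e)%R ->
  exists F U, [/\ closed F, open U, F `<=` A, A `<=` U & mu (U `\` F) <= e%:E].

Let mu_lty A : measurable A -> mu A < +oo.
Proof. by move=> mA; apply: le_lt_trans mu_fin; apply: le_measure; rewrite ?inE. Qed.

Let co_measurable (F U : set 'rV[R]_n) : closed F -> open U -> measurable (U `\` F).
Proof.
by move=> cF oU; apply: measurableD; [exact: open_measurable_rV|exact: closed_measurable_rV].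
Qed.

Lemma closed_open_regularC A : closed_open_regular A -> closed_open_regular (~` A).
Proof.
move=> rA e e0; have [F [U [cF oU FA AU FU]]] := rA e e0.
exists (~` U), (~` F); split; [exact: open_closedC|exact: closed_openC|exact: subsetC|exact: subsetC|].
by rewrite setDE setCK setIC -setDE.
Qed.

Lemma measure_tail_le (F : (set 'rV[R]_n)^nat) (e : R) : (0 < e)%R ->
  (forall k, measurable (F k)) -> (forall k, F k `<=` F k.+1) ->
  exists k, mu ((\bigcup_j F j) `\` F k) <= e%:E.
Proof.
move=> e0 mF ndF.
have mono i j : (i <= j)%N -> F i `<=` F j.
  elim: j => [|j IH]; first by rewrite leqn0 => /eqP ->.
  by rewrite leq_eqVlt ltnS => /orP[/eqP ->//|/IH h]; exact: subset_trans h (ndF j).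
pose D k := (\bigcup_j F j) `\` F k.
have mU : measurable (\bigcup_j F j) by exact: bigcupT_measurable.
have mD k : measurable (D k) by exact: measurableD.
have D0 : \bigcap_k D k = set0.
  apply/seteqP; split => x // h; have [[j _ Fj] _] := h 0%N I.
  by have [_] := h j I; apply.
have cvgD : mu \o D @ \oo --> mu (\bigcap_k D k).
  apply: nonincreasing_cvg_mu => //; first exact: mu_lty.
    exact: bigcapT_measurable.
  move=> i j ij; apply/subsetPset => x [h nF]; split => // Fi; apply: nF.
  exact: mono ij x Fi.
rewrite D0 measure0 in cvgD.
have /fine_cvgP[_ /cvgrPdist_lt/(_ e e0)[N _ hN]] := cvgD.
exists N; have := hN N (leqnn N); rewrite /= sub0r normrN => h.
have fin : mu (D N) \is a fin_num by rewrite ge0_fin_numE// mu_lty.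
by rewrite -(fineK fin) lee_fin (le_trans (ler_norm _))// ltW.
Qed.

(** A countable union of closed sets need not be closed, so the inner approximation is a finite
    union. Half of e pays for the discarded tail, which is small because [mu] is finite; the other
    half is shared geometrically among the sets. *)
Lemma closed_open_regular_bigcup (A : (set 'rV[R]_n)^nat) :
  (forall k, closed_open_regular (A k)) -> closed_open_regular (\bigcup_k A k).
Proof.
move=> rA e e0.
have e20 : (0 < e / 2)%R by rewrite divr_gt0.
have ex k : exists FU : set 'rV[R]_n * set 'rV[R]_n, [/\ closed FU.1, open FU.2,
    FU.1 `<=` A k, A k `<=` FU.2 & mu (FU.2 `\` FU.1) <= (e / 2 / (2 ^ k.+1)%:R)%:E].
  have [|F [U h]] := rA k (e / 2 / (2 ^ k.+1)%:R)%R; first by rewrite divr_gt0// ltr0n expn_gt0.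
  by exists (F, U).
have [FU FUP] := choice ex.
pose F k := (FU k).1; pose U k := (FU k).2.
have cF k : closed (F k) by have [] := FUP k.
have oU k : open (U k) by have [] := FUP k.
pose G k := \big[setU/set0]_(i < k) F i.
have cG k : closed (G k) by apply: closed_bigsetU => i _; exact: cF.
have GE : \bigcup_k G k = \bigcup_k F k.
  apply/seteqP; split => x [k _].
    by rewrite /G -bigcup_mkord => -[i _ Fi]; exists i.
  by move=> Fk; exists k.+1 => //; rewrite /G -bigcup_mkord; exists k => /=.
have [N hN] : exists k, mu ((\bigcup_j G j) `\` G k) <= (e / 2)%:E.
  apply: measure_tail_le => // [k|k x]; first exact: closed_measurable_rV.
  by rewrite /G big_ord_recr/=; left.
exists (G N), (\bigcup_k U k); split => //.
- by apply: bigcup_open => k _; exact: oU.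
- move=> x; rewrite /G -bigcup_mkord => -[k _ Fk]; exists k => //.
  by have [_ _ h _ _] := FUP k; exact: h.
- by move=> x [k _ Ak]; exists k => //; have [_ _ _ h _] := FUP k; exact: h.
have mUF k : measurable (U k `\` F k) by exact: co_measurable.
have mGN : measurable ((\bigcup_j G j) `\` G N).
  apply: measurableD; last exact: closed_measurable_rV.
  by apply: bigcupT_measurable => k; exact: closed_measurable_rV.
apply: (@le_trans _ _ (mu ((\bigcup_k (U k `\` F k)) `|` ((\bigcup_j G j) `\` G N)))).
  apply: le_measure; rewrite ?inE.
  - by apply: co_measurable => //; apply: bigcup_open => k _; exact: oU.
  - by apply: measurableU => //; exact: bigcupT_measurable.
  move=> x [[k _ Uk] nG]; have [Fx|nF] := pselect ((\bigcup_k F k) x).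
    by right; split => //; rewrite GE.
  by left; exists k => //; split => // Fk; apply: nF; exists k.
apply: (le_trans (measureU2 _ _ _)) => //; first exact: bigcupT_measurable.
rewrite [e in e%:E]splitr EFinD; apply: leeD => //.
apply: (@le_trans _ _ (\sum_(k <oo) mu (U k `\` F k))).
  by apply: measure_sigma_subadditive => //; exact: bigcupT_measurable.
apply: (@le_trans _ _ (\sum_(k <oo) (e / 2 / (2 ^ k.+1)%:R)%:E)).
  by apply: lee_nneseries => // k _; have [] := FUP k.
apply: (le_trans (epsilon_trick0 xpredT (ltW e20))).
by [].
Qed.

(** The regular sets form a sigma-algebra, and it contains each open half-space, an increasing union
    of closed half-spaces. *)
Lemma measurable_closed_open_regular A : measurable A -> closed_open_regular A.
Proof.
have r0 : closed_open_regular set0.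
  by move=> e e0; exists set0, set0; split; [exact: closed0|exact: open0|by []|by []|by rewrite setD0 measure0 lee_fin ltW].
apply: smallest_sub.
  split => //; first by move=> B; rewrite setTD; exact: closed_open_regularC.
  exact: closed_open_regular_bigcup.
move=> B; rewrite -bigcup_seq => -[i _ [Y mY <-]]; rewrite setTI.
have {}mY : (@RGenOInfty.G R).-sigma.-measurable Y by rewrite -RGenOInfty.measurableE.
move: Y mY.
pose P := [set B : set R | closed_open_regular ((fun x : 'rV[R]_n => x 0%R i) @^-1` B)].
apply: (@smallest_sub _ _ _ P).
  split; first by rewrite /P/= preimage_set0.
    by move=> B' PB; rewrite /P/= setTD preimage_setC; exact: closed_open_regularC.
  by move=> F PF; rewrite /P/= preimage_bigcup; exact: closed_open_regular_bigcup.
move=> _ [a ->]; rewrite /P/= => e e0.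
have ci : continuous (fun x : 'rV[R]_n => x 0%R i) by exact: coord_continuous.
pose F (k : nat) := (fun x : 'rV[R]_n => x 0%R i) @^-1` `[(a + k.+1%:R^-1)%R, +oo[%classic.
have cF k : closed (F k).
  by apply: (preimage_closed (f := fun x : 'rV[R]_n => x 0%R i)) => [x _|]; [exact: ci|exact: interval_closed].
set U := _ @^-1` _.
have oU : open U.
  by apply: (open_comp (f := fun x : 'rV[R]_n => x 0%R i)) => [x _|]; [exact: ci|exact: interval_open].
have FU : \bigcup_k F k = U.
  apply/seteqP; split => x.
    move=> [k _]; rewrite /F/U/= !in_itv/= !andbT; apply: lt_le_trans.
    by rewrite ltrDl invr_gt0.
  rewrite /U/= in_itv/= andbT -subr_gt0 => h.
  have [k _ kP] := near_infty_natSinv_lt (PosNum h).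
  have {}kP : (k.+1%:R^-1 < x 0 i - a)%R := kP k (leqnn k).
  by exists k => //; rewrite /F/= in_itv/= andbT -lerBrDl ltW.
have [k hk] : exists k, mu ((\bigcup_j F j) `\` F k) <= e%:E.
  apply: measure_tail_le => // [k|k x]; first exact: closed_measurable_rV.
  rewrite /F/= !in_itv/= !andbT; apply: le_trans.
  by rewrite lerD2l lef_pV2 ?posrE// ler_nat.
exists (F k), U; split => //; last by rewrite -FU.
by rewrite -FU => x Fx; exists k.
Qed.

End regularity.

Section hausdorff_inner_regular.
Context {R : realType} {n : nat} (s : nat).
Hypothesis s_gt0 : (0 < s)%N.
Local Open Scope ereal_scope.

(** Regularity is available for finite measures only; it is applied to the restriction of H to
    [B]. *)
Lemma hausdorff_closed_inner (B : set 'rV[R]_n) (e : R) : measurable B ->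
  hausdorff_measure s B < +oo -> (0 < e)%R ->
  exists F, [/\ closed F, F `<=` B & hausdorff_measure s (B `\` F) <= e%:E].
Proof.
move=> mB HB e0.
pose mu : {measure set 'rV[R]_n -> \bar R} := hausdorff_restr B s_gt0.
have muE A : mu A = hausdorff_measure s (A `&` B) by [].
have [|F [U [cF oU FB BU UF]]] := measurable_closed_open_regular (mu := mu) _ mB e0.
  by rewrite muE setTI.
exists F; split => //; apply: le_trans UF; rewrite muE.
by apply: subset_hausdorff_measure => x [Bx nF]; split => //; split => //; exact: BU.
Qed.

(* A Borel set G containing P \ X with the same measure reduces X to the Borel set P \ G, up to
   the null set G & X. *)
Lemma hausdorff_compact_inner (X P : set 'rV[R]_n) (e : R) :
  (hausdorff_measure s).-caratheodory X -> compact P ->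
  hausdorff_measure s P < +oo -> (0 < e)%R ->
  exists F, [/\ compact F, F `<=` X `&` P & hausdorff_measure s ((X `&` P) `\` F) <= e%:E].
Proof.
move=> cX cP HP e0; have mP := compact_measurable_rV cP.
have [G mG [PG HG]] := hausdorff_borel_regular s (P `\` X).
have HGfin : hausdorff_measure s (G `&` ~` X) \is a fin_num.
  rewrite ge0_fin_numE ?hausdorff_measure_ge0//; apply: le_lt_trans HP.
  apply: (@le_trans _ _ (hausdorff_measure s G)); first exact: subset_hausdorff_measure.
  by rewrite HG; apply: subset_hausdorff_measure => x [].
(* G minus X still contains P minus X and so has the full measure of G. The Carathéodory splitting
   of G by X then leaves measure 0 for the part in X, the cancellation being allowed by
   finiteness. *)
have HXG : hausdorff_measure s (G `&` X) = 0.
  have GX : hausdorff_measure s (G `&` ~` X) = hausdorff_measure s G.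
    apply/eqP; rewrite eq_le; apply/andP; split.
      by apply: subset_hausdorff_measure => x [].
    rewrite HG; apply: subset_hausdorff_measure => x [Px nX]; split => //.
    exact: PG.
  by rewrite -[LHS](addeK _ HGfin) -(cX G) GX subee// -GX.
pose B := P `\` G.
have mB : measurable B by exact: measurableD.
have HB : hausdorff_measure s B < +oo.
  by apply: le_lt_trans HP; apply: subset_hausdorff_measure => x [].
have [F [cF FB HF]] := hausdorff_closed_inner mB HB e0.
exists F; split.
- apply: (subclosed_compact cF cP) => x /FB[].
  by [].
- move=> x /FB[Px nG]; split => //; apply: contrapT => nX; apply: nG.
  exact: PG.
apply: (@le_trans _ _ (hausdorff_measure s ((G `&` X) `|` (B `\` F)))).
  apply: subset_hausdorff_measure => x [[Xx Px] nF].
  by have [Gx|nG] := pselect (G x); [left|right].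
by apply: (le_trans (hausdorff_measureU_le s_gt0 _ _)); rewrite HXG add0e.
Qed.

End hausdorff_inner_regular.

(** * C^1 graphs are locally almost flat *)

Section c1_graph_flat.
Context {R : realType} {n : nat}.
Implicit Types (x y z v nu : 'rV[R]_n) (f : 'rV[R]_n -> R).

Lemma derive_coord_sum f x v : differentiable f x ->
  'D_v f x = \sum_i v 0 i * 'D_(delta_mx 0 i) f x.
Proof.
move=> df; rewrite deriveE// {1}(row_sum_delta v) linear_sum; apply: eq_bigr => i _.
by rewrite linearZ deriveE.
Qed.

Lemma segment_mean_value f x v :
  (forall t : R, 0 <= t <= 1 -> differentiable f (x + t *: v)) ->
  exists2 t : R, 0 <= t <= 1 & f (x + v) - f x = 'D_v f (x + t *: v).
Proof.
move=> df; pose phi (t : R) := f (x + t *: v).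
have qE (t : R) : (fun h : R => h^-1 *: ((phi \o shift t) (h *: (1 : R)) - phi t)) =
    (fun h : R => h^-1 *: ((f \o shift (x + t *: v)) (h *: v) - f (x + t *: v))).
  apply/funext => h /=; congr (_ *: (_ - _)); rewrite /phi; congr f.
  by apply/rowP => i; rewrite !mxE /GRing.scale/=; ring.
have dphi (t : R) : 0 <= t <= 1 -> derivable phi t 1.
  move=> t01; rewrite /derivable qE; exact: diff_derivable (df t t01).
have Dphi (t : R) : 'D_1 phi t = 'D_v f (x + t *: v) by rewrite /derive qE.
have [||c] := @MVT R phi (fun t => 'D_v f (x + t *: v)) 0 1 ltr01.
- move=> t; rewrite in_itv/= => /andP[t0 t1]; apply: DeriveDef; last exact: Dphi.
  by apply: dphi; rewrite !ltW.
- apply: derivable_within_continuous => t; rewrite in_itv/=.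
  exact: dphi.
rewrite in_itv/= => /andP[c0 c1]; rewrite subr0 mulr1 /phi scale1r scale0r addr0 => h.
by exists c; rewrite ?ltW.
Qed.

Lemma eball_segment (z x v : 'rV[R]_n) (r t : R) : 0 <= t <= 1 -> eball z r x ->
  eball z r (x + v) -> eball z r (x + t *: v).
Proof.
rewrite /eball/= => /andP[t0 t1] hx hv.
have -> : x + t *: v - z = (1 - t) *: (x - z) + t *: (x + v - z).
  by apply/rowP => i; rewrite !mxE; ring.
apply: (le_lt_trans (ler_enormD _ _)); rewrite !enormZ !ger0_norm ?subr_ge0//.
have [->|t0'] := eqVneq t 0; first by rewrite subr0 mul0r addr0 mul1r.
have {t0'} : 0 < t by rewrite lt0r t0'.
nra.
Qed.

(** Differentiability at z controls only increments starting at z. By continuity of the partial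
    derivatives, one gradient g serves all pairs of points near z, through the mean value theorem on
    the segment joining them. *)
Lemma c1_strictly_differentiable (U : set 'rV[R]_n) f z (eta : R) :
  open U -> C1_on U f -> U z -> 0 < eta ->
  exists2 r : R, 0 < r & exists g : 'rV[R]_n, forall x y,
    eball z r x -> eball z r y -> U x /\ `|f y - f x - edot (y - x) g| <= eta * enorm (y - x).
Proof.
move=> oU fC Uz eta0.
have e0 : 0 < eta / n.+1%:R by rewrite divr_gt0.
have ev : \forall c \near z, U c /\
    forall i, `|'D_(delta_mx 0 i) f z - 'D_(delta_mx 0 i) f c| < eta / n.+1%:R.
  apply: filterI; first exact: open_nbhs_nbhs.
  apply: (@filter_forall _ _ _ _ (nbhs_filter z)) => i.
  have [_ ci] := fC z Uz.
  exact: (@cvgrPdist_lt _ _ _ (nbhs z) (nbhs_filter z) _ _).1 (ci (delta_mx 0 i)) _ e0.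
have [r r0 hr] := (nbhs_eballP _ _).1 ev.
exists r => //; exists (\row_i 'D_(delta_mx 0 i) f z) => x y hx hy.
split; first by have [] := hr x hx.
set v := y - x; have yE : y = x + v by rewrite /v addrC subrK.
rewrite yE in hy *.
have seg (t : R) : 0 <= t <= 1 -> eball z r (x + t *: v) by move=> t01; exact: eball_segment.
have dseg (t : R) : 0 <= t <= 1 -> differentiable f (x + t *: v).
  by move=> t01; have [Uc _] := hr _ (seg t t01); have [] := fC _ Uc.
have [t t01 ->] := segment_mean_value dseg.
rewrite derive_coord_sum; last exact: dseg.
rewrite /edot -sumrB; apply: (le_trans (ler_norm_sum _ _ _)).
have [_ hc] := hr _ (seg t t01).
apply: (@le_trans _ _ (\sum_(i < n) (eta / n.+1%:R) * enorm v)).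
  apply: ler_sum => i _; rewrite [X in _ - _ * X]mxE -/v -mulrBr normrM mulrC.
  apply: ler_pM => //; last exact: ler_coord_enorm.
  by rewrite distrC ltW.
rewrite sumr_const card_ord -(mulr_natl (_ * _)) mulrA ler_wpM2r ?enorm_ge0//.
by rewrite mulrCA ger_pMr// ler_pdivrMr// mul1r ler_nat.
Qed.

(** The normal is that of the tangent plane at p, before normalization N = nu - gt with gt the
    tangential gradient. For points of the graph over z and z', (q - q').N is the remainder f z - f
    z' - (z - z').g, while |z - z'| <= |q - q'| and |N| >= 1. *)
Lemma c1_graph_locally_flat (S : set 'rV[R]_n) p (eta : R) : C1_graph S -> S p -> 0 < eta ->
  exists2 r : R, 0 < r & exists2 nu : 'rV[R]_n, enorm nu = 1 & flat nu eta (S `&` eball p r).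
Proof.
move=> [nu [U [f [nu1 oU fC ->]]]] [z0 [Uz0 /= z0nu] pE] eta0.
have [r r0 [g hg]] := c1_strictly_differentiable oU fC Uz0 eta0.
exists r => //.
have nn : edot nu nu = 1 by rewrite -sqr_enorm nu1 expr1n.
have NN h : edot h nu = 0 -> edot (nu - h) (nu - h) = 1 + edot h h.
  by move=> hnu; rewrite !edotBl !edotBr (edotC nu h) hnu nn; ring.
(* [f] is also defined off the hyperplane, so its gradient may have a component along nu; removing
   it does not change the products with differences z - z' in the hyperplane. *)
pose gt := g - edot g nu *: nu.
have gtnu : edot gt nu = 0 by rewrite edotBl edotZl nn mulr1 subrr.
pose N := nu - gt.
have N1 : 1 <= enorm N.
  rewrite -(ler_pXn2r (n := 2)) ?nnegrE ?enorm_ge0// expr1n sqr_enorm.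
  by rewrite NN// lerDl edot_ge0.
have N0 : 0 < enorm N := lt_le_trans ltr01 N1.
have orth a b : edot a nu = 0 -> edot (a + b *: nu) (a + b *: nu) = edot a a + b ^+ 2.
  by move=> h; rewrite !edotDl !edotDr !edotZl !edotZr (edotC nu a) h nn; ring.
exists ((enorm N)^-1 *: N).
  by rewrite enormZ normfV gtr0_norm// mulVf// gt_eqF.
move=> q q' [[z [Uz /= znu] qE] qr] [[z' [Uz' /= z'nu] q'E] q'r].
have dE w w' : w + f w *: nu - (w' + f w' *: nu) = w - w' + (f w - f w') *: nu.
  by apply/rowP => i; rewrite !mxE; ring.
have dle w w' : edot w nu = 0 -> edot w' nu = 0 ->
    enorm (w - w') <= enorm (w + f w *: nu - (w' + f w' *: nu)).
  move=> h h'; rewrite dE /enorm ler_sqrt ?edot_ge0//.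
  have hh : edot (w - w') nu = 0 by rewrite edotBl h h' subrr.
  by rewrite orth// lerDl sqr_ge0.
have zr : eball z0 r z.
  rewrite /eball/= (le_lt_trans (dle _ _ znu z0nu))//.
  by move: qr; rewrite /eball/= -qE -pE.
have zr' : eball z0 r z'.
  rewrite /eball/= (le_lt_trans (dle _ _ z'nu z0nu))//.
  by move: q'r; rewrite /eball/= -q'E -pE.
have [_ hd] := hg z' z zr' zr.
rewrite edotZr normrM normfV (gtr0_norm N0) mulrC ler_pdivrMr//.
have -> : edot (q - q') N = f z - f z' - edot (z - z') g.
  rewrite -qE -q'E dE /N /gt !(edotBr, edotZr, edotDl, edotZl, edotNl) znu z'nu nn.
  by rewrite (edotC nu g); ring.
apply: (le_trans hd); apply: (@le_trans _ _ (eta * enorm (q - q'))).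
  by apply: ler_wpM2l; [exact: ltW|rewrite -qE -q'E; exact: (dle z z' znu z'nu)].
by rewrite ler_peMr// mulr_ge0 ?enorm_ge0// ltW.
Qed.

Lemma lipschitz_continuous_R f (L : R) :
  (forall x y, `|f x - f y| <= L * enorm (x - y)) -> continuous f.
Proof.
move=> fL x; apply/(@cvgrPdist_lt _ _ _ (nbhs x) (nbhs_filter x)) => e e0.
have L0 : 0 < 1 + `|L| by rewrite ltr_pwDl.
apply/nbhs_eballP; exists (e / (1 + `|L|)); first by rewrite divr_gt0.
move=> y; rewrite /eball/= => yx; apply: (le_lt_trans (fL _ _)).
apply: (@le_lt_trans _ _ ((1 + `|L|) * enorm (x - y))).
  by rewrite ler_wpM2r ?enorm_ge0// (le_trans (ler_norm _))// lerDr.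
by rewrite enormC mulrC -ltr_pdivlMr.
Qed.

Lemma closed_ball_closed (q : 'rV[R]_n) (r : R) : closed [set y | enorm (y - q) <= r].
Proof.
have cf : continuous (fun y : 'rV[R]_n => enorm (y - q)).
  apply: (@lipschitz_continuous_R _ 1) => x y.
  by rewrite mul1r (le_trans (ler_dist_enorm _ _))// opprB addrA subrK.
apply: (preimage_closed (f := fun y : 'rV[R]_n => enorm (y - q)) (D := [set t | t <= r])).
  by move=> x _; exact: cf.
exact: closed_le.
Qed.

(** A Lindelöf argument: each point of [K] lies in a ball with rational centre and radius 1 / (j +
    1) in which [K] is flat. Closed balls keep the pieces compact, and codes of balls without
    flatness yield the empty set. *)
Lemma compact_c1_graph_cover (K S : set 'rV[R]_n) (eta : R) : compact K -> C1_graph S ->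
  K `<=` S -> 0 < eta ->
  exists P : (set 'rV[R]_n)^nat, [/\ forall k, compact (P k),
    forall k, exists2 nu, enorm nu = 1 & flat nu eta (P k) & K `<=` \bigcup_k P k].
Proof.
move=> cK CS KS eta0.
have [nu0 nu01] : exists nu0 : 'rV[R]_n, enorm nu0 = 1 by have [nu [U [f [h _ _ _]]]] := CS; exists nu.
pose B (q : 'rV[rat]_n) (j : nat) : set 'rV[R]_n :=
  K `&` [set y | enorm (y - map_mx ratr q) <= j.+1%:R^-1].
have cB q j : compact (B q j) by apply: compact_closedI => //; exact: closed_ball_closed.
pose good (c : 'rV[rat]_n * nat) := exists2 nu, enorm nu = 1 & flat nu eta (B c.1 c.2).
pose P k := if unpickle k is Some c then
  (if `[< good c >] then B c.1 c.2 else set0) else set0.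
exists P; split.
- move=> k; rewrite /P; case: unpickle => [c|]; last exact: compact0.
  by case: ifP => _; [exact: cB|exact: compact0].
- move=> k; rewrite /P; case: unpickle => [c|]; last by exists nu0.
  by case: asboolP => [//|_]; exists nu0.
move=> p Kp; have [r r0 [nu nu1 fr]] := c1_graph_locally_flat CS (KS p Kp) eta0.
have r20 : 0 < r / 2 by rewrite divr_gt0.
have [j _ jP] := near_infty_natSinv_lt (PosNum r20).
have {}jP : j.+1%:R^-1 < r / 2 := jP j (leqnn j).
have j0 : 0 < (j.+1%:R^-1 : R) by rewrite invr_gt0.
have [q qP] := dense_rat_rV p j0.
exists (pickle (q, j)) => //; rewrite /P pickleK.
have gd : good (q, j).
  exists nu => // x y [Kx hx] [Ky hy]; apply: fr; split; [exact: KS| |exact: KS|].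
    rewrite /eball/= (le_lt_trans (ler_enorm_dist (map_mx ratr q) _ _))// (enormC _ p).
    by move: hx qP jP; rewrite /=; move: (_^-1) => e; lra.
  rewrite /eball/= (le_lt_trans (ler_enorm_dist (map_mx ratr q) _ _))// (enormC _ p).
  by move: hy qP jP; rewrite /=; move: (_^-1) => e; lra.
by rewrite (asboolT gd); split => //=; exact: ltW.
Qed.

End c1_graph_flat.

Section crack_decomposition.
Context {R : realType} {m : nat}.
Local Notation H := (@hausdorff_measure R m.+2 m.+1).
Implicit Types A P F : set 'rV[R]_m.+2.
Local Open Scope ereal_scope.

Lemma bounded_sub_eball n (P : set 'rV[R]_n) : bounded_set P -> exists2 r : R, (0 < r)%R & P `<=` eball 0%R r.
Proof.
move=> [M [Mr hM]].
exists (n%:R * (`|M| + 1) + 1)%R; first by rewrite ltr_wpDl// mulr_ge0// addr_ge0.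
move=> x Px; rewrite /eball/= subr0; apply: (@le_lt_trans _ _ (n%:R * `|x|)%R); first exact: enorm_le_normr.
rewrite (@le_lt_trans _ _ (n%:R * (`|M| + 1))%R)// ?ltrDl// ler_wpM2l//.
by apply: hM => //; rewrite (le_lt_trans (ler_norm _))// ltrDl.
Qed.

Lemma tube_sub_eball n (P : set 'rV[R]_n) xi r : P `<=` eball 0%R r ->
  tube P xi `<=` eball 0%R (r + enorm xi)%R.
Proof.
move=> Pr x [s /andP[s0 s1] /Pr]; rewrite /eball/= !subr0 => h.
have -> : (x = (x + s *: xi) - s *: xi)%R by rewrite addrK.
apply: (le_lt_trans (ler_enormB _ _)); rewrite enormZ ger0_norm//.
by rewrite ltr_leD// ler_piMl// enorm_ge0.
Qed.

(** For xi = nu the lower bound of [lebesgue_tube_flat] applies, and the tube is bounded, hence of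
    finite volume. *)
Lemma flat_hausdorff_lty (kappa : R) P nu : (0 < kappa < 1)%R -> compact P ->
  enorm nu = 1%R -> flat nu (kappa ^+ 2 / 2) P -> H P < +oo.
Proof.
move=> k01 cP nu1 fP; have /andP[k0 k1] := k01.
have nn : edot nu nu = 1%R by rewrite -sqr_enorm nu1 expr1n.
have nu0 : nu != 0%R by rewrite -enorm_eq0 nu1 oner_eq0.
have [|lo _] := andP (lebesgue_tube_flat cP nu1 k01 fP nu0 _).
  by rewrite nu1 nn normr1 mulr1 ltW.
have [r r0 Pr] := bounded_sub_eball (compact_bounded cP).
have tub : lebesgue_rV R m.+2 (tube P nu) < +oo.
  apply: le_lt_trans (lebesgue_rV_eball_lty 0%R (r + enorm nu)%R).
  apply: le_measure; rewrite ?inE; [exact: measurable_tube|exact: measurable_eball|exact: tube_sub_eball].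
have c0 : (0 < `|edot nu nu| * (1 - kappa) ^+ m.+1)%R.
  by rewrite nn normr1 mul1r exprn_gt0// subr_gt0.
have := hausdorff_measure_ge0 m.+1 P; case: (H P) lo => [h _ _|lo _|//]; first by rewrite ltry.
move: lo; by rewrite gt0_muley ?lte_fin// leye_eq => /eqP tt; rewrite tt in tub.
Qed.

Lemma rectifiable_flat_cover A (eta : R) : rectifiable A -> (0 < eta)%R ->
  exists P : (set 'rV[R]_m.+2)^nat, [/\ forall k, compact (P k),
    forall k, exists2 nu, enorm nu = 1%R & flat nu eta (P k) &
    H (A `\` \bigcup_k P k) = 0].
Proof.
move=> [K KP HK] eta0.
have ex i : exists Q : (set 'rV[R]_m.+2)^nat, [/\ forall k, compact (Q k),
    forall k, exists2 nu, enorm nu = 1%R & flat nu eta (Q k) & K i `<=` \bigcup_k Q k].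
  have [cK [S CS KS]] := KP i.
  exact: compact_c1_graph_cover cK CS KS eta0.
have [Q QP] := choice ex.
exists (fun k => if unpickle k is Some c then Q c.1 c.2 else set0); split.
- move=> k; case: unpickle => [[i j]|]; last exact: compact0.
  by have [h _ _] := QP i; exact: h.
- move=> k; case: unpickle => [[i j]|]; last by exists (e0 m.+1); [exact: enorm_e0|].
  by have [_ h _] := QP i; exact: h.
apply/eqP; rewrite eq_le hausdorff_measure_ge0 andbT -HK.
apply: subset_hausdorff_measure => x [Ax nx]; split => // -[i _ Ki]; apply: nx.
have [_ _ h] := QP i; have [j _ Qj] := h x Ki.
by exists (pickle (i, j)) => //; rewrite pickleK.
Qed.

(* One recursion: step j, encoding a pair (k, i), takes from P k what is left of A up to measure
   1 / (i + 1). *)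
Lemma flat_decomposition A (kappa : R) : H.-caratheodory A -> rectifiable A ->
  (0 < kappa < 1)%R ->
  exists F : (set 'rV[R]_m.+2)^nat, [/\ forall k, compact (F k),
    forall k, exists2 nu, enorm nu = 1%R & flat nu (kappa ^+ 2 / 2) (F k),
    forall k, F k `<=` A, trivIset setT F & H (A `\` \bigcup_k F k) = 0].
Proof.
move=> cA rA k01; have /andP[k0 k1] := k01.
have eta0 : (0 < kappa ^+ 2 / 2)%R by rewrite divr_gt0// exprn_gt0.
have [P [cP fP HP]] := rectifiable_flat_cover rA eta0.
have HPfin k : H (P k) < +oo by have [nu nu1 fl] := fP k; exact: flat_hausdorff_lty k01 (cP k) nu1 fl.
pose idx (j : nat) : nat * nat := odflt (0, 0)%N (unpickle j).
(* A choice function must be total, so compactness of the part removed so far is a premise here; it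
   is established along the recursion afterwards. *)
have ex (jU : nat * set 'rV[R]_m.+2) : exists F : set 'rV[R]_m.+2, compact jU.2 ->
    [/\ compact F, F `<=` (A `\` jU.2) `&` P (idx jU.1).1 &
      H (((A `\` jU.2) `&` P (idx jU.1).1) `\` F) <= ((idx jU.1).2.+1%:R^-1 : R)%:E].
  have [cU|nc] := pselect (compact jU.2); last by exists set0 => /nc.
  have cAU : H.-caratheodory (A `\` jU.2).
    rewrite setDE; apply: (@caratheodory_measurable_setI _ _ (hausdorff_outer (ltn0Sn m))) => //.
    apply: hausdorff_borel_caratheodory => //.
    by apply: measurableC; exact: (compact_measurable_rV cU).
  have [|F hF] := hausdorff_compact_inner (ltn0Sn m) cAU (cP (idx jU.1).1) (HPfin (idx jU.1).1) (e := (idx jU.1).2.+1%:R^-1).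
    by rewrite invr_gt0.
  by exists F.
have [sel selP] := choice ex.
pose U := fix U (j : nat) : set 'rV[R]_m.+2 := if j is i.+1 then U i `|` sel (i, U i) else set0.
have cU j : compact (U j).
  elim: j => [|j IH]/=; first exact: compact0.
  apply: compactU => //.
  by have [] := selP (j, U j) IH.
pose F j := sel (j, U j).
have FP j := selP (j, U j) (cU j).
have FU i j : (i < j)%N -> F i `<=` U j.
  elim: j => // j IH; rewrite ltnS leq_eqVlt => /orP[/eqP -> x Fx|/IH h x Fx]; [by right|left; exact: h].
have UF j : U j `<=` \bigcup_k F k.
  elim: j => //= j IH x [/IH//|Fx]; by exists j.
exists F; split.
- by move=> j; have [] := FP j.
- move=> j; have [_ h _] := FP j; have [nu nu1 fl] := fP (idx j).1.
  by exists nu => // p q /h[_ Pp] /h[_ Pq]; exact: fl.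
- by move=> j x; have [_ h _] := FP j => /h[[]].
- apply/trivIsetP => i j _ _; wlog ij : i j / (i < j)%N.
    move=> W ne; have := ne; rewrite neq_ltn => /orP[h|h]; first exact: W.
    by rewrite setIC; apply: W => //; rewrite eq_sym.
  move=> _; apply/seteqP; split => x // -[Fi Fj].
  by have [_ h _] := FP j; have [[_ nU] _] := h x Fj; apply: nU; exact: FU ij x Fi.
apply/eqP; rewrite eq_le hausdorff_measure_ge0 andbT.
pose D k := (A `&` P k) `\` \bigcup_j F j.
have HD k : H (D k) = 0.
  apply/eqP; rewrite eq_le hausdorff_measure_ge0 andbT.
  apply/lee_addgt0Pr => e e1; rewrite add0e.
  have [i _ hi] := near_infty_natSinv_lt (PosNum e1).
  have {}hi : (i.+1%:R^-1 < e)%R := hi i (leqnn i).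
  pose j := pickle (k, i); have [_ _] := FP j.
  rewrite /idx /j pickleK/= => h; apply: (le_trans _ (le_trans h _)).
    apply: subset_hausdorff_measure => x [[Ax Px] nF]; split; last by move=> Fx; apply: nF; exists j.
    by split => //; split => // /UF.
  by rewrite lee_fin ltW.
apply: (@le_trans _ _ (H ((A `\` \bigcup_k P k) `|` \bigcup_k D k))).
  apply: subset_hausdorff_measure => x [Ax nF]; have [[k _ Pk]|nP] := pselect ((\bigcup_k P k) x); last by left.
  by right; exists k.
apply: (le_trans (hausdorff_measureU_le _ _ _)) => //; rewrite HP add0e.
by rewrite (le_trans (hausdorff_measure_sigma_subadditive m.+1 D))// eseries0.
Qed.

Lemma hausdorff_decomposition A (F : (set 'rV[R]_m.+2)^nat) :
  (forall k, compact (F k)) -> (forall k, F k `<=` A) -> trivIset setT F ->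
  H (A `\` \bigcup_k F k) = 0 -> H A = \sum_(k <oo) H (F k).
Proof.
move=> cF FA tF HN.
have e : \sum_(k <oo) H (F k) = H (\bigcup_k F k).
  rewrite -[X in H X]setIT hausdorff_on_sigma_additive//.
    by apply: eq_eseriesr => k _; rewrite setIT.
  by move=> k; apply: hausdorff_borel_caratheodory => //; exact: compact_measurable_rV.
rewrite e; apply/eqP; rewrite eq_le; apply/andP; split; last first.
  by apply: subset_hausdorff_measure => x [k _ /FA].
apply: (@le_trans _ _ (H ((A `\` \bigcup_k F k) `|` \bigcup_k F k))).
  apply: subset_hausdorff_measure => x Ax.
  by have [|] := pselect ((\bigcup_k F k) x); [right|left].
by apply: (le_trans (hausdorff_measureU_le _ _ _)) => //; rewrite HN add0e.
Qed.

End crack_decomposition.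

(** * Radial integrals *)

Section integral_lemmas.
Context d (T : measurableType d) {R : realType}.
Local Open Scope ereal_scope.

(* The library integral of a nonnegative function, measurable or not, is a supremum over the simple
   functions below it. *)
Lemma le_integral_nonneg (mu : {measure set T -> \bar R}) (D : set T) (f g : T -> \bar R) :
  (forall x, D x -> 0 <= f x) -> (forall x, D x -> f x <= g x) ->
  \int[mu]_(x in D) f x <= \int[mu]_(x in D) g x.
Proof.
move=> f0 fg.
rewrite (ge0_integralE _ f0) ge0_integralE; last by move=> x Dx; exact: le_trans (f0 x Dx) (fg x Dx).
apply: ereal_sup_le => _ [h hf <-]; exists h => // x.
apply: (le_trans (hf x)); rewrite !patchE; case: ifPn => // /set_mem Dx.
exact: fg.
Qed.

(** [f x] is the length of the set of s >= 0 with s < f x; Tonelli exchanges s and x. *)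
Lemma layer_cake (mu : {sigma_finite_measure set T -> \bar R}) (w f : T -> R) :
  measurable_fun setT w -> measurable_fun setT f ->
  (forall x, 0 <= w x)%R -> (forall x, 0 <= f x)%R ->
  \int[mu]_x (w x * f x)%:E =
  \int[lebesgue_measure]_(s in `[0%R, +oo[) \int[mu]_x (w x * \1_[set y | s < f y]%R x)%:E.
Proof.
move=> mw mf w0 f0.
pose A : set (T * R) := [set p | (0 <= p.2)%R && (p.2 < f p.1)%R].
have mA : measurable A.
  have : measurable_fun [set: T * R] (fun p : T * R => (0 <= p.2)%R && (p.2 < f p.1)%R).
    apply: measurable_and.
      by apply: measurable_fun_ler => //; exact: measurable_snd.
    apply: measurable_fun_ltr; first exact: measurable_snd.
    exact: (measurableT_comp mf measurable_fst).
  by move=> /(_ measurableT [set true]); rewrite setTI; apply.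
pose F (p : T * R) := (w p.1 * \1_A p)%:E.
have mF : measurable_fun setT F.
  apply/measurable_EFinP/measurable_funM; first exact: (measurableT_comp mw measurable_fst).
  exact: measurable_indic.
have F0 p : 0 <= F p by rewrite lee_fin mulr_ge0.
transitivity (\int[mu]_x \int[lebesgue_measure]_s F (x, s)).
  apply: eq_integral => x _.
  transitivity (\int[lebesgue_measure]_s ((w x)%:E * (\1_`[0%R, f x[ s)%:E)).
    rewrite ge0_integralZl//.
    - rewrite integral_indic// setIT.
      transitivity ((w x)%:E * lebesgue_measure `[0%R, f x[%classic); last by [].
      rewrite lebesgue_measure_itv/= lte_fin.
      case: ltP => [_|h]; first by rewrite sube0.
      have -> : f x = 0%R by apply/eqP; rewrite eq_le h f0.
      by rewrite mulr0 mule0.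
    - by apply/measurable_EFinP; exact: measurable_indic.
    - by rewrite lee_fin.
  apply: eq_integral => s _; rewrite /F -EFinM !indicE; congr (_ * (nat_of_bool _)%:R)%:E.
transitivity (\int[lebesgue_measure]_s \int[mu]_x F (x, s)).
  exact: (fubini_tonelli (m1 := mu) (m2 := lebesgue_measure)).
rewrite [RHS]integral_mkcond/=; apply: eq_integral => s _.
rewrite patchE; case: ifPn => [/set_mem|/negP h].
  rewrite /= in_itv/= andbT => s0; apply: eq_integral => x _; rewrite /F !indicE; congr (_ * (nat_of_bool _)%:R)%:E.
  by apply/idP/idP => /set_mem h; apply/mem_set;
    move: h; rewrite /A/= s0.
rewrite integral0_eq// => x _; rewrite /F indicE memNset ?mulr0// => -[/andP[h' _]].
by apply: h; apply/mem_set; rewrite /= in_itv/= andbT.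
Qed.

End integral_lemmas.

Lemma ge0_integral_product_map d1 d2 d (T1 : measurableType d1) (T2 : measurableType d2)
    (T : measurableType d) (R : realType) (m1 : {sigma_finite_measure set T1 -> \bar R})
    (m2 : {sigma_finite_measure set T2 -> \bar R}) (mu : {measure set T -> \bar R})
    (phi : T1 * T2 -> T) (f : T -> \bar R) : measurable_fun setT phi ->
  (forall A, measurable A -> mu A = (m1 \x m2)%E (phi @^-1` A)) ->
  measurable_fun setT f -> (forall x, 0 <= f x)%E ->
  (\int[mu]_x f x = \int[m2]_y \int[m1]_x f (phi (x, y)))%E.
Proof.
move=> mphi muE mf f0.
transitivity (\int[pushforward (m1 \x m2)%E phi]_x f x)%E.
  by apply: eq_measure_integral => A mA _; exact: muE.
rewrite (ge0_integral_pushforward mphi (m1 \x m2)%E measurableT mf)// preimage_setT fubini_tonelli2//.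
  exact: measurableT_comp mf mphi.
by move=> x; exact: f0.
Qed.

Section radial.
Context {R : realType}.
Local Open Scope ereal_scope.

Lemma ge0_integral_rVS n (f : 'rV[R]_n.+1 -> \bar R) : measurable_fun setT f ->
  (forall x, 0 <= f x) ->
  \int[lebesgue_rV R n.+1]_x f x =
  \int[lebesgue_rV R n]_z \int[lebesgue_measure]_t f (rV_cons (t, z)).
Proof.
move=> mf f0.
exact: (ge0_integral_product_map (m1 := lebesgue_measure) (@measurable_rV_cons R n)).
Qed.

Lemma integral_monomial (a b c : R) k : (a <= b)%R ->
  \int[lebesgue_measure]_(x in `]a, b[) (c * x ^+ k)%:E =
  (c * (b ^+ k.+1 - a ^+ k.+1) / k.+1%:R)%:E.
Proof.
rewrite le_eqVlt => /predU1P[->|ab].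
  by rewrite set_itvoo0 integral_set0 subrr mulr0 mul0r.
have cm : continuous (fun x : R => c * x ^+ k)%R.
  by move=> x; apply: cvgM; [exact: cvg_cst|exact: exprn_continuous].
have mm : measurable_fun setT (fun x : R => c * x ^+ k)%R by exact: continuous_measurable_fun.
rewrite integral_itv_bndo_bndc; last first.
  exact/measurable_EFinP/measurable_funTS.
rewrite integral_itv_obnd_cbnd; last first.
  exact/measurable_EFinP/measurable_funTS.
pose F : R -> R := ((c / k.+1%:R) \*: (@id R ^+ k.+1))%R.
have FE (x : R) : F x = (c / k.+1%:R * x ^+ k.+1)%R by rewrite /F/= exprfctE.
have dF (x : R) : is_derive x (1%R : R) F (c * x ^+ k)%R.
  apply: is_derive_eq; rewrite /GRing.scale/= mulr1.
  by field; rewrite addrC natr1 pnatr_eq0.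
have cF (x : R) : {for x, continuous F}.
  exact/differentiable_continuous/derivable1_diffP/ex_derive.
rewrite (@continuous_FTC2 _ _ F)//.
- by rewrite -EFinB !FE; congr EFin; field; rewrite addrC natr1 pnatr_eq0.
- exact: continuous_subspaceT.
- split; first by move=> x _; exact: ex_derive.
    exact/cvg_at_right_filter/cF.
  exact/cvg_at_left_filter/cF.
- by move=> x _; rewrite derive1E; exact: derive_val.
Qed.

(* T is an interval with endpoints 0 and r, up to its restriction to [0, +oo[. *)
Lemma down_closed_squeeze (T : set R) : (forall p q : R, (0 <= p <= q)%R -> T q -> T p) ->
  (forall q : R, (0 <= q)%R -> T q -> (q < 1)%R) ->
  exists2 r : R, (0 <= r)%R & forall (a : set R -> \bar R) (g : R -> R),
    (forall A B : set R, (forall q : R, (0 <= q)%R -> A q -> B q) -> a A <= a B) ->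
    (forall A, 0 <= a A) -> continuous g -> g 0%R = 0%R ->
    (forall s : R, (0 < s)%R -> a [set q | (q < s)%R] = (g s)%:E) -> a T = (g r)%:E.
Proof.
move=> dT T1; pose S := [set q : R | q = 0%R \/ (0 <= q)%R /\ T q].
have S0 : S 0%R by left.
have hS : has_sup S.
  split; first by exists 0%R.
  by exists 1%R => q [->//|[q0 /(T1 _ q0)/ltW]].
have r0 : (0 <= sup S)%R by exact: sup_upper_bound.
exists (sup S) => // a g amono a0 cg g0 ag.
have up (s : R) : (sup S < s)%R -> a T <= (g s)%:E.
  move=> rs; rewrite -ag; last exact: le_lt_trans rs.
  apply: amono => q q0 Tq /=; apply: le_lt_trans rs.
  by apply: sup_upper_bound => //; right.
have dn (s : R) : (0 < s)%R -> (s < sup S)%R -> (g s)%:E <= a T.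
  move=> s0 sr; rewrite -ag//; apply: amono => q q0 /= qs.
  have [t [t00|[t0 Tt]] st] := sup_gt hS.1 sr.
    by move: st; rewrite t00 ltNge ltW.
  by apply: (dT q t) => //; rewrite q0/= (le_trans (ltW qs))// ltW.
have fin : a T \is a fin_num.
  by rewrite ge0_fin_numE// (le_lt_trans (up (sup S + 1)%R _)) ?ltry// ltrDl.
have near_r (P : set R) : nbhs (sup S) P -> exists2 e : R, (0 < e)%R & forall s, (`|sup S - s| < e)%R -> P s.
  by move=> /nbhs_ballP[e e0 h]; exists e => // s hs; apply: h.
rewrite -(fineK fin); congr EFin; apply/eqP; rewrite eq_le; apply/andP; split; rewrite leNgt; apply/negP => h.
  have /near_r[e e0 he] : \forall x \near sup S, (g x < fine (a T))%R by apply: (cvgr_lt _ (cg (sup S))).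
  have e20 : (0 < e / 2)%R by rewrite divr_gt0.
  have := he (sup S + e / 2)%R; rewrite opprD addNKr normrN gtr0_norm// => /(_ _)/wrap[].
    by rewrite ltr_pdivrMr// ltr_pMr// ltr1n.
  rewrite ltNge -lee_fin fineK// up//.
  by rewrite ltrDl.
have [r00|rpos] := leP (sup S) 0%R.
  have rE : sup S = 0%R by apply/eqP; rewrite eq_le r00 r0.
  by move: h; rewrite rE g0 ltNge fine_ge0.
have /near_r[e e0 he] : \forall x \near sup S, (fine (a T) < g x)%R by apply: (cvgr_gt _ (cg (sup S))).
pose t := (Num.min (e / 2) (sup S / 2))%R.
have t0 : (0 < t)%R by rewrite lt_min !divr_gt0.
have te : (t < e)%R by rewrite gt_min ltr_pdivrMr// ltr_pMr// ltr1n.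
have tr : (t < sup S)%R by rewrite gt_min [X in _ || X]ltr_pdivrMr// ltr_pMr// ltr1n orbT.
have := he (sup S - t)%R; rewrite opprB addrCA subrr addr0 gtr0_norm// => /(_ te).
rewrite ltNge -lee_fin fineK// dn ?subr_gt0//.
by rewrite ltrBlDr ltrDl.
Qed.

End radial.

Section radial_integral.
Context {R : realType}.
Local Open Scope ereal_scope.

Lemma integral_abs_slice (c : R) :
  \int[lebesgue_measure]_t (`|t| * \1_[set t : R | (t ^+ 2 < c)%R] t)%:E = (Num.max c 0)%:E.
Proof.
have [c0|c0] := leP c 0%R.
  apply: integral0_eq => t _; rewrite indicE memNset ?mulr0//=.
  by apply/negP; rewrite -leNgt (le_trans c0)// sqr_ge0.
pose r := Num.sqrt c; have r0 : (0 < r)%R by rewrite sqrtr_gt0.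
have tr (t : R) : (t ^+ 2 < c)%R = (`|t| < r)%R.
  by rewrite -sqrtr_sqr ltr_sqrt.
pose f1 : R -> \bar R := (fun t : R => (-1 * t ^+ 1)%:E) \_ `](- r)%R, 0%R[.
pose f2 : R -> \bar R := (fun t : R => (1 * t ^+ 1)%:E) \_ `]0%R, r[.
have f10 t : 0 <= f1 t.
  rewrite /f1 patchE; case: ifPn => // /set_mem; rewrite /= in_itv/= lee_fin => /andP[_ t0].
  by rewrite mulN1r oppr_ge0 ltW.
have f20 t : 0 <= f2 t.
  rewrite /f2 patchE; case: ifPn => // /set_mem; rewrite /= in_itv/= lee_fin mul1r => /andP[t0 _].
  exact: ltW.
have mM (b : R) : measurable_fun setT (fun t : R => (b * t ^+ 1)%:E).
  by apply/measurable_EFinP; apply: measurable_funM => //; exact: measurable_id.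
have mf1 : measurable_fun setT f1.
  by apply/(measurable_restrictT _ _).1; [exact: measurable_itv|exact: measurable_funTS].
have mf2 : measurable_fun setT f2.
  by apply/(measurable_restrictT _ _).1; [exact: measurable_itv|exact: measurable_funTS].
transitivity (\int[lebesgue_measure]_t (f1 t + f2 t)).
  apply: eq_integral => t _; rewrite /f1 /f2 !patchE !mem_setE !in_itv/= indicE.
  have -> : (t \in [set t : R | (t ^+ 2 < c)%R]) = (`|t| < r)%R.
    by apply/idP/idP => [/set_mem/=|h]; rewrite ?tr//; apply/mem_set; rewrite /= tr.
  rewrite mulN1r mul1r ltr_norml; have [t0|t0|->] := ltgtP t 0%R.
  - rewrite andbT andFb adde0 (lt_trans t0 r0) andbT.
    by case: ifPn => _; rewrite ?mulr1 ?mulr0// ltr0_norm.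
  - rewrite andbF andTb add0e (@lt_trans _ _ 0%R (- r)%R t) ?oppr_lt0//=.
    by case: ifPn => _; rewrite ?mulr1 ?mulr0// gtr0_norm.
  - by rewrite andbF andFb adde0 normr0 mul0r.
rewrite ge0_integralD// -!integral_mkcond !integral_monomial ?oppr_le0 ?ltW//.
rewrite -EFinD; congr EFin; rewrite !expr0n/= sqrrN /r sqr_sqrtr ?ltW//.
by rewrite sub0r subr0 mulN1r opprK mul1r -splitr.
Qed.

Lemma integral_shell (b r : R) : (0 <= b)%R -> (0 <= r)%R ->
  \int[lebesgue_measure]_s (2 * `|s| * \1_[set s : R | (b < s < r)%R] s)%:E =
  (Num.max (r ^+ 2 - b ^+ 2) 0)%:E.
Proof.
move=> b0 r0; have [br|rb] := leP b r; last first.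
  rewrite max_r; last by rewrite subr_le0 ler_pXn2r ?nnegrE// ltW.
  apply: integral0_eq => s _; rewrite indicE memNset ?mulr0//= => /andP[h1 h2].
  by have := lt_trans h1 h2; rewrite ltNge (ltW rb).
rewrite max_l; last by rewrite subr_ge0 ler_pXn2r ?nnegrE.
transitivity (\int[lebesgue_measure]_(s in `]b, r[) (2 * s ^+ 1)%:E).
  rewrite [RHS]integral_mkcond; apply: eq_integral => s _; rewrite patchE mem_setE in_itv/= indicE.
  have -> : (s \in [set s : R | (b < s < r)%R]) = (b < s < r)%R.
    by apply/idP/idP => [/set_mem//|h]; apply/mem_set.
  case: ifPn => [/andP[h _]|_]; last by rewrite mulr0.
  by rewrite mulr1 ger0_norm// ltW// (le_lt_trans b0).
by rewrite integral_monomial//; congr EFin; field.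
Qed.

(* The integral of `|t| over { t | t ^ 2 < r ^ 2 - |z| ^ 2 } equals that of 2 s over
   { s | |z| < s < r }; Tonelli then integrates over z first. *)
Lemma integral_abs_ball n (r : R) : (0 < r)%R ->
  \int[lebesgue_rV R n.+1]_x (`|x 0%R ord0| * \1_(eball (0%R : 'rV[R]_n.+1) r) x)%:E =
  (2 * ball_volume R n * r ^+ n.+2 / n.+2%:R)%:E.
Proof.
move=> r0; have r0' := ltW r0.
rewrite ge0_integral_rVS; last 2 first.
- apply/measurable_EFinP/measurable_funM.
    exact: measurableT_comp (measurable_coord _).
  by apply: measurable_indic; exact: measurable_eball.
- by move=> x; rewrite lee_fin mulr_ge0.
transitivity (\int[lebesgue_rV R n]_z (Num.max (r ^+ 2 - enorm z ^+ 2) 0)%:E).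
  apply: eq_integral => z _; rewrite -integral_abs_slice; apply: eq_integral => t _.
  rewrite rV_cons0/= !indicE; congr (_ * (nat_of_bool _)%:R)%:E.
  have e : (enorm (rV_cons (t, z)) ^+ 2)%R = (t ^+ 2 + enorm z ^+ 2)%R.
    by rewrite !sqr_enorm edot_rV_uncons rV_consK rV_cons0 expr2.
  have h : (enorm (rV_cons (t, z)) < r)%R = (t ^+ 2 < r ^+ 2 - enorm z ^+ 2)%R.
    by rewrite ltrBrDr -e ltr_pXn2r ?nnegrE ?enorm_ge0.
  by apply/idP/idP => /set_mem/= H; apply/mem_set; move: H; rewrite /eball/= subr0 h.
pose A : set ('rV[R]_n * R) := [set p | (enorm p.1 < p.2)%R && (p.2 < r)%R].
have mA : measurable A.
  have : measurable_fun setT (fun p : 'rV[R]_n * R => (enorm p.1 < p.2)%R && (p.2 < r)%R).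
    apply: measurable_and; apply: measurable_fun_ltr => //.
    exact: (measurableT_comp measurable_enorm measurable_fst).
  by move=> /(_ measurableT [set true]); rewrite setTI; apply.
pose F (p : 'rV[R]_n * R) : \bar R := (2 * `|p.2| * \1_A p)%:E.
have mF : measurable_fun setT F.
  apply/measurable_EFinP/measurable_funM; last exact: measurable_indic.
  apply: measurable_funM => //; apply: measurableT_comp => //; exact: measurable_snd.
have F0 p : 0 <= F p by rewrite lee_fin !mulr_ge0.
transitivity (\int[lebesgue_rV R n]_z \int[lebesgue_measure]_s F (z, s)).
  apply: eq_integral => z _; apply: etrans (esym (integral_shell (enorm_ge0 z) r0')) _.
  apply: eq_integral => s _; by rewrite /F/= !indicE; congr (_ * (nat_of_bool _)%:R)%:E.
transitivity (\int[lebesgue_measure]_s \int[lebesgue_rV R n]_z F (z, s)).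
  exact: (fubini_tonelli (m1 := lebesgue_rV R n) (m2 := lebesgue_measure)).
transitivity (\int[lebesgue_measure]_(s in `]0%R, r[) (2 * ball_volume R n * s ^+ n.+1)%:E); last first.
  by rewrite integral_monomial// expr0n/= subr0.
rewrite [RHS]integral_mkcond; apply: eq_integral => s _; rewrite patchE mem_setE in_itv/=.
case: ifPn => [/andP[s0 sr]|h].
  transitivity (\int[lebesgue_rV R n]_z ((2 * s)%:E * (\1_(eball (0%R : 'rV[R]_n) s) z)%:E)).
    apply: eq_integral => z _; rewrite /F/= -EFinM !indicE gtr0_norm//; congr (_ * (nat_of_bool _)%:R)%:E.
    by apply/idP/idP => /set_mem H; apply/mem_set; move: H; rewrite /A /eball/= subr0 sr andbT.
  rewrite ge0_integralZl//; last 2 first.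
  - by apply/measurable_EFinP; apply: measurable_indic; exact: measurable_eball.
  - by rewrite lee_fin mulr_ge0// ltW.
  rewrite integral_indic//; last exact: measurable_eball.
  transitivity ((2 * s)%:E * (s ^+ n * ball_volume R n)%:E).
    by congr (_ * _); rewrite setIT; exact: lebesgue_rV_eball.
  rewrite -EFinM; congr EFin; rewrite exprS; ring.
apply: integral0_eq => z _; rewrite /F/= indicE memNset ?mulr0// => /andP[/= h1 h2].
by move: h; rewrite h2 andbT (le_lt_trans (enorm_ge0 z) h1).
Qed.

(* By the layer cake formula it is enough to treat the indicator of an interval [0, r]. *)
Lemma integral_radial_abs n (J : R -> R) : nonincreasing_fun J -> (forall q, 0 <= J q)%R ->
  (forall q, 1 <= q -> J q = 0)%R ->
  \int[lebesgue_rV R n.+1]_x (`|x 0%R ord0| * J (enorm x))%:E =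
  \int[lebesgue_measure]_q (2 * ball_volume R n * (Num.max q 0) ^+ n.+1 * J q)%:E.
Proof.
move=> ndJ J0 J1; have mJ : measurable_fun setT J by exact: nonincreasing_measurable.
have w0 (q : R) : (0 <= 2 * ball_volume R n * (Num.max q 0) ^+ n.+1)%R.
  by rewrite mulr_ge0 ?exprn_ge0 ?le_max ?lexx ?orbT// mulr_ge0// ltW// ball_volume_gt0.
have mw : measurable_fun setT (fun q : R => 2 * ball_volume R n * (Num.max q 0) ^+ n.+1)%R.
  apply: measurable_funM => //; apply: measurable_funX; apply: measurable_maxr => //; exact: measurable_id.
rewrite (layer_cake (lebesgue_rV R n.+1))//; last 2 first.
- by apply: measurableT_comp => //; exact: measurable_coord.
- exact: measurableT_comp mJ measurable_enorm.
transitivity (\int[lebesgue_measure]_(s in `[0%R, +oo[) \int[lebesgue_measure]_q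
   (2 * ball_volume R n * (Num.max q 0) ^+ n.+1 * \1_[set y | s < J y]%R q)%:E); last first.
  by apply/esym; exact: (layer_cake lebesgue_measure).
apply: eq_integral => s; rewrite inE/= in_itv/= andbT => s0.
pose T := [set q : R | (s < J q)%R].
have [] := @down_closed_squeeze R T.
- by move=> p q /andP[_ pq]; rewrite /T/= => /lt_le_trans; apply; exact: ndJ.
- move=> q _; rewrite /T/= => h; rewrite ltNge; apply/negP => q1; move: h.
  by rewrite (J1 q q1) ltNge s0.
(* [g t] is the common value of both sides on the indicator of an interval with endpoints 0 and t:
   on the left by [integral_abs_ball], on the right as the integral of a power. *)
move=> r r0 hr; pose g (t : R) := (2 * ball_volume R n * t ^+ n.+2 / n.+2%:R)%R.
have cg : continuous g.
  by move=> t; apply: cvgM; [apply: cvgM; [exact: cvg_cst|exact: exprn_continuous]|exact: cvg_cst].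
have g0 : g 0%R = 0%R by rewrite /g expr0n/= mulr0 mul0r.
have h1 := hr (fun A => \int[lebesgue_rV R n.+1]_x (`|x 0%R ord0| * \1_A (enorm x))%:E) g _ _ cg g0 _.
have h2 := hr (fun A => \int[lebesgue_measure]_q (2 * ball_volume R n * (Num.max q 0) ^+ n.+1 * \1_A q)%:E) g _ _ cg g0 _.
transitivity (g r)%:E; [|apply/esym].
  apply: etrans (h1 _ _ _).
  - by apply: eq_integral => x _; rewrite !indicE; congr (_ * (nat_of_bool _)%:R)%:E;
      apply/idP/idP => /set_mem H; apply/mem_set.
  - move=> A B AB; apply: le_integral_nonneg => x _; first by rewrite lee_fin mulr_ge0.
    rewrite lee_fin ler_wpM2l// !indicE; case: (boolP (_ \in A)) => [/set_mem h|]; last by rewrite ler_nat.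
    by rewrite mem_set//; apply: AB h; exact: enorm_ge0.
  - by move=> A; apply: integral_ge0 => x _; rewrite lee_fin mulr_ge0.
  - move=> t t0; rewrite /g -integral_abs_ball//; apply: eq_integral => x _.
    rewrite !indicE; congr (_ * (nat_of_bool _)%:R)%:E.
    by apply/idP/idP => /set_mem H; apply/mem_set; move: H; rewrite /eball/= subr0.
apply: h2.
- move=> A B AB; apply: le_integral_nonneg => q _; first by rewrite lee_fin mulr_ge0.
  have [q0|q0] := leP 0%R q; last by rewrite expr0n/= !mulr0 !mul0r.
  rewrite lee_fin ler_wpM2l//.
    by rewrite mulr_ge0 ?exprn_ge0// mulr_ge0// ltW// ball_volume_gt0.
  rewrite !indicE; case: (boolP (_ \in A)) => [/set_mem h|]; last by rewrite ler_nat.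
  by rewrite mem_set//; apply: AB h.
- by move=> A; apply: integral_ge0 => q _; rewrite lee_fin mulr_ge0.
move=> t t0; transitivity (\int[lebesgue_measure]_(q in `]0%R, t[) (2 * ball_volume R n * q ^+ n.+1)%:E).
  rewrite [RHS]integral_mkcond; apply: eq_integral => q _; rewrite patchE mem_setE in_itv/= indicE.
  have -> : (q \in [set q : R | (q < t)%R]) = (q < t)%R.
    by apply/idP/idP => [/set_mem//|h]; apply/mem_set.
  have [q0|q0] := ltP 0%R q; last by rewrite expr0n/= mulr0 mul0r.
  by rewrite andTb; case: ifPn => _; rewrite ?mulr1 ?mulr0.
by rewrite integral_monomial ?ltW// expr0n/= subr0.
Qed.

End radial_integral.

Section rotation_invariance.
Context {R : realType}.
Local Open Scope ereal_scope.

Lemma ge0_integral_rV_scale n (s : R) (f : 'rV[R]_n -> \bar R) : (0 < s)%R ->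
  measurable_fun setT f -> (forall x, 0 <= f x) ->
  \int[lebesgue_rV R n]_x f x = (s ^+ n)%:E * \int[lebesgue_rV R n]_x f (s *: x)%R.
Proof.
move=> s0 mf f0.
have mZ : measurable_fun setT (fun x : 'rV[R]_n => s *: x)%R by apply: measurable_funZ_rV.
have sn : (0 < s ^+ n)%R by rewrite exprn_gt0.
have sn' : (0 <= (s ^+ n)^-1)%R by rewrite invr_ge0 ltW.
pose k : {nonneg R} := NngNum sn'.
have -> : \int[lebesgue_rV R n]_x f (s *: x)%R = \int[mscale k (lebesgue_rV R n)]_x f x.
  transitivity (\int[pushforward (lebesgue_rV R n) (fun x : 'rV[R]_n => s *: x)%R]_x f x).
    by rewrite ge0_integral_pushforward.
  apply: eq_measure_integral => A mA _.
  transitivity (((s ^+ n)^-1)%:E * lebesgue_rV R n A); last by [].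
  transitivity (lebesgue_rV R n ((fun x => s *: x)%R @^-1` A)); first by [].
  by rewrite (lebesgue_rV_scale s0 mA) muleA -EFinM mulVf ?gt_eqF// mul1e.
by rewrite ge0_integral_mscale// muleA -EFinM mulfV ?gt_eqF// mul1e.
Qed.

Let T n (nu : 'rV[R]_n.+1) := reflection (nu - e0 n)%R.

Let edot_T n (nu x : 'rV[R]_n.+1) : enorm nu = 1%R -> edot (T nu x) (e0 n) = edot x nu.
Proof. by move=> nu1; rewrite -(reflection_unit nu1 (enorm_e0 n)) edot_reflection. Qed.

Lemma integral_abs_edot n (nu : 'rV[R]_n.+1) (J : R -> R) : enorm nu = 1%R ->
  measurable_fun setT J -> (forall q, 0 <= J q)%R ->
  \int[lebesgue_rV R n.+1]_x (`|edot x nu| * J (enorm x))%:E =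
  \int[lebesgue_rV R n.+1]_x (`|x 0%R ord0| * J (enorm x))%:E.
Proof.
move=> nu1 mJ J0.
rewrite -[RHS](ge0_integral_invariant (@measurable_reflection R n.+1 (nu - e0 n)%R)).
- by apply: eq_integral => x _; rewrite enorm_reflection -(edot_e0 (reflection _ x)) (edot_T x nu1).
- by move=> A mA; exact: lebesgue_rV_reflection.
- apply/measurable_EFinP/measurable_funM; last exact: measurableT_comp mJ measurable_enorm.
  by apply: measurableT_comp => //; exact: measurable_coord.
- by move=> x; rewrite lee_fin mulr_ge0.
Qed.

(** The directions, scaled to the unit ball, for which the sharp estimate of tubes is given up. *)
Definition slab n (nu : 'rV[R]_n) (kappa : R) : set 'rV[R]_n :=
  [set x | (enorm x < 1)%R /\ (`|edot x nu| < kappa)%R].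

Lemma measurable_slab n (nu : 'rV[R]_n) (kappa : R) : measurable (slab nu kappa).
Proof.
have m1 : measurable_fun setT (fun x : 'rV[R]_n => (enorm x < 1)%R && (`|edot x nu| < kappa)%R).
  apply: measurable_and; apply: measurable_fun_ltr => //; first exact: measurable_enorm.
  by apply: measurableT_comp => //; apply: measurable_fun_edot.
rewrite (_ : slab nu kappa = (fun x : 'rV[R]_n => (enorm x < 1)%R && (`|edot x nu| < kappa)%R) @^-1` [set true]).
  by rewrite -[X in measurable X]setTI; exact: m1.
by apply/seteqP; split => x /= => [[-> ->]|/andP[]].
Qed.

(** Once nu is reflected to the first axis, the sections are empty for |t| >= kappa and lie in the
    unit ball of dimension n otherwise. *)
Lemma lebesgue_slab n (nu : 'rV[R]_n.+1) (kappa : R) : enorm nu = 1%R -> (0 <= kappa)%R ->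
  lebesgue_rV R n.+1 (slab nu kappa) <= (2 * kappa * ball_volume R n)%:E.
Proof.
move=> nu1 k0.
have -> : slab nu kappa = reflection (nu - e0 n)%R @^-1` slab (e0 n) kappa.
  by apply/seteqP; split => x; rewrite /slab/= enorm_reflection (edot_T _ nu1).
rewrite lebesgue_rV_reflection; last exact: measurable_slab.
rewrite lebesgue_rV_sections; last exact: measurable_slab.
apply: (@le_trans _ _ (\int[lebesgue_measure]_(t in `](- kappa)%R, kappa[) (ball_volume R n * t ^+ 0)%:E)); last first.
  by rewrite integral_monomial ?ge0_cp// !expr1 lee_fin; lra.
rewrite [leRHS]integral_mkcond; apply: le_integral_nonneg => t _; first exact: measure_ge0.
rewrite patchE mem_setE in_itv/= -ltr_norml; case: ifPn => h.
  rewrite expr0 mulr1 ball_volumeE; apply: le_measure; rewrite ?inE.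
  - apply: (measurable_preimage (f := fun x => rV_cons (t, x))); last exact: measurable_slab.
    by apply: (measurableT_comp (@measurable_rV_cons R n)); exact: measurable_fun_pair.
  - exact: measurable_eball.
  move=> x [h1 _]; rewrite /eball/= subr0; apply: le_lt_trans h1.
  by have := ler_enorm_uncons (rV_cons (t, x)); rewrite rV_consK.
have -> : [set x | slab (e0 n) kappa (rV_cons (t, x))] = set0.
  by apply/seteqP; split => x //= -[_]; rewrite edot_e0 rV_cons0/= => h'; rewrite h' in h.
by rewrite measure0.
Qed.

End rotation_invariance.

(** * The failure energy *)

Section tube_energy.
Context {R : realType} {m : nat}.
Variables (J : R -> R) (M Cplus : R).
Hypotheses (ndJ : nonincreasing_fun J) (J0 : forall q, 0 <= J q) (J1 : forall q, 1 <= q -> J q = 0)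
  (JM : forall q, J q <= M) (C0 : 0 < Cplus).
Local Open Scope ereal_scope.
Local Notation lam := (lebesgue_rV R m.+2).
Local Notation H := (@hausdorff_measure R m.+2 m.+1).
Local Notation tc := (@tube_constant R m.+1).
Implicit Types (E C D : set 'rV[R]_m.+2) (eps kappa : R).

Let w0 : (0 < ball_volume R m.+2)%R.
Proof. exact: ball_volume_gt0. Qed.

Definition bond_density eps (xi : 'rV[R]_m.+2) : R :=
  (J (enorm xi / eps) / (eps * (ball_volume R m.+2 * eps ^+ m.+2)) * Cplus)%R.

Lemma bond_density_ge0 eps xi : (0 < eps)%R -> (0 <= bond_density eps xi)%R.
Proof.
move=> e0; rewrite mulr_ge0 ?(ltW C0)// divr_ge0//.
by rewrite mulr_ge0 ?(ltW e0)// mulr_ge0 ?(ltW w0)// exprn_ge0// ltW.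
Qed.

Lemma bond_density_eq0 eps xi : (0 < eps)%R -> (eps <= enorm xi)%R -> bond_density eps xi = 0%R.
Proof. by move=> e0 h; rewrite /bond_density J1 ?mul0r// ler_pdivlMr// mul1r. Qed.

Lemma measurable_bond_density eps : measurable_fun setT (bond_density eps).
Proof.
apply: measurable_funM => //; apply: measurable_funM => //.
apply: (measurableT_comp (nonincreasing_measurable measurableT ndJ)).
by apply: measurable_funM => //; exact: measurable_enorm.
Qed.

(* The part of the failure energy carried by the bonds that cross E, with the pair (x, y)
   parametrized by x and xi = y - x. *)
Definition tube_energy eps E : \bar R :=
  \int[lam]_xi ((bond_density eps xi)%:E * lam (tube E xi)).

Let mJ : measurable_fun setT J.
Proof. exact: nonincreasing_measurable. Qed.

Let tc_gt0 : (0 < tc)%R.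
Proof. exact: tube_constant_gt0. Qed.

Let M0 : (0 <= M)%R.
Proof. exact: le_trans (J0 0) (JM 0). Qed.

Lemma measurable_lebesgue_tube E : measurable [set p : 'rV[R]_m.+2 * 'rV[R]_m.+2 | tube E p.2 p.1] ->
  measurable_fun setT (fun xi => lam (tube E xi)).
Proof.
move=> mE; apply: (eq_measurable_fun (lam \o ysection [set p | tube E p.2 p.1])) => [xi _|].
  by congr (lam _); apply/seteqP; split => x /=; rewrite /ysection/= in_setE.
exact: measurable_fun_ysection.
Qed.

Lemma measurable_tube_density eps E : compact E ->
  measurable_fun setT (fun xi => (bond_density eps xi)%:E * lam (tube E xi)).
Proof.
move=> cE; apply: emeasurable_funM.
  by apply/measurable_EFinP; exact: measurable_bond_density.
exact: measurable_lebesgue_tube (measurable_tube_pair cE).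
Qed.

Let bond eps (x : 'rV[R]_m.+2) E : \bar R :=
  (J (enorm x) * (Cplus / (ball_volume R m.+2 * eps)))%:E * lam (tube E (eps *: x)%R).

Let bond_ge0 eps x E : (0 < eps)%R -> 0 <= bond eps x E.
Proof.
by move=> e0; rewrite mule_ge0// lee_fin mulr_ge0// divr_ge0// ?mulr_ge0 ?ltW.
Qed.

Let measurable_bond eps E : compact E -> measurable_fun setT (bond eps ^~ E).
Proof.
move=> cE; apply: emeasurable_funM.
  apply/measurable_EFinP/measurable_funM => //.
  exact: measurableT_comp mJ measurable_enorm.
apply: (measurableT_comp (measurable_lebesgue_tube (measurable_tube_pair cE))).
exact: measurable_funZ_rV.
Qed.

(** Under xi = eps x the Jacobian cancels the power eps ^ (m + 2) in the kernel. One factor 1 / eps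
    remains, to be absorbed by the tube, whose direction is now [eps *: x]. *)
Lemma tube_energyE eps E : (0 < eps)%R -> compact E ->
  tube_energy eps E = \int[lam]_x bond eps x E.
Proof.
move=> e0 cE.
pose f xi : \bar R := ((bond_density eps xi)%:E * lam (tube E xi)).
have mf : measurable_fun setT f by exact: measurable_tube_density.
have f0 x : 0 <= f x by rewrite mule_ge0// lee_fin bond_density_ge0.
transitivity ((eps ^+ m.+2)%:E * \int[lam]_x f (eps *: x)%R).
  exact: ge0_integral_rV_scale e0 mf f0.
have en : (0 < eps ^+ m.+2)%R by rewrite exprn_gt0.
have mfe : measurable_fun setT (fun x : 'rV[R]_m.+2 => f (eps *: x)%R).
  by apply: (measurableT_comp mf); exact: measurable_funZ_rV.
rewrite -ge0_integralZl//; last by rewrite lee_fin ltW.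
apply: eq_integral => x _; rewrite /f muleA -EFinM /bond_density; congr (_%:E * _).
rewrite (_ : enorm (eps *: x)%R / eps = enorm x)%R; last first.
  by rewrite enormZ gtr0_norm// mulrAC mulfV ?gt_eqF// mul1r.
by field; rewrite !gt_eqF.
Qed.

(** Only |x| < 1 contributes. There [lebesgue_tube_gauge] with L = eps supplies the factor eps that
    cancels 1 / eps, and the volume of the unit ball cancels the one in the kernel. *)
Lemma tube_energy_gauge eps D : (0 < eps)%R -> compact D -> ediam D <= eps%:E ->
  tube_energy eps D <= (Cplus * M * tc)%:E * hausdorff_gauge m.+1 D.
Proof.
move=> e0 cD dD; rewrite tube_energyE//.
have g0 := hausdorff_gauge_ge0 m.+1 D.
pose c : R := (M * (Cplus / ball_volume R m.+2) * tc)%R.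
have c0 : (0 <= c)%R.
  by rewrite mulr_ge0 ?(ltW tc_gt0)// mulr_ge0// divr_ge0// ltW.
apply: (@le_trans _ _ (\int[lam]_x ((c%:E * hausdorff_gauge m.+1 D) * (\1_(eball (0%R : 'rV[R]_m.+2) 1%R) x)%:E))).
  apply: le_integral_nonneg => x _; first exact: bond_ge0.
  rewrite indicE; have [x1|x1] := ltP (enorm x) 1%R; last first.
    by rewrite /bond J1// mul0r mul0e mule_ge0// ?lee_fin// mule_ge0// lee_fin.
  rewrite mem_set ?mule1; last by rewrite /eball/= subr0.
  apply: (@le_trans _ _ ((M * (Cplus / (ball_volume R m.+2 * eps)))%:E * ((tc * eps)%:E * hausdorff_gauge m.+1 D))).
    rewrite /bond; apply: lee_pmul => //.
    - by rewrite lee_fin mulr_ge0// divr_ge0// ?mulr_ge0 ?ltW.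
    - by rewrite lee_fin ler_wpM2r// divr_ge0// ?mulr_ge0 ?ltW.
    - apply: lebesgue_tube_gauge => //.
      by rewrite enormZ gtr0_norm// ler_piMr// ltW.
  rewrite muleA -EFinM le_eqVlt; apply/orP; left; apply/eqP; congr (_%:E * _).
  by rewrite /c; field; rewrite !gt_eqF.
rewrite ge0_integralZl//; last 2 first.
- by apply/measurable_EFinP; apply: measurable_indic; exact: measurable_eball.
- by rewrite mule_ge0.
rewrite integral_indic//; last exact: measurable_eball.
apply: (@le_trans _ _ (c%:E * hausdorff_gauge m.+1 D * (ball_volume R m.+2)%:E)).
  by rewrite setIT ball_volumeE.
rewrite muleAC -EFinM le_eqVlt; apply/orP; left; apply/eqP; congr (_%:E * _).
by rewrite /c; field; rewrite gt_eqF.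
Qed.

Section flat_piece.
Variables (C : set 'rV[R]_m.+2) (nu : 'rV[R]_m.+2) (kappa K : R).
Hypotheses (cC : compact C) (nu1 : enorm nu = 1%R) (k01 : (0 < kappa < 1)%R)
  (fC : flat nu (kappa ^+ 2 / 2)%R C).
Hypothesis KE : \int[lam]_x (`|x 0%R ord0| * J (enorm x))%:E = K%:E.

Let h := fine (H C).

Let HE : H C = h%:E.
Proof. by rewrite /h fineK// ge0_fin_numE ?hausdorff_measure_ge0//; exact: flat_hausdorff_lty k01 cC nu1 fC. Qed.

Let h0 : (0 <= h)%R.
Proof. by rewrite -lee_fin -HE hausdorff_measure_ge0. Qed.

Let mslab : measurable_fun setT (fun x : 'rV[R]_m.+2 => (\1_(slab nu kappa) x : R)).
Proof. by apply: measurable_indic; exact: measurable_slab. Qed.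

Let slab_integral (c : R) : (0 <= c)%R ->
  \int[lam]_x (c * \1_(slab nu kappa) x)%:E <= (c * (2 * kappa * ball_volume R m.+1))%:E.
Proof.
move=> c0; under eq_integral do rewrite EFinM.
have mE : measurable_fun setT (fun x : 'rV[R]_m.+2 => (\1_(slab nu kappa) x : R)%:E) by exact/measurable_EFinP.
rewrite ge0_integralZl//.
rewrite integral_indic//; last exact: measurable_slab.
rewrite EFinM; apply: lee_wpmul2l; first by rewrite lee_fin.
rewrite setIT.
by apply: lebesgue_slab => //; case/andP: k01 => /ltW.
Qed.

Let main_integral (c : R) : (0 <= c)%R ->
  \int[lam]_x (c * (`|edot x nu| * J (enorm x)))%:E = (c * K)%:E.
Proof.
move=> c0; under eq_integral do rewrite EFinM.
rewrite ge0_integralZl//.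
- by rewrite (integral_abs_edot nu1 mJ J0) KE.
- apply/measurable_EFinP/measurable_funM; last exact: measurableT_comp mJ measurable_enorm.
  by apply: measurableT_comp => //; exact: measurable_fun_edot.
- by move=> x _; rewrite lee_fin mulr_ge0.
Qed.

Let mmain (c : R) : measurable_fun setT (fun x : 'rV[R]_m.+2 => (c * (`|edot x nu| * J (enorm x)))%:E).
Proof.
apply/measurable_EFinP/measurable_funM => //; apply: measurable_funM; last exact: measurableT_comp mJ measurable_enorm.
by apply: measurableT_comp => //; exact: measurable_fun_edot.
Qed.

(** Outside the slab kappa |x| <= kappa <= |x.nu|, so [eps *: x] is an admissible direction, and its
    length brings out the factor eps. *)
Let dichotomy eps (x : 'rV[R]_m.+2) : (0 < eps)%R -> (enorm x < 1)%R ->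
  slab nu kappa x \/ (`|edot x nu| * (1 - kappa) ^+ m.+1 * (eps * h))%:E <= lam (tube C (eps *: x)%R)
    <= (`|edot x nu| * (1 + kappa) ^+ m.+1 * (eps * h))%:E.
Proof.
move=> e0 x1; have [k0 k1] := andP k01; have [|big] := ltP `|edot x nu|%R kappa; first by left.
right; have := @lebesgue_tube_flat R m nu (eps *: x)%R kappa C cC nu1 k01 fC.
have xn0 : x != 0%R by apply: contraTneq big => ->; rewrite edot0l normr0 -ltNge.
rewrite scaler_eq0 negb_or gt_eqF// xn0 => /(_ isT).
rewrite enormZ edotZl normrM gtr0_norm// => /(_ _)/wrap[].
  rewrite mulrCA ler_pM2l// (le_trans _ big)// ler_piMr ?ltW//.
rewrite HE -!EFinM (_ : eps * `|edot x nu| * (1 - kappa) ^+ m.+1 * h = `|edot x nu| * (1 - kappa) ^+ m.+1 * (eps * h))%R; last by ring.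
by rewrite (_ : eps * `|edot x nu| * (1 + kappa) ^+ m.+1 * h = `|edot x nu| * (1 + kappa) ^+ m.+1 * (eps * h))%R; last by ring.
Qed.

Lemma tube_energy_flat_le eps : (0 < eps)%R ->
  tube_energy eps C <= (Cplus / ball_volume R m.+2 * ((1 + kappa) ^+ m.+1 * K +
    M * tc * (2 * kappa * ball_volume R m.+1)))%:E * H C.
Proof.
move=> e0; have [k0 k1] := andP k01; rewrite tube_energyE//.
have cw0 : (0 <= Cplus / ball_volume R m.+2)%R by rewrite divr_ge0 ?ltW.
have tc0 : (0 <= tc)%R by exact: ltW tc_gt0.
pose a : R := (Cplus / ball_volume R m.+2 * (1 + kappa) ^+ m.+1 * h)%R.
(* [a] scales the main term; [b] bounds the integrand on the slab, through the crude tube estimate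
   [lebesgue_tube_hausdorff]. *)
pose b : R := (Cplus / ball_volume R m.+2 * M * tc * h)%R.
have a0 : (0 <= a)%R by rewrite mulr_ge0// mulr_ge0// exprn_ge0// addr_ge0// ltW.
have b0 : (0 <= b)%R by rewrite mulr_ge0// mulr_ge0// mulr_ge0.
have aJ0 (x : 'rV[R]_m.+2) : (0 <= a * (`|edot x nu| * J (enorm x)))%R by rewrite mulr_ge0// mulr_ge0.
apply: (@le_trans _ _ (\int[lam]_x ((a * (`|edot x nu| * J (enorm x)))%:E + (b * \1_(slab nu kappa) x)%:E))).
  apply: le_integral_nonneg => x _; first exact: bond_ge0.
  have [x1|x1] := ltP (enorm x) 1%R; last first.
    by rewrite /bond J1// mul0r mul0e -EFinD lee_fin !mulr0 add0r mulr_ge0.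
  have ce : (0 <= J (enorm x) * (Cplus / (ball_volume R m.+2 * eps)))%R.
    by rewrite mulr_ge0// divr_ge0// ?mulr_ge0 ?ltW.
  have [sx|/andP[_ up]] := dichotomy e0 x1.
    rewrite indicE mem_set// -EFinD.
    apply: (@le_trans _ _ ((M * (Cplus / (ball_volume R m.+2 * eps)))%:E * (tc * eps * h)%:E)).
      rewrite /bond; apply: lee_pmul => //.
        by rewrite lee_fin ler_wpM2r// divr_ge0// ?mulr_ge0 ?ltW.
      rewrite EFinM -HE; apply: lebesgue_tube_hausdorff => //.
      by rewrite enormZ gtr0_norm// ler_piMr// ltW.
    rewrite -EFinM lee_fin mulr1.
    rewrite (_ : M * (Cplus / (ball_volume R m.+2 * eps)) * (tc * eps * h) = b)%R; last first.
      by rewrite /b; field; rewrite !gt_eqF.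
    by rewrite lerDr.
  apply: (@le_trans _ _ (a * (`|edot x nu| * J (enorm x)))%:E); last by rewrite -EFinD lee_fin lerDl mulr_ge0.
  rewrite /bond; apply: (le_trans (lee_wpmul2l _ up)); first by rewrite lee_fin.
  rewrite -EFinM lee_fin le_eqVlt; apply/orP; left; apply/eqP.
  by rewrite /a; field; rewrite !gt_eqF.
rewrite ge0_integralD//.
- rewrite main_integral//; apply: (le_trans (leeD2l _ (slab_integral b0))).
  rewrite -EFinD HE -EFinM lee_fin le_eqVlt; apply/orP; left; apply/eqP.
  by rewrite /a /b; ring.
- by move=> x _; rewrite lee_fin.
- by move=> x _; rewrite lee_fin mulr_ge0.
- exact/measurable_EFinP/measurable_funM.
Qed.

(** On the slab nothing is claimed about the tube. The main term is at most [b] there, since |x.nu|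
    <= 1 and J <= M, and this amount is added on the other side, which avoids subtracting extended
    reals. *)
Lemma le_tube_energy_flat eps : (0 < eps)%R ->
  (Cplus / ball_volume R m.+2 * ((1 - kappa) ^+ m.+1 * K - M * (2 * kappa * ball_volume R m.+1)))%:E * H C
    <= tube_energy eps C.
Proof.
move=> e0; have [k0 k1] := andP k01; rewrite tube_energyE//.
have cw0 : (0 <= Cplus / ball_volume R m.+2)%R by rewrite divr_ge0 ?ltW.
pose a : R := (Cplus / ball_volume R m.+2 * (1 - kappa) ^+ m.+1 * h)%R.
pose b : R := (Cplus / ball_volume R m.+2 * M * h)%R.
have a0 : (0 <= a)%R by rewrite mulr_ge0// mulr_ge0// exprn_ge0// subr_ge0 ltW.
have b0 : (0 <= b)%R by rewrite mulr_ge0// mulr_ge0.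
have aJ0 (x : 'rV[R]_m.+2) : (0 <= a * (`|edot x nu| * J (enorm x)))%R by rewrite mulr_ge0// mulr_ge0.
have key : (a * K)%:E <= \int[lam]_x bond eps x C + (b * (2 * kappa * ball_volume R m.+1))%:E.
  rewrite -main_integral//; apply: (@le_trans _ _ (\int[lam]_x (bond eps x C + (b * \1_(slab nu kappa) x)%:E))).
    apply: le_integral_nonneg => x _; first by rewrite lee_fin.
    have [x1|x1] := ltP (enorm x) 1%R; last first.
      by rewrite J1// !mulr0 adde_ge0 ?bond_ge0// lee_fin mulr_ge0.
    have ce : (0 <= J (enorm x) * (Cplus / (ball_volume R m.+2 * eps)))%R.
      by rewrite mulr_ge0// divr_ge0// ?mulr_ge0 ?ltW.
    have [sx|/andP[lo _]] := dichotomy e0 x1.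
      apply: (@le_trans _ _ (b * \1_(slab nu kappa) x)%:E); last by rewrite leeDr// bond_ge0.
      rewrite indicE mem_set// lee_fin mulr1.
      have x1' : (`|edot x nu| <= 1)%R.
        by have [_ h'] := sx; rewrite ltW// (lt_trans h').
      have p1 : ((1 - kappa) ^+ m.+1 <= 1)%R.
        by apply: exprn_ile1; [rewrite subr_ge0 ltW|rewrite gerBl ltW].
      have p0 : (0 <= (1 - kappa) ^+ m.+1)%R by rewrite exprn_ge0// subr_ge0 ltW.
      pose cw : R := (Cplus / ball_volume R m.+2)%R.
      rewrite (_ : a * _ = cw * h * ((1 - kappa) ^+ m.+1 * (`|edot x nu| * J (enorm x))))%R; last by rewrite /a /cw; ring.
      rewrite (_ : b = cw * h * (1 * (1 * M)))%R; last by rewrite /b /cw; ring.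
      apply: ler_wpM2l; first by rewrite mulr_ge0.
      apply: ler_pM => //; first by rewrite mulr_ge0.
      exact: ler_pM.
    apply: (@le_trans _ _ (bond eps x C)); last by rewrite leeDl// lee_fin mulr_ge0.
    rewrite /bond; apply: (le_trans _ (lee_wpmul2l _ lo)); last by rewrite lee_fin.
    rewrite -EFinM lee_fin le_eqVlt; apply/orP; left; apply/eqP.
    by rewrite /a; field; rewrite !gt_eqF.
  rewrite ge0_integralD//.
  - by apply: leeD2l; exact: slab_integral.
  - by move=> x _; exact: bond_ge0.
  - exact: measurable_bond.
  - by move=> x _; rewrite lee_fin mulr_ge0.
  - exact/measurable_EFinP/measurable_funM.
rewrite HE -EFinM (_ : _ * h = a * K - b * (2 * kappa * ball_volume R m.+1))%R; last by rewrite /a /b; ring.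
by rewrite EFinB leeBlDr.
Qed.

End flat_piece.

End tube_energy.

Section failure_energy_bounds.
Context {R : realType} {m : nat}.
Variables (J : R -> R) (Cplus : R).
Hypotheses (ndJ : nonincreasing_fun J) (J0 : forall q, 0 <= J q) (J1 : forall q, 1 <= q -> J q = 0)
  (C0 : 0 < Cplus).
Local Open Scope ereal_scope.
Local Notation lam := (lebesgue_rV R m.+2).
Implicit Types (A E Omega crack : set 'rV[R]_m.+2) (eps : R) (x y xi : 'rV[R]_m.+2).

Local Notation bond_density := (@bond_density R m J Cplus).

Let crossing E : set ('rV[R]_m.+2 * 'rV[R]_m.+2) := [set p | tube E p.2 p.1].

Let G eps E (p : 'rV[R]_m.+2 * 'rV[R]_m.+2) : \bar R :=
  (bond_density eps p.2 * \1_(crossing E) p)%:E.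

Let G_ge0 eps E p : (0 < eps)%R -> 0 <= G eps E p.
Proof. by move=> e0; rewrite lee_fin mulr_ge0// (bond_density_ge0 J0 C0). Qed.

Let measurable_G eps E : measurable (crossing E) -> measurable_fun setT (G eps E).
Proof.
move=> mE; apply/measurable_EFinP/measurable_funM; last exact: measurable_indic.
by apply: (measurableT_comp _ measurable_snd); exact: measurable_bond_density.
Qed.

(** Exchanging the integrals and translating by x, xi = y - x, gives the iterated form in which the
    failure energy is defined. *)
Lemma tube_energy_tonelli eps E : (0 < eps)%R -> measurable (crossing E) ->
  tube_energy J Cplus eps E = \int[lam]_x \int[lam]_y G eps E (x, (y - x)%R).
Proof.
move=> e0 mE; have mG := @measurable_G eps E mE.
transitivity (\int[lam]_xi \int[lam]_x G eps E (x, xi)).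
  apply: eq_integral => xi _.
  have mt : measurable (tube E xi).
    have -> : tube E xi = ysection (crossing E) xi.
      by apply/seteqP; split => x /=; rewrite /ysection/= in_setE.
    exact: measurable_ysection.
  transitivity (\int[lam]_x ((bond_density eps xi)%:E * (\1_(tube E xi) x)%:E)).
    rewrite ge0_integralZl//.
    - by rewrite (integral_indic lam measurableT mt) setIT.
    - by apply/measurable_EFinP; exact: measurable_indic.
    - by rewrite lee_fin (bond_density_ge0 J0 C0).
  apply: eq_integral => x _; by rewrite /G -EFinM !indicE; congr (_ * (nat_of_bool _)%:R)%:E.
transitivity (\int[lam]_x \int[lam]_xi G eps E (x, xi)).
  exact: (esym (fubini_tonelli (m1 := lam) (m2 := lam) (G eps E) mG (fun p => G_ge0 E p e0))).
apply: eq_integral => x _.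
have mphi : measurable_fun setT (fun y => (y - x)%R) by exact: measurable_funB_rV.
have mf : measurable_fun setT (fun xi => G eps E (x, xi)).
  by apply: (measurableT_comp mG); exact: measurable_fun_pair.
exact: (esym (ge0_integral_invariant mphi (lebesgue_rV_shift (- x)%R) mf (fun xi => G_ge0 E (x, xi) e0))).
Qed.

Let g Omega crack eps x y : \bar R :=
  (kernel_rho Omega J eps y x * Cplus * \1_(failure_set Omega crack eps) (x, y))%:E.

Let gE Omega crack eps x y : Omega y ->
  g Omega crack eps x y = (bond_density eps (y - x) * \1_(failure_set Omega crack eps) (x, y))%:E.
Proof. by move=> Oy; rewrite /g /kernel_rho indicE mem_set// mul1r. Qed.

Let g_ge0 Omega crack eps x y : (0 < eps)%R -> Omega y -> 0 <= g Omega crack eps x y.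
Proof. by move=> e0 Oy; rewrite gE// lee_fin mulr_ge0// (bond_density_ge0 J0 C0). Qed.

(** Pointwise domination suffices, so a failure set that is not Borel causes no difficulty;
    measurability is asked only of the bonds crossing [E]. *)
Lemma failure_energy_le_tube Omega crack E eps : (0 < eps)%R -> measurable (crossing E) ->
  crack `<=` E ->
  failure_energy Omega J Cplus (failure_set Omega crack eps) eps <= tube_energy J Cplus eps E.
Proof.
move=> e0 mE cE; rewrite (tube_energy_tonelli e0 mE) /failure_energy integral_mkcond.
apply: le_integral_nonneg => x _.
  by rewrite patchE; case: ifPn => // _; apply: integral_ge0 => y Oy; exact: g_ge0.
rewrite patchE; case: ifPn => _; last by apply: integral_ge0 => y _; exact: G_ge0.
rewrite integral_mkcond; apply: le_integral_nonneg => y _.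
  by rewrite patchE; case: ifPn => // /set_mem Oy; exact: g_ge0.
rewrite patchE; case: ifPn => [/set_mem Oy|_]; last exact: G_ge0.
rewrite [leLHS](gE crack eps x Oy) lee_fin ler_wpM2l ?(bond_density_ge0 J0 C0)// !indicE ler_nat.
case: (boolP ((x, y) \in failure_set Omega crack eps)) => // /set_mem[_ _ [p [[s]]]].
rewrite /= in_itv/= => s01 <- cp; rewrite mem_set//.
exists s => //; apply: cE; move: cp; congr crack.
by apply/rowP => i; rewrite !mxE; ring.
Qed.

(** A bond shorter than eps that meets [E] has both endpoints in Omega, since points of [E] keep
    distance r >= eps from the complement. Restricting both integrals to Omega therefore loses no
    such bond. *)
Lemma tube_le_failure_energy Omega crack E (r eps : R) : (0 < eps <= r)%R -> compact E ->
  E `<=` crack -> (forall p x, E p -> ~ Omega x -> (r <= enorm (p - x))%R) ->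
  tube_energy J Cplus eps E <= failure_energy Omega J Cplus (failure_set Omega crack eps) eps.
Proof.
move=> /andP[e0 er] cE Ec far; have mE := measurable_tube_pair cE.
have near_Omega x y : (enorm (y - x) < eps)%R -> tube E (y - x)%R x ->
    [/\ Omega x, Omega y & failure_set Omega crack eps (x, y)].
  move=> xy [s s01 Ep]; have /andP[s0 s1] := s01.
  have Ox : Omega x.
    apply: contrapT => nO; have := far _ _ Ep nO; apply/negP; rewrite -ltNge.
    rewrite addrAC subrr add0r enormZ ger0_norm//; apply: lt_le_trans er.
    by apply: le_lt_trans xy; rewrite ler_piMl// enorm_ge0.
  have Oy : Omega y.
    apply: contrapT => nO; have := far _ _ Ep nO; apply/negP; rewrite -ltNge.
    have -> : (x + s *: (y - x) - y = (s - 1) *: (y - x))%R by apply/rowP => i; rewrite !mxE; ring.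
    rewrite enormZ distrC ger0_norm ?subr_ge0//; apply: lt_le_trans er.
    by apply: le_lt_trans xy; rewrite ler_piMl ?enorm_ge0// gerBl.
  split => //; split => //; exists (x + s *: (y - x))%R; split; last exact: Ec.
  by exists s; rewrite /= ?in_itv//; apply/rowP => i; rewrite !mxE; ring.
have G0 x y : ~ ((enorm (y - x) < eps)%R /\ tube E (y - x)%R x) -> G eps E (x, (y - x)%R) = 0.
  move=> h; rewrite /G/=; have [xy|/(bond_density_eq0 Cplus J1 e0)->] := ltP (enorm (y - x)%R) eps; rewrite ?mul0r//.
  by rewrite indicE memNset ?mulr0// => t; apply: h.
rewrite (tube_energy_tonelli e0 mE) /failure_energy [leRHS]integral_mkcond.
apply: le_integral_nonneg => x _; first by apply: integral_ge0 => y _; exact: G_ge0.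
rewrite patchE; case: ifPn => [Ox|/negP nO]; last first.
  rewrite integral0_eq// => y _; apply: G0 => -[xy t]; apply: nO.
  by apply/mem_set; have [] := near_Omega x y xy t.
rewrite [leRHS]integral_mkcond; apply: le_integral_nonneg => y _; first exact: G_ge0.
have [[xy t]|h] := pselect ((enorm (y - x) < eps)%R /\ tube E (y - x)%R x); last first.
  rewrite G0// patchE; case: ifPn => // /set_mem Oy; exact: g_ge0.
have [_ Oy fs] := near_Omega x y xy t.
rewrite patchE mem_set// [leRHS](gE crack eps x Oy) lee_fin ler_wpM2l ?(bond_density_ge0 J0 C0)//.
by rewrite !indicE (mem_set fs) ler_nat leq_b1.
Qed.

Lemma tube_energy_bigcup_le eps (F : (set 'rV[R]_m.+2)^nat) : (0 < eps)%R ->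
  (forall k, compact (F k)) ->
  measurable (crossing (\bigcup_k F k)) /\
  tube_energy J Cplus eps (\bigcup_k F k) <= \sum_(k <oo) tube_energy J Cplus eps (F k).
Proof.
move=> e0 cF.
have mU : measurable (crossing (\bigcup_k F k)).
  have -> : crossing (\bigcup_k F k) = \bigcup_k crossing (F k).
    by apply/seteqP; split => -[x xi]; rewrite /crossing/= tube_bigcup.
  by apply: bigcupT_measurable => k; exact: measurable_tube_pair.
split => //; rewrite -integral_nneseries//.
- apply: le_integral_nonneg => xi _; first by rewrite mule_ge0// lee_fin (bond_density_ge0 J0 C0).
  rewrite nneseriesZl//; apply: lee_wpmul2l; first by rewrite lee_fin (bond_density_ge0 J0 C0).
  rewrite tube_bigcup; apply: measure_sigma_subadditive => //.
    by move=> k; exact: measurable_tube.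
  by apply: bigcupT_measurable => k; exact: measurable_tube.
- move=> k; exact: measurable_tube_density.
- by move=> k xi _; rewrite mule_ge0// lee_fin (bond_density_ge0 J0 C0).
Qed.

Lemma tube_energyU_le eps (E F : set 'rV[R]_m.+2) : (0 < eps)%R -> compact E -> compact F ->
  tube_energy J Cplus eps (E `|` F) <= tube_energy J Cplus eps E + tube_energy J Cplus eps F.
Proof.
move=> e0 cE cF; rewrite /tube_energy -ge0_integralD//.
- apply: le_integral_nonneg => xi _; first by rewrite mule_ge0// lee_fin (bond_density_ge0 J0 C0).
  rewrite -ge0_muleDr//; apply: lee_wpmul2l; first by rewrite lee_fin (bond_density_ge0 J0 C0).
  have -> : tube (E `|` F) xi = tube E xi `|` tube F xi.
    apply/seteqP; split => x.
      by move=> [s s01 [h|h]]; [left|right]; exists s.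
    by move=> [[s s01 h]|[s s01 h]]; exists s => //; [left|right].
  by apply: measureU2; exact: measurable_tube.
- by move=> xi _; rewrite mule_ge0// lee_fin (bond_density_ge0 J0 C0).
- exact: measurable_tube_density.
- by move=> xi _; rewrite mule_ge0// lee_fin (bond_density_ge0 J0 C0).
- exact: measurable_tube_density.
Qed.

Lemma sum_le_tube_energy_separated (r eps : R) (F : (set 'rV[R]_m.+2)^nat) N : (0 < eps <= r)%R ->
  (forall k, compact (F k)) ->
  (forall i j, (i < N)%N -> (j < N)%N -> i != j -> forall p q, F i p -> F j q -> (r <= enorm (p - q))%R) ->
  \sum_(k < N) tube_energy J Cplus eps (F k) <= tube_energy J Cplus eps (\big[setU/set0]_(k < N) F k).
Proof.
move=> /andP[e0 er] cF sep; rewrite /tube_energy -ge0_integral_sum//.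
- apply: le_integral_nonneg => xi _.
    by apply: sume_ge0 => k _; rewrite mule_ge0// lee_fin (bond_density_ge0 J0 C0).
  rewrite -ge0_sume_distrr//; have [xe|xe] := ltP (enorm xi) eps; last first.
    by rewrite -/(bond_density eps xi) (bond_density_eq0 Cplus J1)// !mul0e.
  apply: lee_wpmul2l; first by rewrite lee_fin (bond_density_ge0 J0 C0).
  (* Separation is known only below N, whereas disjointness is stated for a whole sequence; the
     later terms are made empty. *)
  pose T k := if (k < N)%N then tube (F k) xi else set0.
  have mT k : measurable (T k) by rewrite /T; case: ifP => _ //; exact: measurable_tube.
  have tT : trivIset setT T.
    apply/trivIsetP => i j _ _ ij; rewrite /T; case: ifPn => iN; last by rewrite set0I.
    case: ifPn => jN; last by rewrite setI0.
    apply/seteqP; split => x // -[[s /andP[s0 s1] Fi] [t /andP[t0 t1] Fj]].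
    have := sep i j iN jN ij _ _ Fi Fj; apply/negP; rewrite -ltNge.
    have -> : (x + s *: xi - (x + t *: xi) = (s - t) *: xi)%R by apply/rowP => k; rewrite !mxE; ring.
    rewrite enormZ; apply: lt_le_trans er; apply: le_lt_trans xe.
    by rewrite ler_piMl ?enorm_ge0// ler_norml; lra.
  have -> : \sum_(k < N) lam (tube (F k) xi) = \sum_(k < N) lam (T k).
    by apply: eq_bigr => k _; rewrite /T ltn_ord.
  rewrite -(measure_bigsetU lam mT tT); apply: le_measure.
  - by rewrite inE; exact: bigsetU_measurable.
  - rewrite inE; by apply: measurable_tube; exact: bigsetU_compact.
  - move=> x; rewrite -bigcup_mkord => -[k /= kN]; rewrite /T kN => -[s s01 Fk].
    by exists s => //; rewrite -bigcup_mkord; exists k.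
- move=> k; exact: measurable_tube_density.
- by move=> k xi _; rewrite mule_ge0// lee_fin (bond_density_ge0 J0 C0).
Qed.

End failure_energy_bounds.

(** This matches the two estimates at hand: an upper bound by the limit itself, and lower bounds by
    every smaller real. For L = +oo the lower bounds alone express the convergence. *)
Lemma ereal_cvg_le_gt (R : realType) (T : Type) (F : set_system T) (FF : Filter F)
    (f : T -> \bar R) (L : \bar R) : (0 <= L)%E -> (\forall x \near F, f x <= L)%E ->
  (forall l : R, (l%:E < L)%E -> \forall x \near F, (l%:E < f x)%E) -> f x @[x --> F] --> L.
Proof.
case: L => [L||] L0 fL fl; [|by apply/cvgeyPgt => A; apply: fl; exact: ltry|by []].
have fin : \forall x \near F, f x \is a fin_num.
  have := fl (L - 1) _; rewrite lte_fin gtrBl ltr01 => /(_ isT) h.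
  near=> x; rewrite fin_numElt (@lt_trans _ _ (L - 1)%:E) ?ltNyr//=; last by near: x.
  by rewrite (@le_lt_trans _ _ L%:E) ?ltry//; near: x.
apply/fine_cvgP; split => //; apply/cvgrPdist_lt => e e0.
have := fl (L - e) _; rewrite lte_fin gtrBl e0 => /(_ isT) h.
near=> x; have xf : f x \is a fin_num by near: x.
have h1 : ((L - e)%:E < f x)%E by near: x.
have h2 : (f x <= L%:E)%E by near: x.
move: h1 h2; rewrite /= -(fineK xf) lte_fin lee_fin => h1 h2.
by rewrite ger0_norm ?subr_ge0// ltrBlDr addrC -ltrBlDr.
Unshelve. all: by end_near. Qed.

Lemma continuous_lt_near0 (R : realType) (c : R -> R) (a : R) : continuous c -> c 0 < a ->
  exists2 k : R, 0 < k < 1 & c k < a.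
Proof.
move=> cc ca; have /nbhs_ballP[e /= e0 he] : \forall x \near (0 : R), c x < a by apply: (cvgr_lt _ (cc 0)).
exists (Num.min (e / 2) (1 / 2)).
  by rewrite lt_min gt_min !divr_gt0//= [X in _ || X]ltr_pdivrMr// mul1r ltr1n orbT.
apply: he; rewrite /ball/= sub0r normrN gtr0_norm; last by rewrite lt_min !divr_gt0.
by rewrite gt_min ltr_pdivrMr// ltr_pMr// ltr1n.
Qed.

Section null_cover.
Context {R : realType} {n : nat}.

Lemma compact_closed_eball (r : R) : compact [set y : 'rV[R]_n | enorm (y - 0) <= r].
Proof.
apply: bounded_closed_compact; last exact: closed_ball_closed.
exists r; split; first exact: num_real.
move=> s rs y /=; rewrite subr0 => yr.
by rewrite (le_trans (normr_le_enorm _))// (le_trans yr)// ltW.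
Qed.

Lemma hausdorff_null_cover s (A : set 'rV[R]_n) (r delta e : R) : (A `<=` eball 0 r)%classic ->
  hausdorff_measure s A = 0%E -> 0 < delta -> 0 < e ->
  exists D : (set 'rV[R]_n)^nat, [/\ forall k, compact (D k), A `<=` \bigcup_k D k,
    forall k, (ediam (D k) <= delta%:E)%E & (\sum_(k <oo) hausdorff_gauge s (D k) <= e%:E)%E].
Proof.
move=> Ar HA d0 e0.
have : (hausdorff_premeasure s delta A < e%:E)%E.
  by apply: (le_lt_trans (le_hausdorff_measure s A d0)); rewrite HA lte_fin.
move=> /ereal_inf_lt[_ [C [AC Cd] <-]] Ce.
(* Cutting with the bounded set [A] before closing makes the members compact without enlarging their
   diameters. *)
pose D k := closure (C k `&` A).
have dD k : (ediam (D k) <= ediam (C k))%E.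
  by apply: (le_trans (ediam_closure _)); exact: subset_ediam.
exists D; split.
- move=> k; apply: (subclosed_compact _ (@compact_closed_eball r)); first exact: closed_closure.
  rewrite [X in _ `<=` X]((closure_id _).1 (@closed_ball_closed _ _ 0 r)).
  by apply: closure_subset => x [_ /Ar]; rewrite /eball/= => /ltW.
- by move=> x Ax; have [k _ Ck] := AC x Ax; exists k => //; apply: subset_closure.
- by move=> k; exact: le_trans (Cd k).
apply: le_trans (ltW Ce); apply: lee_nneseries => [k _ _|k _]; first exact: hausdorff_gauge_ge0.
by have := @hausdorff_gauge_le R _ _ s 1 (D k) (C k) ler01; rewrite expr1n !mul1e; apply.
Qed.

End null_cover.

(** * Passage to the limit *)

Section energy_limit.
Context {R : realType} {m : nat}.
Variables (J : R -> R) (M Cplus K : R) (Omega crack : set 'rV[R]_m.+2).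
Hypotheses (ndJ : nonincreasing_fun J) (J0 : forall q, 0 <= J q) (J1 : forall q, 1 <= q -> J q = 0)
  (JM : forall q, J q <= M) (C0 : 0 < Cplus) (K0 : 0 < K).
Hypothesis KE : (\int[lebesgue_rV R m.+2]_x (`|x 0%R ord0| * J (enorm x))%:E = K%:E)%E.
Hypotheses (oO : open Omega) (bO : bounded_set Omega) (crackO : crack `<=` Omega)
  (ccrack : (@hausdorff_measure R m.+2 m.+1).-caratheodory crack) (rcrack : rectifiable crack).
Local Open Scope ereal_scope.
Local Notation H := (@hausdorff_measure R m.+2 m.+1).
Local Notation energy eps := (failure_energy Omega J Cplus (failure_set Omega crack eps) eps).
Local Notation tenergy := (@tube_energy R m J Cplus).

Let w := ball_volume R m.+2.
Let wn := ball_volume R m.+1.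
Let tc := @tube_constant R m.+1.

Let upper (kappa : R) : R := (Cplus / w * ((1 + kappa) ^+ m.+1 * K + M * tc * (2 * kappa * wn)))%R.
Let lower (kappa : R) : R := (Cplus / w * ((1 - kappa) ^+ m.+1 * K - M * (2 * kappa * wn)))%R.

Let w0 : (0 < w)%R. Proof. exact: ball_volume_gt0. Qed.

Let tenergy_ge0 (eps : R) E : (0 < eps)%R -> 0 <= tenergy eps E.
Proof.
by move=> e0; apply: integral_ge0 => xi _; rewrite mule_ge0// lee_fin (bond_density_ge0 J0 C0).
Qed.

(** No smallness of eps is required: subadditivity needs no gaps between the pieces, and the cover
    of the null part is chosen after eps. *)
Lemma failure_energy_upper (kappa eps : R) : (0 < kappa < 1)%R -> (0 < eps)%R ->
  energy eps <= (upper kappa)%:E * H crack.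
Proof.
move=> k01 e0.
have [F [cF fF Fc tF HN]] := flat_decomposition ccrack rcrack k01.
have [r r0 Or] : exists2 r : R, (0 < r)%R & Omega `<=` eball 0%R r by exact: bounded_sub_eball.
apply/lee_addgt0Pr => e e1; rewrite /= in e e1 *.
have M0 : (0 <= M)%R := le_trans (J0 0%R) (JM 0%R).
have tc0 : (0 < tc)%R by exact: tube_constant_gt0.
have c00 : (0 <= Cplus * M * tc)%R by rewrite mulr_ge0 ?(ltW tc0)// mulr_ge0// ltW.
(* The added 1 makes the divisor positive; a cover of total gauge e / (Cplus * M * tc + 1) then
   contributes energy at most e. *)
have c0 : (0 < Cplus * M * tc + 1)%R by rewrite ltr_wpDl.
have e2 : (0 < e / (Cplus * M * tc + 1))%R by rewrite divr_gt0.
have [D [cD ND dD sD]] := @hausdorff_null_cover R _ m.+1 (crack `\` \bigcup_k F k) r eps _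
  (fun x h => Or x (crackO h.1)) HN e0 e2.
have cFD k : compact (F k `|` D k) by exact: compactU.
have [mU tU] := tube_energy_bigcup_le ndJ J0 C0 e0 cFD.
have crackU : crack `<=` \bigcup_k (F k `|` D k).
  move=> x cx; have [[k _ Fx]|nF] := pselect ((\bigcup_k F k) x); first by exists k => //; left.
  by have [|k _ Dx] := ND x; [split|exists k => //; right].
have h1 := failure_energy_le_tube ndJ J0 C0 Omega e0 mU crackU.
apply: (le_trans h1).
apply: (le_trans tU).
apply: (@le_trans _ _ (\sum_(k <oo) (tenergy eps (F k) + tenergy eps (D k)))).
  apply: lee_nneseries => [k _ _|k _]; first exact: tenergy_ge0.
  exact: tube_energyU_le.
rewrite nneseriesD; [|by move=> *; exact: tenergy_ge0..].
apply: leeD.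
  rewrite (hausdorff_decomposition cF Fc tF HN) -nneseriesZl; last by move=> *; exact: hausdorff_measure_ge0.
  apply: lee_nneseries => [k _ _|k _]; first exact: tenergy_ge0.
  have [nu nu1 fl] := fF k.
  exact: (tube_energy_flat_le ndJ J0 J1 JM C0 (cF k) nu1 k01 fl KE e0).
apply: (@le_trans _ _ ((Cplus * M * tc)%:E * \sum_(k <oo) hausdorff_gauge m.+1 (D k))).
  rewrite -nneseriesZl; last by move=> *; exact: hausdorff_gauge_ge0.
  apply: lee_nneseries => [k _ _|k _]; first exact: tenergy_ge0.
  exact: (tube_energy_gauge ndJ J0 J1 JM C0 e0 (cD k) (dD k)).
apply: (le_trans (lee_wpmul2l _ sD)); first by rewrite lee_fin.
rewrite -EFinM lee_fin mulrCA ger_pMr// ler_pdivrMr// mul1r lerDl.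
by [].
Qed.

(** A partial sum over the pieces already exceeds [l], even when the total is infinite, and the
    threshold for eps depends only on finitely many gaps. Positivity of [lower kappa] makes the
    series one of nonnegative terms. *)
Lemma failure_energy_lower (kappa : R) (l : R) : (0 < kappa < 1)%R -> (0 < lower kappa)%R ->
  l%:E < (lower kappa)%:E * H crack -> \forall eps \near (0%R : R)^'+, l%:E < energy eps.
Proof.
move=> k01 lk0 lH.
have [F [cF fF Fc tF HN]] := flat_decomposition ccrack rcrack k01.
have H0 k : 0 <= H (F k) by exact: hausdorff_measure_ge0.
have [N lN] : exists N, l%:E < \sum_(0 <= k < N) (lower kappa)%:E * H (F k).
  apply: contrapT => h; move: lH; rewrite ltNge => /negP; apply.
  rewrite (hausdorff_decomposition cF Fc tF HN) -nneseriesZl//.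
  apply: lime_le.
    by apply: is_cvg_nneseries => k _ _; rewrite mule_ge0// lee_fin ltW.
  by apply: nearW => k; rewrite leNgt; apply/negP => hk; apply: h; exists k.
rewrite big_mkord in lN.
pose E := \big[setU/set0]_(k < N) F k.
have cE : compact E by apply: bigsetU_compact.
have Ec : E `<=` crack by rewrite /E -bigcup_mkord => x [k _ /Fc].
have sep i j : i != j -> \forall eps \near (0%R : R)^'+,
    forall p q, F i p -> F j q -> (eps <= enorm (p - q))%R.
  move=> ij; have [|||r r0 hr] := @compact_closed_separated R _ (F i) (F j).
  - exact: cF.
  - by apply: compact_closed => //; exact: norm_hausdorff.
  - by move/trivIsetP : tF; apply.
  near=> eps => p q Fp Fq; apply: le_trans (hr _ _ Fp Fq).
  by near: eps; exact: nbhs_right_le.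
have far : \forall eps \near (0%R : R)^'+,
    forall p x, E p -> ~ Omega x -> (eps <= enorm (p - x))%R.
  have [|r r0 hr] := @compact_closed_separated R _ E (~` Omega) cE (open_closedC oO).
    by apply/seteqP; split => // x [/Ec/crackO].
  near=> eps => p q Ep Oq; apply: le_trans (hr _ _ Ep Oq).
  by near: eps; exact: nbhs_right_le.
have seps : \forall eps \near (0%R : R)^'+, forall i j : 'I_N, val i != val j ->
    forall p q, F i p -> F j q -> (eps <= enorm (p - q))%R.
  apply: filter_forall => i; apply: filter_forall => j.
  have [ij|ij] := eqVneq (val i) (val j); first by apply: nearW.
  by apply: filterS (sep _ _ ij) => eps h _.
near=> eps.
have e0 : (0 < eps)%R by near: eps; exact: nbhs_right_gt.
have e1 : (0 < eps <= eps)%R by rewrite e0 lexx.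
apply: (lt_le_trans lN).
apply: (@le_trans _ _ (\sum_(k < N) tenergy eps (F k))).
  apply: lee_sum => k _; have [nu nu1 fl] := fF k.
  exact: (le_tube_energy_flat ndJ J0 J1 JM C0 (cF k) nu1 k01 fl KE e0).
apply: (le_trans (sum_le_tube_energy_separated ndJ J0 J1 C0 (r := eps) e1 cF _)).
  move=> i j iN jN ij; have h : forall i j : 'I_N, val i != val j ->
    forall p q, F i p -> F j q -> (eps <= enorm (p - q))%R by near: eps.
  exact: (h (Ordinal iN) (Ordinal jN) ij).
apply: (tube_le_failure_energy ndJ J0 J1 C0 e1 cE Ec).
by near: eps.
Unshelve. all: by end_near. Qed.

Lemma failure_energy_cvg :
  energy eps @[eps --> (0%R : R)^'+] --> (Cplus / w * K)%:E * H crack.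
Proof.
have cw0 : (0 < Cplus / w)%R by rewrite divr_gt0.
have cK0 : (0 < Cplus / w * K)%R by rewrite mulr_gt0.
have idc : continuous (@id R) by move=> x; exact: cvg_id.
have cexp (f : R -> R) : continuous f -> continuous (fun x => f x ^+ m.+1)%R.
  move=> cf x; apply: (continuous_comp (f := f) (g := fun y : R => y ^+ m.+1)%R); first exact: cf.
  exact: exprn_continuous.
have cup : continuous upper.
  move=> x; apply: cvgM; first exact: cvg_cst.
  apply: cvgD; apply: cvgM; try exact: cvg_cst.
    by apply: (cexp (fun k => 1 + k)%R) => y; apply: cvgD; [exact: cvg_cst|exact: idc].
  by apply: cvgM; [apply: cvgM; [exact: cvg_cst|exact: idc]|exact: cvg_cst].
have clo : continuous lower.
  move=> x; apply: cvgM; first exact: cvg_cst.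
  apply: cvgB; apply: cvgM; try exact: cvg_cst.
    by apply: (cexp (fun k => 1 - k)%R) => y; apply: cvgB; [exact: cvg_cst|exact: idc].
  by apply: cvgM; [apply: cvgM; [exact: cvg_cst|exact: idc]|exact: cvg_cst].
(* The two factors are continuous in kappa and agree at 0, which closes the squeeze. *)
have up0 : upper 0 = (Cplus / w * K)%R by rewrite /upper addr0 expr1n; ring.
have lo0 : lower 0 = (Cplus / w * K)%R by rewrite /lower subr0 expr1n; ring.
have HH : 0 <= H crack := hausdorff_measure_ge0 _ _.
apply: ereal_cvg_le_gt.
- by rewrite mule_ge0// lee_fin ltW.
- near=> eps; have e0 : (0 < eps)%R by near: eps; exact: nbhs_right_gt.
  case HE : (H crack) => [h||]; [|by rewrite gt0_muley ?leey// lte_fin|by move: HH; rewrite HE].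
  apply/lee_addgt0Pr => e e1; rewrite /= in e e1 *.
  have h0 : (0 <= h)%R by rewrite -lee_fin -HE.
  have [||k k01 ke] := @continuous_lt_near0 R (fun k => upper k * h)%R (upper 0 * h + e)%R.
  + by move=> x; apply: cvgM; [exact: cup|exact: cvg_cst].
  + by rewrite ltrDl.
  apply: (le_trans (failure_energy_upper k01 e0)).
  by rewrite HE -EFinM -EFinD lee_fin -up0 ltW.
move=> l lL.
have [k k01 /andP[k1 k2]] : exists2 k : R, (0 < k < 1)%R & (0 < lower k)%R && (l%:E < (lower k)%:E * H crack).
  case HE : (H crack) lL => [h||] lL; last by move: HH; rewrite HE.
    (* A single continuous function, negative at 0, encodes both requirements on k: [lower k] is
       positive and [lower k * h] exceeds l. *)
    have [||k k01 ke] := @continuous_lt_near0 R (fun k => Num.max (- lower k) (l - lower k * h))%R 0%R.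
    + move=> x; apply: (@continuous_max _ _ (fun k => - lower k)%R (fun k => l - lower k * h)%R).
        by apply: cvgN; exact: clo.
      by apply: cvgB; [exact: cvg_cst|apply: cvgM; [exact: clo|exact: cvg_cst]].
    + by rewrite gt_max oppr_lt0 lo0 cK0/= subr_lt0 -lte_fin.
    move: ke; rewrite gt_max oppr_lt0 subr_lt0 => /andP[h1 h2].
    by exists k => //; rewrite h1/= -EFinM lte_fin.
  have [||k k01 ke] := @continuous_lt_near0 R (fun k => - lower k)%R 0%R.
  + by move=> x; apply: cvgN; exact: clo.
  + by rewrite oppr_lt0 lo0.
  by rewrite oppr_lt0 in ke; exists k => //; rewrite ke gt0_muley ?ltry// lte_fin.
exact: failure_energy_lower k01 k1 k2.
Unshelve. all: by end_near. Qed.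

End energy_limit.

Section influence_moment.
Context {R : realType}.
Variables (J : R -> R) (M : R).
Hypothesis hJ : influence_function J M.

(* Only the values of J on [0, +oo[ are specified; this extension is monotone on R. *)
Let Jmax (q : R) : R := J (Num.max q 0).

Let J0 q : 0 <= Jmax q.
Proof. by case: hJ => h _ _ _ _; apply: h; rewrite le_max lexx orbT. Qed.

Let JE q : 0 <= q -> Jmax q = J q.
Proof. by move=> q0; rewrite /Jmax max_l. Qed.

Let J1 q : 1 <= q -> Jmax q = 0.
Proof.
case: hJ => _ _ _ _ h q1; rewrite JE; first exact: h.
exact: le_trans q1.
Qed.

Let ndJ : nonincreasing_fun Jmax.
Proof.
case: hJ => _ h _ _ _ p q pq; apply: h; first by rewrite le_max lexx orbT.
by rewrite ge_max !le_max pq lexx !orbT.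
Qed.

Let JM q : Jmax q <= M.
Proof.
case: hJ => _ h _ <- _; apply: h => //.
by rewrite le_max lexx orbT.
Qed.

(** Identifies the constant of the limit as a positive real number. Finiteness, from J <= M on
    [0, 1], is what allows the real integral [I] to be read as an extended one. *)
Lemma influence_moment n (I := \int[lebesgue_measure]_(q in `[0, 1]) (q ^+ n.+1 * J q)) :
  0 < I /\ (\int[lebesgue_rV R n.+1]_x (`|x 0%R ord0| * Jmax (enorm x))%:E =
    (2 * ball_volume R n * I)%:E)%E.
Proof.
have wn : 0 < ball_volume R n by exact: ball_volume_gt0.
have M0 : 0 <= M := le_trans (J0 0) (JM 0).
have IE : I = \int[lebesgue_measure]_(q in `[0, 1]) (q ^+ n.+1 * Jmax q).
  apply: eq_Rintegral => q; rewrite inE/= in_itv/= => /andP[q0 _].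
  by rewrite JE.
have mJ : measurable_fun setT Jmax by exact: nonincreasing_measurable.
have mf : measurable_fun setT (fun q : R => (q ^+ n.+1 * Jmax q)%:E).
  apply/measurable_EFinP/measurable_funM => //; apply: measurable_funX; exact: measurable_id.
have f0 q : `[0, 1]%classic q -> (0 <= (q ^+ n.+1 * Jmax q)%:E)%E.
  by rewrite /= in_itv/= => /andP[q0 _]; rewrite lee_fin mulr_ge0// exprn_ge0.
have Ifin : ((\int[lebesgue_measure]_(q in `[0%R, 1%R]) (q ^+ n.+1 * Jmax q)%:E) \is a fin_num)%E.
  rewrite ge0_fin_numE; last by apply: integral_ge0.
  apply: (@le_lt_trans _ _ (\int[lebesgue_measure]_(q in `[0%R, 1%R]) (cst M%:E q))%E).
    apply: le_integral_nonneg => // q; rewrite /= in_itv/= => /andP[q0 q1].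
    rewrite lee_fin -[M]mul1r; apply: ler_pM => //; first exact: exprn_ge0.
    exact: exprn_ile1.
  rewrite integral_cst//.
  have e1 : (lebesgue_measure (`[0%R, 1%R]%classic : set R) = 1%:E)%E.
    by rewrite lebesgue_measure_itv/= lte_fin ltr01 oppr0 adde0.
  apply: (@le_lt_trans _ _ (M%:E * 1%:E)%E); last by rewrite -EFinM ltry.
  by rewrite -e1.
have IEe : (I%:E = \int[lebesgue_measure]_(q in `[0%R, 1%R]) (q ^+ n.+1 * Jmax q)%:E)%E.
  by rewrite IE /Rintegral fineK.
split.
  have J12 : 0 < Jmax (1 / 2).
    by rewrite JE//; case: hJ => _ _ h _ _; apply: h; rewrite divr_ge0//= ltr_pdivrMr// mul1r ltr1n.
  rewrite -lte_fin IEe.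
  (* On ]0, 1/2[ monotonicity gives J >= J (1/2) > 0, and the remaining power is integrated
     explicitly. *)
  apply: (@lt_le_trans _ _ (\int[lebesgue_measure]_(q in `]0%R, (1 / 2)%R[) (Jmax (1 / 2) * q ^+ n.+1)%:E)%E).
    rewrite integral_monomial//.
    by rewrite lte_fin divr_gt0// mulr_gt0// expr0n/= subr0 exprn_gt0// divr_gt0.
  rewrite integral_mkcond [leRHS]integral_mkcond; apply: le_integral_nonneg => q _.
    rewrite patchE; case: ifPn => // /set_mem; rewrite /= in_itv/= => /andP[q0 _].
    by rewrite lee_fin mulr_ge0// exprn_ge0// ltW.
  rewrite !patchE !mem_setE !in_itv/=; case: ifPn => [/andP[q0 q1]|_]; last first.
    by case: ifPn => // h; apply: f0; rewrite /= in_itv.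
  rewrite (ltW q0) (ltW (lt_trans q1 _))/= ?ltr_pdivrMr ?mul1r ?ltr1n//.
  rewrite lee_fin mulrC; apply: ler_wpM2l; first by rewrite exprn_ge0// ltW.
  by apply: ndJ; move: q1; rewrite ?div1r => /ltW.
rewrite (integral_radial_abs _ ndJ J0 J1) EFinM IEe.
rewrite -ge0_integralZl//; last 2 first.
- exact: measurable_funTS.
- by rewrite lee_fin mulr_ge0// ltW.
rewrite [RHS]integral_mkcond; apply: eq_integral => q _; rewrite patchE mem_setE in_itv/=.
have [q0|q0] := leP 0 q; last by rewrite expr0n/= mulr0 mul0r.
rewrite andTb; case: ifPn => [_|]; first by rewrite -EFinM mulrA.
by rewrite -ltNge => /ltW/J1 ->; rewrite mulr0.
Qed.

Lemma failure_energy_influence d (Omega crack : set 'rV[R]_d) Cplus eps : 0 < eps ->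
  failure_energy Omega J Cplus (failure_set Omega crack eps) eps =
  failure_energy Omega Jmax Cplus (failure_set Omega crack eps) eps.
Proof.
move=> e0; apply: eq_integral => x _; apply: eq_integral => y _.
by rewrite /kernel_rho JE// divr_ge0 ?enorm_ge0// ltW.
Qed.

Lemma failure_energy_limit m (Omega crack : set 'rV[R]_m.+2) (Cplus : R) :
  bounded_domain Omega -> 0 < Cplus -> crack `<=` Omega ->
  (hausdorff_measure m.+1).-caratheodory crack -> rectifiable crack ->
  failure_energy Omega J Cplus (failure_set Omega crack eps) eps
    @[eps --> (0 : R)^'+] -->
  ((energy_release_rate m.+2 J Cplus)%:E * hausdorff_measure m.+1 crack)%E.
Proof.
move=> [_ oO _ bO] C0 cO cc rc.
have [I0 KE] := influence_moment m.+1.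
have K0 : 0 < 2 * ball_volume R m.+1 *
    \int[lebesgue_measure]_(q in `[0, 1]) (q ^+ m.+2 * J q).
  by rewrite mulr_gt0// mulr_gt0// ball_volume_gt0.
have := failure_energy_cvg ndJ J0 J1 JM C0 K0 KE oO bO cO cc rc.
rewrite (_ : energy_release_rate m.+2 J Cplus = Cplus / ball_volume R m.+2 *
  (2 * ball_volume R m.+1 * \int[lebesgue_measure]_(q in `[0, 1]) (q ^+ m.+2 * J q))); last first.
  by rewrite /energy_release_rate/=; ring.
apply: cvg_trans; apply: near_eq_cvg; near=> eps.
by apply/esym/failure_energy_influence; near: eps; exact: nbhs_right_gt.
Unshelve. all: by end_near. Qed.

End influence_moment.

Theorem mainTheorem8 (R : realType) (d : nat) (hd : d = 2%N \/ d = 3%N)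
    (Omega : set 'rV[R]_d) (hOmega : bounded_domain Omega)
    (Cplus : R) (hC : 0 < Cplus)
    (J : R -> R) (M : R) (hJ : influence_function J M)
    (crack : set 'rV[R]_d) (hsub : crack `<=` Omega)
    (hmeas : (hausdorff_measure d.-1).-caratheodory crack)
    (hrect : rectifiable crack) :
  failure_energy Omega J Cplus (failure_set Omega crack eps) eps
    @[eps --> (0 : R)^'+] -->
  ((energy_release_rate d J Cplus)%:E * hausdorff_measure d.-1 crack)%E.
Proof.
case: hd => hd; subst d; exact: (failure_energy_limit hJ).
Qed.
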